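(* Let $(M,\omega)$ be a symplectic manifold without boundary and let $\{\phi_t\}_{0\le t\le1}$ be an isotopy in $\mathrm{Ham}^c(M)$ generated by a Hamiltonian $H_t$, $0\le t\le 1$, which has at least one fixed minimum and at least one fixed maximum. If $\{\phi_t\}$ is a smooth point of the length functional $\mathcal L$, then there exist a fixed minimum $p$ and a fixed maximum $P$ such that $$\bigcap_{t\in[0,1]}\mathrm{minset}\,H_t=\{p\}\quad\text{and}\quad\bigcap_{t\in[0,1]}\mathrm{maxset}\,H_t=\{P\},$$ and such that $\mathrm{minset}\,H_t=\{p\}$ and $\mathrm{maxset}\,H_t=\{P\}$ hold for all $t\in[0,1]$ except on a subset of measure $0$.
   Context: $\mathrm{Ham}^c(M)$ is the group of compactly supported Hamiltonian symplectomorphisms of $(M,\omega)$. The generating Hamiltonian $H_t$ of a $C^\infty$ path $\{\phi_t\}_{t\in[0,1]}$ in $\mathrm{Ham}^c(M)$ (unique up to adding a constant for each $t$) is defined by $\frac{d}{dt}\phi_t(x)=X_{H_t}(\phi_t(x))$, where $\omega(X_{H_t},\cdot)=dH_t$. The Hofer length is $\mathcal L(\{\phi_t\})=\int_0^1(\sup_M H_t-\inf_M H_t)\,dt$. $\mathrm{minset}\,H_t=\{x\in M: H_t(x)=\min H_t\}$ and $\mathrm{maxset}\,H_t=\{x\in M: H_t(x)=\max H_t\}$. A fixed minimum is a point of $\bigcap_{t\in[0,1]}\mathrm{minset}\,H_t$; a fixed maximum is a point of $\bigcap_{t\in[0,1]}\mathrm{maxset}\,H_t$. A tangent vector field along a path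 $\gamma=\{\phi_t\}_{t\in[0,1]}$ is a smooth family $\{G_t\}_{0\le t\le1}$ of compactly supported functions on $M$ with $G_0=G_1=0$ (normalised by $\int_M G_t\,\omega^n=0$ when $M$ is compact, $\dim M=2n$). Put $\gamma_\varepsilon=\{\phi_{\varepsilon G_t}\circ\phi_t\}_{t\in[0,1]}$, where, for each fixed $t$, $\phi_{\varepsilon G_t}$ is the time-$1$ map of the flow of the autonomous Hamiltonian $\varepsilon G_t$. The path $\gamma$ is a smooth point of $\mathcal L$ if, for all tangent vector fields $\{G_t\}$ along $\gamma$, the function $\varepsilon\mapsto\mathcal L(\gamma_\varepsilon)$ is differentiable at $\varepsilon=0$. *)

(* Defs.v *)
From HB Require Import structures.
From mathcomp Require Import all_boot all_order all_algebra all_fingroup.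
From mathcomp Require Import all_classical all_reals all_analysis.

Set Implicit Arguments.
Unset Strict Implicit.
Unset Printing Implicit Defensive.

Import Order.TTheory GRing.Theory Num.Theory.
Import numFieldNormedType.Exports.

Local Open Scope classical_set_scope.
Local Open Scope ring_scope.

Section Smoothness.
Context {R : realType} {V W : normedModType R}.

(* For finite-dimensional V and open U this is the usual C^k: all iterated
   directional derivatives of order at most k exist and the ones of order k are
   continuous on U. *)
Fixpoint Ck (k : nat) (U : set V) (f : V -> W) : Prop :=
  match k with
  | 0%N => forall x, U x -> {for x, continuous f}
  | k'.+1 => (forall x v, U x -> derivable f x v) /\
             (forall v, Ck k' U (fun x => 'D_v f x))
  end.

(* Smoothness at x of the restriction of f to an arbitrary set A: f agrees on A
   with a function that is smooth on a neighbourhood of x.  With A = setT this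
   is ordinary smoothness near x; other sets A are needed for the end points of
   the time interval [0, 1]. *)
Definition smooth_at (A : set V) (f : V -> W) (x : V) : Prop :=
  exists (U : set V) (g : V -> W),
    [/\ open U, U x, forall k, Ck k U g & forall y, U y -> A y -> f y = g y].

End Smoothness.

(* The atlas need not be maximal.  [to_coord c] and [of_coord c] are only
   meaningful on [chart_dom c] and [chart_img c]. *)
Record manifold (R : realType) (m : nat) := Manifold {
  mcarrier :> topologicalType;
  chart : Type;
  chart_dom : chart -> set mcarrier;
  chart_img : chart -> set 'rV[R]_m;
  to_coord : chart -> mcarrier -> 'rV[R]_m;
  of_coord : chart -> 'rV[R]_m -> mcarrier;
  open_chart_dom : forall c, open (chart_dom c);
  open_chart_img : forall c, open (chart_img c);
  to_coord_img : forall c x, chart_dom c x -> chart_img c (to_coord c x);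
  of_coord_dom : forall c y, chart_img c y -> chart_dom c (of_coord c y);
  to_coordK : forall c x, chart_dom c x -> of_coord c (to_coord c x) = x;
  of_coordK : forall c y, chart_img c y -> to_coord c (of_coord c y) = y;
  to_coord_cont :
    forall c x, chart_dom c x -> {for x, continuous (to_coord c)};
  of_coord_cont :
    forall c y, chart_img c y -> {for y, continuous (of_coord c)};
  chart_cover : forall x, exists c, chart_dom c x;
  transition_smooth : forall c d y, chart_img c y ->
    chart_dom d (of_coord c y) ->
    smooth_at setT (fun z => to_coord d (of_coord c z)) y;
  manifold_hausdorff : hausdorff_space mcarrier;
  manifold_second_countable : @second_countable mcarrier
}.

Arguments chart {R m} _.
Arguments chart_dom {R m _} _ _.
Arguments chart_img {R m _} _ _.
Arguments to_coord {R m _} _ _.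
Arguments of_coord {R m _} _ _.

Definition bilin {R : realType} {m : nat} (A : 'M[R]_m) (v w : 'rV[R]_m) : R :=
  (v *m A *m w^T) 0 0.

(* In the chart c, at the point with coordinates y, the 2-form evaluates on the
   coordinate vectors v and w as [bilin (form c y) v w]; [form_pullback] says
   that these local expressions define one 2-form, and [form_closed] is
   d omega (u, v, w) = 0 for constant coordinate fields. *)
Record symplectic_manifold (R : realType) (n : nat) := SymplecticManifold {
  smanifold :> manifold R (n + n);
  form : chart smanifold -> 'rV[R]_(n + n) -> 'M[R]_(n + n);
  form_smooth : forall c y, chart_img c y ->
    forall i j, smooth_at setT (fun z => form c z i j : R) y;
  form_alternating : forall c y, chart_img c y ->
    forall v, bilin (form c y) v v = 0;
  form_nondegenerate : forall c y, chart_img c y ->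
    forall v, (forall w, bilin (form c y) v w = 0) -> v = 0;
  form_closed : forall c y, chart_img c y -> forall u v w,
    'D_u (fun z => bilin (form c z) v w : R) y +
    'D_v (fun z => bilin (form c z) w u : R) y +
    'D_w (fun z => bilin (form c z) u v : R) y = 0;
  form_pullback : forall c d y, chart_img c y ->
    chart_dom d (of_coord c y) -> forall v w,
    bilin (form c y) v w =
    bilin (form d (to_coord d (of_coord c y)))
          ('D_v (fun z => to_coord d (of_coord c z)) y)
          ('D_w (fun z => to_coord d (of_coord c z)) y)
}.

Section Integration.
Context {R : realType}.

(* Iterated Lebesgue integral over R^m; it is only applied to continuous
   functions with compact support, where it is the Lebesgue integral. *)
Fixpoint integral_rV (m : nat) : ('rV[R]_m -> R) -> R :=
  match m with
  | 0%N => fun f => f 0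
  | m'.+1 => fun f =>
      (\int[@lebesgue_measure R]_x
         integral_rV (fun y : 'rV[R]_m' =>
           f (row_mx (x%:M : 'rV[R]_1) y : 'rV[R]_(1 + m'))))%R
  end.

Context {n : nat} (M : symplectic_manifold R n).

Definition smooth_function (f : M -> R) : Prop :=
  forall (c : chart M) y, chart_img c y ->
    smooth_at setT (fun z => f (of_coord c z) : R) y.

(* The absolute value of omega^n evaluated on the coordinate frame.  Pairing the
   indices i and n + i instead of 2i and 2i+1 only changes the sign of the
   sum. *)
Definition liouville_density (c : chart M) (y : 'rV[R]_(n + n)) : R :=
  `| 2 ^- n * \sum_(s : 'S_(n + n)) (-1) ^+ s *
       \prod_(i < n) form c y (s (lshift n i)) (s (rshift n i)) |.

(* [liouville_integral f v]: M being oriented by omega^n, the integral over M of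
   f omega^n, computed with a finite smooth partition of unity subordinate to
   charts, is v.  It is used for compact M only. *)
Definition liouville_integral (f : M -> R) (v : R) : Prop :=
  exists (k : nat) (c : 'I_k -> chart M) (rho : 'I_k -> M -> R),
    [/\ forall i, smooth_function (rho i),
        forall i x, 0 <= rho i x,
        forall i, exists K : set M,
          [/\ compact K, K `<=` chart_dom (c i) &
              forall x, ~ K x -> rho i x = 0],
        forall x, \sum_(i < k) rho i x = 1 &
        v = \sum_(i < k) integral_rV (fun y =>
              if `[< chart_img (c i) y >] then
                rho i (of_coord (c i) y) * f (of_coord (c i) y) *
                liouville_density (c i) y
              else 0)].

End Integration.

Section Hamiltonian.
Context {R : realType} {n : nat} (M : symplectic_manifold R n).

Local Notation I01 := (`[0, 1]%classic : set R).

Definition smooth_family (H : R -> M -> R) : Prop :=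
  forall (c : chart M) t y, I01 t -> chart_img c y ->
    smooth_at (I01 `*` setT)
      (fun z : R * 'rV[R]_(n + n) => H z.1 (of_coord c z.2) : R) (t, y).

Definition smooth_isotopy (phi : R -> M -> M) : Prop :=
  forall (c d : chart M) t y, I01 t -> chart_img c y ->
    chart_dom d (phi t (of_coord c y)) ->
    (\forall z \near within (I01 `*` setT) (nbhs (t, y)),
       chart_dom d (phi z.1 (of_coord c z.2))) /\
    smooth_at (I01 `*` setT)
      (fun z : R * 'rV[R]_(n + n) => to_coord d (phi z.1 (of_coord c z.2)))
      (t, y).

(* The curve g, with times in A, stays in the domain of the chart c for times
   near t and its velocity at t (one-sided at an end point of A) has
   coordinates v. *)
Definition has_velocity (A : set R) (g : R -> M) (t : R) (c : chart M)
    (v : 'rV[R]_(n + n)) : Prop :=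
  (\forall s \near within A (nbhs t), chart_dom c (g s)) /\
  (h^-1 *: (to_coord c (g (t + h)) - to_coord c (g t)))
    @[h --> within [set h | A (t + h)] (0 : R)^'] --> v.

(* v is the coordinate expression at x of X_F, where omega (X_F, .) = dF. *)
Definition is_ham_vector (F : M -> R) (c : chart M) (x : M)
    (v : 'rV[R]_(n + n)) : Prop :=
  forall w, bilin (form c (to_coord c x)) v w =
            'D_w (fun z => F (of_coord c z) : R) (to_coord c x).

Definition ham_orbit (A : set R) (F : R -> M -> R) (g : R -> M) : Prop :=
  forall t, A t -> forall c : chart M, chart_dom c (g t) ->
    exists v, has_velocity A g t c v /\ is_ham_vector (F t) c (g t) v.

Definition generates (H : R -> M -> R) (phi : R -> M -> M) : Prop :=
  smooth_family H /\ forall x, ham_orbit I01 H (fun t => phi t x).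

Definition compactly_supported_family (H : R -> M -> R) : Prop :=
  exists2 K : set M, compact K &
    forall t x, I01 t -> ~ K x -> H t x = 0.

Definition Ham_c (psi : M -> M) : Prop :=
  exists (F : R -> M -> R) (phi : R -> M -> M),
    [/\ compactly_supported_family F, smooth_isotopy phi, generates F phi,
        phi 0 = id & phi 1 = psi].

(* C^infty paths in Ham^c(M); they need not start at the identity. *)
Definition Ham_c_path (phi : R -> M -> M) : Prop :=
  [/\ forall t, I01 t -> Ham_c (phi t),
      smooth_isotopy phi &
      exists2 K : set M, compact K &
        forall t x, I01 t -> ~ K x -> phi t x = x].

(* l is the Hofer length of the path phi. *)
Definition hofer_length (phi : R -> M -> M) (l : R) : Prop :=
  exists2 H : R -> M -> R, generates H phi &
    (\int[@lebesgue_measure R]_(t in I01)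
       (ereal_sup [set (H t x)%:E | x in [set: M]] -
        ereal_inf [set (H t x)%:E | x in [set: M]]) = l%:E)%E.

Definition min_set (F : M -> R) : set M := [set x | forall y, F x <= F y].
Definition max_set (F : M -> R) : set M := [set x | forall y, F y <= F x].

Definition fixed_minima (H : R -> M -> R) : set M :=
  \bigcap_(t in I01) min_set (H t).
Definition fixed_maxima (H : R -> M -> R) : set M :=
  \bigcap_(t in I01) max_set (H t).

Definition tangent_field (G : R -> M -> R) : Prop :=
  [/\ smooth_family G,
      compactly_supported_family G,
      forall x, G 0 x = 0,
      forall x, G 1 x = 0 &
      compact [set: M] -> forall t, I01 t -> liouville_integral (G t) 0].

Definition is_flow (F : M -> R) (Phi : R -> M -> M) : Prop :=
  forall x, Phi 0 x = x /\ ham_orbit setT (fun=> F) (fun s => Phi s x).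

(* psi is the path { phi_(eps G_t) o phi_t }. *)
Definition is_deformation (phi : R -> M -> M) (G : R -> M -> R) (eps : R)
    (psi : R -> M -> M) : Prop :=
  forall t, I01 t -> exists2 Phi : R -> M -> M,
    is_flow (fun x => eps * G t x) Phi & forall x, psi t x = Phi 1 (phi t x).

(* l is the function eps |-> L(gamma_eps); gamma_eps and its length are uniquely
   determined on a connected manifold. *)
Definition smooth_point (phi : R -> M -> M) : Prop :=
  forall G, tangent_field G ->
    exists (gamma : R -> R -> M -> M) (l : R -> R),
      (forall eps, is_deformation phi G eps (gamma eps) /\
                   hofer_length (gamma eps) (l eps)) /\
      derivable l 0 1.

End Hamiltonian.

(* Main.v *)
(* Let g be a smooth function with compact support in one chart, with integral 0
   when M is compact, and put a t = t (1 - t).  Writing Psi_t for the time-1 map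
   of the flow of eps a(t) g, the path Psi_t o phi_t is generated by
     H^eps_t(Psi_t x) = H_t(x) + eps a'(t) g(x) + (a constant),
   so that at a maximum Q and a minimum q of H_t the oscillation of H^eps_t is
   at least osc H_t + eps a'(t) (g Q - g q).  Adding the inequalities for eps and
   - eps, with Q and q free, the second difference of the length at 0 is at least
   eps times the integral of |a'(t)| times the sum of the oscillations of g on
   maxset H_t and on minset H_t.  Differentiability makes it o(eps), hence g is
   constant on maxset H_t and on minset H_t for almost all t.  Countably many such
   g separate a given point from all others, and the theorem follows.

   The displayed formula is proved without differentiating the flow Psi_t in its
   initial point: the flow preserves omega on small differences up to first order,
   which is a Gronwall estimate in coordinates and is enough to see that the
   difference of the two sides is locally constant on M. *)
Require Import Defs.
From HB Require Import structures.
From mathcomp Require Import all_boot all_order all_algebra all_fingroup.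
From mathcomp Require Import all_classical all_reals all_analysis.
From mathcomp Require Import measurable_realfun ring lra.

Set Implicit Arguments.
Unset Strict Implicit.
Unset Printing Implicit Defensive.

Import Order.TTheory GRing.Theory Num.Theory.
Import numFieldNormedType.Exports.

Local Open Scope classical_set_scope.
Local Open Scope ring_scope.

Implicit Types R : realType.

(** * Iterated directional derivatives *)

(** The displayed formula is an identity between functions of a point, whereas the equations of
    motion only speak about points of the form phi_t(x0). So phi_t has to be surjective. This is
    obtained without an inverse isotopy: openness of phi_t at a point is propagated in time from
    phi_0 = id, and connectedness of M does the rest. The flow of a bump function is not constructed
    either: the smooth point hypothesis supplies deformations for every eps, and one of them
    contains that flow. The factor a(t) = t (1 - t) vanishes at both ends of [0, 1], as a tangent
    field must, while a'(t) = 1 - 2 t vanishes at the single time 1/2. On a compact M one bump need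
    not have integral 0. Two concentric bumps are combined so that the integrals cancel; if the
    second is narrow enough to have a strictly smaller integral, the two coefficients do not add up
    to 0 and the combination is still nonzero at the centre. *)

Definition smooth_on R (V W : normedModType R) (U : set V)
  (f : V -> W) := forall k, Ck k U f.

Lemma near_open (T : topologicalType) (U : set T) (x : T) (P : T -> Prop) :
  open U -> U x -> (forall y, U y -> P y) -> \forall y \near x, P y.
Proof. by move=> oU Ux UP; apply: filterS UP _; exact: open_nbhs_nbhs. Qed.

Lemma Ck_eq R (V W : normedModType R) k (U : set V) (f g : V -> W) :
  open U -> (forall x, U x -> f x = g x) -> Ck k U f -> Ck k U g.
Proof.
move=> oU; elim: k f g => [|k IH] f g fg /=.
  move=> cf x Ux; rewrite /prop_for /continuous_at -(fg x Ux).
  apply: cvg_trans (cf _ Ux); apply: near_eq_cvg.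
  by apply: near_open oU Ux _ => y /fg.
have nfg x : U x -> \forall y \near x, f y = g y.
  by move=> Ux; apply: near_open oU Ux _.
move=> [df Df]; split.
  by move=> x v Ux; apply: near_eq_derivable (df _ v Ux) => //; exact: nfg.
move=> v; apply: IH (Df v) => x Ux.
by apply: near_eq_derive; exact: nfg.
Qed.

Lemma CkW R (V W : normedModType R) k (U U' : set V) (f : V -> W) :
  U' `<=` U -> Ck k U f -> Ck k U' f.
Proof.
move=> UU; elim: k f => [|k IH] f /=; first by move=> cf x /UU; exact: cf.
by move=> [df Df]; split => [x v /UU|v]; [exact: df|exact: IH].
Qed.

(** [Ck k] states continuity for the derivatives of order exactly k. Asking for all orders up to k
    puts the continuity of the lower ones at the disposal of the inductions for sums, products and
    inverses. *)
Definition CkS R (V W : normedModType R) k (U : set V) (f : V -> W) :=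
  forall j, (j <= k)%N -> Ck j U f.

Lemma CkSP R (V W : normedModType R) k (U : set V) (f : V -> W) :
  CkS k.+1 U f -> forall v, CkS k U (fun x => 'D_v f x).
Proof. by move=> cf v j jk; exact: (proj2 (cf j.+1 _)). Qed.

Lemma CkSW R (V W : normedModType R) k (U : set V) (f : V -> W) :
  CkS k.+1 U f -> CkS k U f.
Proof. by move=> cf j jk; apply: cf; exact: leqW. Qed.

Lemma CkS_derivable R (V W : normedModType R) k (U : set V)
  (f : V -> W) x v : CkS k.+1 U f -> U x -> derivable f x v.
Proof. by move=> cf Ux; exact: (proj1 (cf 1%N _)). Qed.

Lemma CkSS R (V W : normedModType R) k (U : set V) (f : V -> W) :
  Ck 0 U f -> (forall x v, U x -> derivable f x v) ->
  (forall v, CkS k U (fun x => 'D_v f x)) -> CkS k.+1 U f.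
Proof.
move=> c0 df Df [|j] jk//; split => // v.
exact: Df.
Qed.

Lemma CkS_eq R (V W : normedModType R) k (U : set V) (f g : V -> W) :
  open U -> (forall x, U x -> f x = g x) -> CkS k U f -> CkS k U g.
Proof. by move=> oU fg cf j jk; apply: Ck_eq (cf j jk). Qed.

Lemma smooth_CkS R (V W : normedModType R) (U : set V) (f : V -> W) :
  smooth_on U f <-> forall k, CkS k U f.
Proof. by split=> [sf k j _//|cf k]; exact: (cf k k). Qed.

Lemma CkS_cst R (V W : normedModType R) (U : set V) (a : W) k :
  CkS k U (fun=> a).
Proof.
move=> j _; elim: j a => [|j IH] a; first by move=> x _; exact: cst_continuous.
split=> [x v _|v]; first exact: derivable_cst.
have -> : (fun x => 'D_v (fun=> a) x) = (fun=> 0) :> (V -> W).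
  by apply/funext => x; exact: derive_cst.
exact: IH.
Qed.

Lemma CkSD R (V W : normedModType R) (U : set V) k (f g : V -> W) :
  open U -> CkS k U f -> CkS k U g -> CkS k U (fun x => f x + g x).
Proof.
move=> oU; elim: k f g => [|k IH] f g cf cg.
  by case=> // _ x Ux; apply: continuousD; [exact: (cf 0%N)|exact: (cg 0%N)].
apply: CkSS.
- by move=> x Ux; apply: continuousD; [exact: (cf 0%N)|exact: (cg 0%N)].
- by move=> x v Ux; apply: derivableD; [exact: (CkS_derivable cf)|exact: (CkS_derivable cg)].
- move=> v; apply: (@CkS_eq _ _ _ _ _ (fun x => 'D_v f x + 'D_v g x)) => //.
    by move=> x Ux; rewrite -deriveD//; [exact: (CkS_derivable cf)|exact: (CkS_derivable cg)].
  by apply: IH; exact: CkSP.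
Qed.

Lemma CkSM R (V : normedModType R) (U : set V) k (f g : V -> R) :
  open U -> CkS k U f -> CkS k U g -> CkS k U (fun x => f x * g x).
Proof.
move=> oU; elim: k f g => [|k IH] f g cf cg.
  by case=> // _ x Ux; apply: continuousM; [exact: (cf 0%N)|exact: (cg 0%N)].
apply: CkSS.
- by move=> x Ux; apply: continuousM; [exact: (cf 0%N)|exact: (cg 0%N)].
- by move=> x v Ux; apply: derivableM; [exact: (CkS_derivable cf)|exact: (CkS_derivable cg)].
- move=> v; apply: (@CkS_eq _ _ _ _ _ (fun x => f x * 'D_v g x + g x * 'D_v f x)) => //.
    by move=> x Ux; rewrite -deriveM//; [exact: (CkS_derivable cf)|exact: (CkS_derivable cg)].
  by apply: CkSD => //; apply: IH; try exact: CkSW; exact: CkSP.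
Qed.

Lemma CkSV R (V : normedModType R) (U : set V) k (f : V -> R) :
  open U -> (forall x, U x -> f x != 0) -> CkS k U f ->
  CkS k U (fun x => (f x)^-1).
Proof.
move=> oU f0; elim: k => [|k IH] cf.
  by case=> // _ x Ux; apply: continuousV; [exact: f0|exact: (cf 0%N)].
apply: CkSS.
- by move=> x Ux; apply: continuousV; [exact: f0|exact: (cf 0%N)].
- by move=> x v Ux; apply: derivableV; [exact: f0|exact: (CkS_derivable cf)].
- move=> v; apply: (@CkS_eq _ _ _ _ _
     (fun x => (-1 * 'D_v f x) * ((f x)^-1 * (f x)^-1))) => //.
    move=> x Ux; rewrite deriveV ?f0//; last exact: (CkS_derivable cf).
    by rewrite expr2 invfM /GRing.scale/=; ring.
  have IHk := IH (CkSW cf).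
  apply: CkSM => //; last exact: CkSM.
  by apply: CkSM => //; [exact: CkS_cst|exact: CkSP].
Qed.

Lemma smooth_on_eq R (V W : normedModType R) (U : set V) (f g : V -> W) :
  open U -> (forall x, U x -> f x = g x) -> smooth_on U f -> smooth_on U g.
Proof. by move=> oU fg sf k; apply: Ck_eq (sf k). Qed.

Lemma smooth_onW R (V W : normedModType R) (U U' : set V) (f : V -> W) :
  U' `<=` U -> smooth_on U f -> smooth_on U' f.
Proof. by move=> UU sf k; apply: CkW (sf k). Qed.

Lemma smooth_cst R (V W : normedModType R) (U : set V) (a : W) :
  smooth_on U (fun=> a).
Proof. by apply/smooth_CkS => k; exact: CkS_cst. Qed.

Lemma smoothD R (V W : normedModType R) (U : set V) (f g : V -> W) :
  open U -> smooth_on U f -> smooth_on U g -> smooth_on U (fun x => f x + g x).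
Proof.
move=> oU /smooth_CkS cf /smooth_CkS cg; apply/smooth_CkS => k; exact: CkSD.
Qed.

Lemma smoothM R (V : normedModType R) (U : set V) (f g : V -> R) :
  open U -> smooth_on U f -> smooth_on U g -> smooth_on U (fun x => f x * g x).
Proof.
move=> oU /smooth_CkS cf /smooth_CkS cg; apply/smooth_CkS => k; exact: CkSM.
Qed.

Lemma smoothN R (V : normedModType R) (U : set V) (f : V -> R) :
  open U -> smooth_on U f -> smooth_on U (fun x => - f x).
Proof.
move=> oU sf; apply: (smooth_on_eq oU (f := fun x => -1 * f x)).
  by move=> x _; rewrite mulN1r.
by apply: smoothM => //; exact: smooth_cst.
Qed.

Lemma smoothB R (V : normedModType R) (U : set V) (f g : V -> R) :
  open U -> smooth_on U f -> smooth_on U g -> smooth_on U (fun x => f x - g x).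
Proof. by move=> oU sf sg; apply: smoothD => //; exact: smoothN. Qed.

Lemma smoothV R (V : normedModType R) (U : set V) (f : V -> R) :
  open U -> (forall x, U x -> f x != 0) -> smooth_on U f ->
  smooth_on U (fun x => (f x)^-1).
Proof.
by move=> oU f0 /smooth_CkS cf; apply/smooth_CkS => k; exact: CkSV.
Qed.

Lemma smooth_sum R (V W : normedModType R) (U : set V) (I : Type)
    (s : seq I) (P : pred I) (f : I -> V -> W) :
  open U -> (forall i, P i -> smooth_on U (f i)) ->
  smooth_on U (fun x => \sum_(i <- s | P i) f i x).
Proof.
move=> oU sf; elim: s => [|i s IH].
  by apply: smooth_on_eq (@smooth_cst R V W U 0) => // x _; rewrite big_nil.
case Pi : (P i).
  apply: smooth_on_eq (smoothD oU (sf i Pi) IH) => // x _.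
  by rewrite big_cons Pi.
by apply: smooth_on_eq IH => // x _; rewrite big_cons Pi.
Qed.

Lemma smooth_prod R (V : normedModType R) (U : set V) (I : Type)
    (s : seq I) (P : pred I) (f : I -> V -> R) :
  open U -> (forall i, P i -> smooth_on U (f i)) ->
  smooth_on U (fun x => \prod_(i <- s | P i) f i x).
Proof.
move=> oU sf; elim: s => [|i s IH].
  by apply: smooth_on_eq (@smooth_cst R V R U 1) => // x _; rewrite big_nil.
case Pi : (P i).
  apply: smooth_on_eq (smoothM oU (sf i Pi) IH) => // x _.
  by rewrite big_cons Pi.
by apply: smooth_on_eq IH => // x _; rewrite big_cons Pi.
Qed.

Lemma smooth_derive R (V W : normedModType R) (U : set V)
  (f : V -> W) v : smooth_on U f -> smooth_on U (fun x => 'D_v f x).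
Proof. by move=> sf k; exact: (proj2 (sf k.+1)). Qed.

Lemma smooth_derivable R (V W : normedModType R) (U : set V)
  (f : V -> W) x v : smooth_on U f -> U x -> derivable f x v.
Proof. by move=> sf Ux; exact: (proj1 (sf 1%N)). Qed.

Lemma smooth_continuous R (V W : normedModType R) (U : set V)
  (f : V -> W) x : smooth_on U f -> U x -> {for x, continuous f}.
Proof. by move=> sf Ux; exact: (sf 0%N). Qed.

Lemma smooth_on_setU R (V W : normedModType R) (U U' : set V)
  (f : V -> W) : smooth_on U f -> smooth_on U' f -> smooth_on (U `|` U') f.
Proof.
move=> sU sU' k; elim: k f sU sU' => [|k IH] f sU sU' /=.
  by move=> x []; [exact: (sU 0%N)|exact: (sU' 0%N)].
split=> [x v [Ux|Ux]|v].
- exact: (proj1 (sU 1%N)) Ux.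
- exact: (proj1 (sU' 1%N)) Ux.
- by apply: IH; exact: smooth_derive.
Qed.

(** With [l] the linear part of the affine map [a], the difference quotients of [f \o a] are
    literally difference quotients of [f]. Slices of and projections from R x V are handled this
    way, without a chain rule. *)
Lemma smooth_affine R (V V' W : normedModType R) (U : set V')
    (f : V' -> W) (a : V -> V') (l : V -> V') :
  continuous a -> (forall x v h, a (h *: v + x) = h *: l v + a x) ->
  smooth_on U f -> smooth_on (a @^-1` U) (f \o a).
Proof.
move=> ca al sf k; elim: k f sf => [|k IH] f sf.
  move=> x Ux; apply: continuous_comp; first exact: ca.
  exact: smooth_continuous sf Ux.
have E x v : (fun h : R => h^-1 *: ((f \o a \o shift x) (h *: v) - (f \o a) x)) =
             (fun h : R => h^-1 *: ((f \o shift (a x)) (h *: l v) - f (a x))).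
  by apply/funext => h /=; rewrite al.
have D x v : 'D_v (f \o a) x = 'D_(l v) f (a x) by rewrite /derive E.
split=> [x v Ux|v].
  by rewrite /derivable E; exact: (proj1 (sf 1%N)).
rewrite (_ : (fun x => _) = (fun x => 'D_(l v) f x) \o a); last first.
  by apply/funext => x /=; exact: D.
by apply: IH; exact: smooth_derive.
Qed.

Lemma is_derive_line R (V W : normedModType R)
    (f : V -> W) (x v : V) (d : W) :
  is_derive x v f d <-> is_derive (0 : R) 1 (fun h : R => f (h *: v + x)) d.
Proof.
have E : (fun h : R => h^-1 *: (((fun h : R => f (h *: v + x)) \o shift 0) (h *: 1) - f (0 *: v + x)))
  = (fun h : R => h^-1 *: ((f \o shift x) (h *: v) - f x)).
  by apply/funext => h /=; rewrite scale0r add0r addr0 [_%:A]mulr1.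
by split=> -[df <-]; split; move: df; rewrite /derivable /derive E.
Qed.

Lemma is_derive_comp1 R (V : normedModType R) (psi : R -> R)
    (f : V -> R) (x v : V) (d e : R) :
  is_derive x v f d -> is_derive (f x) 1 psi e ->
  is_derive x v (psi \o f) (e * d).
Proof.
move=> /is_derive_line fd pe; apply/is_derive_line.
by apply: (@is_derive1_comp R psi (fun h => f (h *: v + x))) => //; rewrite scale0r add0r.
Qed.

Lemma smooth_comp1 R (V : normedModType R) (U : set V)
    (psi : R -> R) (f : V -> R) :
  open U -> smooth_on setT psi -> smooth_on U f -> smooth_on U (psi \o f).
Proof.
move=> oU sp sf; apply/smooth_CkS => k; elim: k psi sp => [|k IH] psi sp.
  case=> // _ x Ux; apply: continuous_comp; first exact: (smooth_continuous sf).
  exact: (smooth_continuous sp).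
have D x v : U x -> is_derive x v (psi \o f) (('D_1 psi (f x)) * 'D_v f x).
  move=> Ux; apply: is_derive_comp1; apply: derivableP.
    exact: (smooth_derivable sf).
  exact: (smooth_derivable sp).
apply: CkSS.
- move=> x Ux; apply: continuous_comp; first exact: (smooth_continuous sf).
  exact: (smooth_continuous sp).
- by move=> x v Ux; have [] := D x v Ux.
- move=> v; apply: (@CkS_eq _ _ _ _ _ (fun x => 'D_1 psi (f x) * 'D_v f x)) => //.
    by move=> x Ux; have [_ ->] := D x v Ux.
  apply: CkSM => //.
    have sp' : smooth_on setT ('D_1 psi) by exact: smooth_derive.
    exact: (IH _ sp').
  exact: (proj1 (smooth_CkS _ _) (smooth_derive v sf)).
Qed.

Lemma derive_scale1 R (W : normedModType R) (f : R -> W) (x v : R) :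
  derivable f x 1 -> is_derive x v f (v *: 'D_1 f x).
Proof.
move=> df; have df' : differentiable f x by exact/derivable1_diffP.
split; first exact: diff_derivable.
by rewrite !deriveE// -[v in LHS]mulr1 linearZ.
Qed.

(** * Flat functions and mean value estimates *)

(** The classical e^(-1/x), with powers of 1/x included so that the family is closed under
    differentiation and one induction proves all its members smooth. *)
Definition flat R (n : nat) (x : R) : R :=
  if 0 < x then x ^- n * expR (- x^-1) else 0.

Lemma flat_ge0 R n (x : R) : 0 <= flat n x.
Proof.
rewrite /flat; case: ifP => // x0.
by rewrite mulr_ge0 ?expR_ge0// invr_ge0 exprn_ge0// ltW.
Qed.

Lemma flat_gt0 R n (x : R) : 0 < x -> 0 < flat n x.
Proof. by move=> x0; rewrite /flat x0 mulr_gt0 ?expR_gt0// invr_gt0 exprn_gt0. Qed.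

Lemma flat_le0 R n (x : R) : x <= 0 -> flat n x = 0.
Proof. by move=> x0; rewrite /flat ltNge x0. Qed.

(** From e^y >= y^(n+2) / (n+2)! at y = 1/x. The quadratic bound makes the difference quotients at 0
    tend to 0. *)
Lemma flat_le R n (x : R) :
  flat n x <= (n.+2)`!%:R * x ^+ 2.
Proof.
rewrite /flat; case: ifP => x0; last by rewrite mulr_ge0 ?sqr_ge0.
have y0 : 0 <= x^-1 by rewrite invr_ge0 ltW.
have := expR_ge1Dxn n.+1 y0; rewrite expRN.
have F : (0 : R) < (n.+2)`!%:R by rewrite ltr0n fact_gt0.
set y := x^-1 in y0 *; move=> H.
have yE : 0 < y by rewrite invr_gt0.
have : y ^+ n.+2 / (n.+2)`!%:R <= expR y by lra.
rewrite ler_pdivrMr// => H2.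
rewrite ler_pdivrMr ?expR_gt0// -exprVn -/y.
have -> : x ^+ 2 = y ^- 2 by rewrite -exprVn invrK.
rewrite mulrAC ler_pdivlMr ?exprn_gt0// -exprD addn2.
by rewrite mulrC.
Qed.

Lemma flat_is_derive R n (x : R) :
  is_derive x 1 (flat n) (- n%:R * flat n.+1 x + flat n.+2 x).
Proof.
have [x0|x0|->] := ltrgtP x 0.
- rewrite !flat_le0 ?ltW// mulr0 addr0.
  apply: (@near_eq_is_derive _ _ _ (cst 0)).
  near=> y; rewrite flat_le0//; apply: ltW.
  by near: y; exact: lt_nbhsl.
- apply: (@near_eq_is_derive _ _ _ (fun y : R => (y^-1) ^+ n * expR (- y^-1))).
    near=> y; rewrite /flat ifT ?exprVn//; near: y; exact: lt_nbhsr.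
  have xn0 : x != 0 by rewrite gt_eqF.
  rewrite /flat x0.
  have dV : is_derive x 1 (fun y : R => y^-1) (- (x ^- 2)).
    apply: is_derive_eq; first exact: (is_deriveV xn0).
    by rewrite /GRing.scale/= mulr1.
  have dN : is_derive x 1 (fun y : R => - y^-1) (x ^- 2).
    by have := is_deriveN dV; rewrite opprK.
  have dE : is_derive x 1 (fun y : R => expR (- y^-1)) (expR (- x^-1) * x ^- 2).
    exact: (is_derive1_comp (is_derive_expR _) dN).
  have dX : is_derive x 1 (fun y : R => y^-1 ^+ n) (n%:R * x^-1 ^+ n.-1 * (- x ^- 2)).
    rewrite (_ : (fun _ => _) = (fun y : R => y^-1) ^+ n).
      exact: is_deriveX.
    by rewrite exprfctE.
  rewrite -[X in is_derive _ _ _ X](_ : x^-1 ^+ n *: (expR (- x^-1) * x ^- 2) +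
    expR (- x^-1) *: (n%:R * x^-1 ^+ n.-1 * (- x ^- 2)) = _); first exact: (is_deriveM dX dE).
  rewrite /GRing.scale/= -!exprVn.
  by case: n dX => [|n] dX; rewrite ?exprS /=; ring.
- rewrite !flat_le0// mulr0 addr0.
  have C : (fun h : R => h^-1 *: ((flat n \o shift 0) (h *: 1) - flat n 0)) @ 0^' --> (0 : R).
    apply/cvgrPdist_le => e e0; near=> h.
    rewrite /= [flat n 0]flat_le0// subr0 addr0 [h%:A]mulr1 sub0r normrN.
    have h0 : h != 0 by near: h; exact: nbhs_dnbhs_neq.
    rewrite normrM normfV ler_pdivrMl ?normr_gt0// ger0_norm ?flat_ge0//.
    apply: le_trans (flat_le _ _) _.
    rewrite -(real_normK (num_real h)) expr2 mulrA [leRHS]mulrC ler_wpM2r//.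
    rewrite -ler_pdivlMl ?ltr0n ?fact_gt0//.
    near: h; apply: dnbhs0_le; rewrite mulr_gt0// invr_gt0 ltr0n; exact: fact_gt0.
  split; first by apply/cvg_ex; exists 0.
  exact: cvg_lim.
Unshelve. all: by end_near. Qed.

Lemma smooth_flat R n : smooth_on setT (@flat R n).
Proof.
apply/smooth_CkS => k; elim: k n => [|k IH] n.
  case=> // _ x _; have [d _] := flat_is_derive n x.
  by apply: differentiable_continuous; exact/derivable1_diffP.
have cf : Ck 0 setT (@flat R n).
  move=> x _; have [d _] := flat_is_derive n x.
  by apply: differentiable_continuous; exact/derivable1_diffP.
apply: CkSS => //.
  move=> x v _; have [d _] := flat_is_derive n x.
  by have [] := derive_scale1 v d.
move=> v.
apply: (@CkS_eq _ _ _ _ _ (fun x => v * (- n%:R * flat n.+1 x + flat n.+2 x))).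
- exact: openT.
- move=> x _; have [d <-] := flat_is_derive n x.
  by have [_ ->] := derive_scale1 v d.
- apply: CkSM; [exact: openT|exact: CkS_cst|].
  apply: CkSD; [exact: openT| |exact: IH].
  by apply: CkSM; [exact: openT|exact: CkS_cst|exact: IH].
Qed.

Lemma is_derive_along R (V W : normedModType R)
    (f : V -> W) (x v : V) (s : R) (d : W) :
  is_derive (s *: v + x) v f d <-> is_derive s 1 (fun h : R => f (h *: v + x)) d.
Proof.
have E : (fun h : R => h^-1 *: (((fun h : R => f (h *: v + x)) \o shift s) (h *: 1) - f (s *: v + x)))
  = (fun h : R => h^-1 *: ((f \o shift (s *: v + x)) (h *: v) - f (s *: v + x))).
  by apply/funext => h /=; rewrite [_%:A]mulr1 scalerDl addrA.
by split=> -[df <-]; split; move: df; rewrite /derivable /derive E.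
Qed.

(** Parametrising the segment by t in [0, 1] avoids a case distinction on the sign of [l]. *)
Lemma mvt_line R (V : normedModType R) (f df : V -> R) (x v : V) (l : R) :
  (forall t : R, 0 <= t <= 1 -> is_derive ((t * l) *: v + x) v f (df ((t * l) *: v + x))) ->
  exists2 t : R, 0 <= t <= 1 & f (l *: v + x) - f x = l * df ((t * l) *: v + x).
Proof.
move=> D.
have D1 (t : R) : 0 <= t <= 1 -> is_derive t 1 (fun t : R => f ((t * l) *: v + x))
    (l * df ((t * l) *: v + x)).
  move=> t01; have /is_derive_along d1 := D t t01.
  have d2 : is_derive t 1 (fun t : R => t * l) l.
    have := @is_deriveM _ _ id (cst l) t 1 _ _ (is_derive_id _ _) (is_derive_cst _ _ _).
    by rewrite /GRing.scale/= mulr0 add0r mulr1.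
  have := @is_derive1_comp _ (fun s => f (s *: v + x)) (fun t => t * l) t _ _ d1 d2.
  by rewrite mulrC.
have cf : {within `[0, 1], continuous (fun t : R => f ((t * l) *: v + x))}.
  apply: derivable_within_continuous => t; rewrite in_itv/= => t01.
  by have [] := D1 t t01.
have D2 (t : R) : t \in `]0, 1[ -> is_derive t 1 (fun t : R => f ((t * l) *: v + x))
    (l * df ((t * l) *: v + x)).
  by rewrite in_itv/= => /andP[/ltW t0 /ltW t1]; apply: D1; rewrite t0.
have [c] := MVT_segment ler01 D2 cf.
rewrite in_itv/= => c01; rewrite mul1r mul0r scale0r add0r subr0 mulr1 => E.
by exists c.
Qed.

Lemma rV_norm_le R m (x : 'rV[R]_m) (e : R) : 0 <= e ->
  (`|x| <= e) <-> (forall i, `|x 0 i| <= e).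
Proof.
move=> e0; rewrite [`|x|]/Num.Def.normr/= mx_normrE; split.
  move=> H i; apply: le_trans H.
  exact: (le_bigmax _ (fun i : 'I_1 * 'I_m => `|x i.1 i.2|) (0, i)).
move=> H; apply: bigmax_le => // -[i j] _ /=; by rewrite (ord1 i).
Qed.

Lemma rV_norm_lt R m (x : 'rV[R]_m) (e : R) : 0 < e ->
  (`|x| < e) <-> (forall i, `|x 0 i| < e).
Proof.
move=> e0; rewrite [`|x|]/Num.Def.normr/= mx_normrE; split.
  move=> H i; apply: le_lt_trans H.
  exact: (le_bigmax _ (fun i : 'I_1 * 'I_m => `|x i.1 i.2|) (0, i)).
move=> H; apply: bigmax_lt => // -[i j] _ /=; by rewrite (ord1 i).
Qed.

Lemma rV_coord_le R m (x : 'rV[R]_m) i : `|x 0 i| <= `|x|.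
Proof. exact: (proj1 (rV_norm_le _ (normr_ge0 x))). Qed.

Local Notation e_ i := (delta_mx 0 i).

(* The telescoping path moves one coordinate at a time from [b] to [a]. *)
Lemma mvt_coord R m (f : 'rV[R]_m -> R) (x0 : 'rV[R]_m) (r : R) a b :
  (forall y, `|y - x0| < r -> forall i, derivable f y (e_ i)) ->
  `|a - x0| < r -> `|b - x0| < r ->
  exists2 xi : 'I_m -> 'rV[R]_m, forall i, `|xi i - x0| < r &
    f a - f b = \sum_i (a 0 i - b 0 i) * 'D_(e_ i) f (xi i).
Proof.
move=> df ar br; have r0 : 0 < r by exact: le_lt_trans ar.
pose c k : 'rV[R]_m := \row_i (if (i < k)%N then a 0 i else b 0 i).
(* The norm is the sup norm, so a ball is a box: mixing coordinates of [a] and [b], or taking a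
   convex combination in one coordinate, does not leave it. *)
have mid (i : 'I_m) (t : R) : 0 <= t <= 1 ->
    `|(t * (a 0 i - b 0 i)) *: e_ i + c i - x0| < r.
  move=> /andP[t0 t1]; apply/(rV_norm_lt _ r0) => j; rewrite !mxE eqxx/=.
  have aj := proj1 (rV_norm_lt _ r0) ar j; have bj := proj1 (rV_norm_lt _ r0) br j.
  rewrite !mxE in aj bj.
  move: aj bj; case: (eqVneq j i) => [->|ji] aj bj /=; last first.
    by rewrite mulr0 add0r; case: ifP.
  rewrite ltnn mulr1; move: aj bj; rewrite !ltr_norml => /andP[a1 a2] /andP[b1 b2].
  (* For t < 1 the coordinate of [b] has positive weight, which keeps the inequalities strict; t = 1
     is settled apart. *)
  move: t1; rewrite le_eqVlt => /orP[/eqP->|t1]; first by apply/andP; split; lra.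
  set A := a 0 i in a1 a2 *; set B := b 0 i in b1 b2 *; set X := x0 0 i in a1 a2 b1 b2 *.
  have p1 : 0 <= t * (A - X + r) by apply: mulr_ge0 => //; lra.
  have p2 : 0 < (1 - t) * (B - X + r) by apply: mulr_gt0; lra.
  have p3 : 0 <= t * (r - (A - X)) by apply: mulr_ge0 => //; lra.
  have p4 : 0 < (1 - t) * (r - (B - X)) by apply: mulr_gt0; lra.
  apply/andP; split; lra.
have step (i : 'I_m) : exists xi, `|xi - x0| < r /\
    f (c i.+1) - f (c i) = (a 0 i - b 0 i) * 'D_(e_ i) f xi.
  have [t t01 E] := @mvt_line _ _ f (fun y => 'D_(e_ i) f y) (c i) (e_ i) (a 0 i - b 0 i)
    (fun t t01 => derivableP (df _ (mid i t t01) i)).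
  exists ((t * (a 0 i - b 0 i)) *: e_ i + c i); split; first exact: mid.
  rewrite -E; congr (f _ - _); apply/rowP => j; rewrite !mxE eqxx/= ltnS.
  case: (ltngtP j i) => [ji|ji|/val_inj ->].
  - by rewrite (_ : (j == i) = false) ?mulr0 ?add0r//; apply/eqP => e; rewrite e ltnn in ji.
  - by rewrite (_ : (j == i) = false) ?mulr0 ?add0r//; apply/eqP => e; rewrite e ltnn in ji.
  - by rewrite eqxx mulr1 subrK.
have [xi xiP] := choice step.
exists xi => [i|]; first by have [] := xiP i.
transitivity (f (c m) - f (c 0%N)).
  by congr (f _ - f _); apply/rowP => j; rewrite !mxE ?ltn_ord.
rewrite -(telescope_sumr (fun k => f (c k)) (leq0n m)) big_mkord; apply: eq_bigr => i _.
by have [_ ->] := xiP i.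
Qed.

Lemma sum_coord_le R m (u : 'rV[R]_m) (g : 'I_m -> R) (C : R) :
  (forall i, `|g i| <= C) -> `|\sum_i u 0 i * g i| <= m%:R * C * `|u|.
Proof.
move=> gC; apply: le_trans (ler_norm_sum _ _ _) _.
apply: (@le_trans _ _ (\sum_(i < m) C * `|u|)).
  apply: ler_sum => i _; rewrite normrM mulrC.
  by apply: ler_pM => //; exact: rV_coord_le.
by rewrite sumr_const card_ord -[leLHS]mulr_natl mulrA.
Qed.

Lemma near_ball_norm R (V : normedModType R) (x : V) (P : V -> Prop) :
  (\forall y \near x, P y) <-> exists2 r : R, 0 < r & forall y, `|y - x| < r -> P y.
Proof.
split.
  move=> /nbhs_normP[r /= r0 H]; exists r => // y yr; apply: H.
  by rewrite /= distrC.
move=> [r r0 H]; apply/nbhs_normP; exists r => // y /= yr; apply: H.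
by rewrite distrC.
Qed.

(** Strict differentiability: both points vary, as limits of quotients along moving points require.
    It follows from [mvt_coord] and the continuity of the partial derivatives; the constant [e]
    absorbs the factor m of the sum over coordinates. *)
Lemma smooth_strict_diff R m (U : set 'rV[R]_m) (f : 'rV[R]_m -> R)
    (x : 'rV[R]_m) (eta : R) :
  open U -> smooth_on U f -> U x -> 0 < eta ->
  exists2 r : R, 0 < r & forall a b, `|a - x| < r -> `|b - x| < r ->
    U a /\ `|f a - f b - \sum_i (a - b) 0 i * 'D_(e_ i) f x| <= eta * `|a - b|.
Proof.
move=> oU sf Ux eta0.
pose e : R := eta / (m%:R + 1).
have m0 : (0 : R) < m%:R + 1 by rewrite ltr_wpDl.
have e0 : 0 < e by rewrite divr_gt0.
have N1 : \forall y \near x, forall i, `|'D_(e_ i) f y - 'D_(e_ i) f x| < e.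
  apply: (@filter_forall _ 'I_m (fun i y => `|'D_(e_ i) f y - 'D_(e_ i) f x| < e) (nbhs x)) => i.
  have /(_ x Ux) := smooth_continuous (smooth_derive (e_ i) sf).
  move=> /cvgrPdist_lt/(_ _ e0); apply: filterS => y; by rewrite distrC.
have : \forall y \near x, U y /\ forall i, `|'D_(e_ i) f y - 'D_(e_ i) f x| < e.
  by apply: filterI N1; exact: open_nbhs_nbhs.
move=> /near_ball_norm[r r0 H]; exists r => // a b ar br.
split; first by have [] := H _ ar.
have [y yr i|xi xir ->] := @mvt_coord _ _ f x r a b _ ar br.
  by apply: (smooth_derivable sf); have [] := H _ yr.
rewrite -sumrB (eq_bigr (fun i => (a - b) 0 i * ('D_(e_ i) f (xi i) - 'D_(e_ i) f x))).
  apply: le_trans (sum_coord_le _ (C := e) _) _.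
    by move=> i; apply: ltW; have [_] := H _ (xir i); exact.
  rewrite ler_wpM2r// /e mulrCA ler_piMr ?ltW// ltr_pdivrMr// mul1r; lra.
by move=> i _; rewrite !mxE mulrBr.
Qed.

(** A chain rule along an arbitrary filter with arbitrary scale [k]. It yields both the linearity of
    the directional derivative in the direction and the derivative along a curve. *)
Lemma smooth_quotient R m (U : set 'rV[R]_m) (f : 'rV[R]_m -> R)
    (x w : 'rV[R]_m) (I : Type) (F : set_system I) (a b : I -> 'rV[R]_m) (k : I -> R) :
  Filter F -> open U -> smooth_on U f -> U x ->
  a @ F --> x -> b @ F --> x -> (k i)^-1 *: (a i - b i) @[i --> F] --> w ->
  (k i)^-1 * (f (a i) - f (b i)) @[i --> F] --> \sum_i w 0 i * 'D_(e_ i) f x.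
Proof.
move=> FF oU sf Ux ax bx kw.
have lim1 : \sum_j ((k i)^-1 *: (a i - b i)) 0 j * 'D_(e_ j) f x @[i --> F]
    --> \sum_i w 0 i * 'D_(e_ i) f x.
  apply: cvg_big; first exact: add_continuous.
  move=> j _; apply: cvgMr_tmp.
  apply: (@continuous_cvg _ _ _ _ _ _ (fun y : 'rV[R]_m => y 0 j)) kw.
  exact: coord_continuous.
apply/cvgrPdist_le => e e0.
pose eta : R := (e / 2) / (`|w| + 1).
have w0 : (0 : R) < `|w| + 1 by rewrite ltr_wpDl.
have eta0 : 0 < eta by rewrite !divr_gt0.
have [r r0 H] := smooth_strict_diff oU sf Ux eta0.
near=> i.
have [|| _ Hi] := H (a i) (b i).
- near: i; move/cvgrPdist_lt : ax => /(_ _ r0); apply: filterS => i; by rewrite distrC.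
- near: i; move/cvgrPdist_lt : bx => /(_ _ r0); apply: filterS => i; by rewrite distrC.
have L : `|\sum_i w 0 i * 'D_(e_ i) f x -
    \sum_j ((k i)^-1 *: (a i - b i)) 0 j * 'D_(e_ j) f x| <= e / 2.
  by near: i; move/cvgrPdist_le : lim1 => /(_ _ (divr_gt0 e0 (ltr0n R 2))); exact.
have N : `|(k i)^-1 *: (a i - b i)| <= `|w| + 1.
  have : `|w - (k i)^-1 *: (a i - b i)| <= 1.
    by near: i; move/cvgrPdist_le : kw => /(_ _ ltr01); exact.
  move=> N1; rewrite -[X in `|X|](subKr w); apply: le_trans (ler_normB _ _) _.
  by rewrite lerD2l.
rewrite (splitr e) -[X in `|X|](subrKA
  (\sum_j ((k i)^-1 *: (a i - b i)) 0 j * 'D_(e_ j) f x)).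
apply: le_trans (ler_normD _ _) (lerD L _).
rewrite (eq_bigr (fun j => (k i)^-1 * ((a i - b i) 0 j * 'D_(e_ j) f x))); last first.
  by move=> j _; rewrite !mxE mulrA.
rewrite -mulr_sumr -mulrBr normrM distrC.
apply: (@le_trans _ _ (`|(k i)^-1| * (eta * `|a i - b i|))).
  by rewrite ler_wpM2l.
rewrite mulrCA -normrZ /eta -[leRHS](divfK (lt0r_neq0 w0)).
by rewrite ler_wpM2l// ltW.
Unshelve. all: by end_near. Qed.

Lemma line_cvg R (V : normedModType R) (x v : V) :
  (h *: v + x) @[h --> (0 : R)^'] --> x.
Proof.
have C : (h *: v + x) @[h --> (0 : R)] --> 0 *: v + x.
  by apply: cvgD; [apply: cvgZr_tmp; exact: cvg_id|exact: cvg_cst].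
by rewrite scale0r add0r in C; apply: cvg_within_filter.
Qed.

Lemma smooth_deriveE R m (U : set 'rV[R]_m) (f : 'rV[R]_m -> R)
    (x v : 'rV[R]_m) :
  open U -> smooth_on U f -> U x -> 'D_v f x = \sum_i v 0 i * 'D_(e_ i) f x.
Proof.
move=> oU sf Ux; apply: cvg_lim => //.
have C := @line_cvg R _ x v.
apply: (@smooth_quotient _ _ U f x v R (0 : R)^' (fun h => h *: v + x) (fun=> x) id _ oU sf Ux C (cvg_cst _)).
have CV : (fun=> v) @ (0 : R)^' --> v by exact: cvg_cst.
apply: cvg_trans CV; apply: near_eq_cvg; near=> h.
by rewrite addrK scalerA mulVf ?scale1r//; near: h; exact: nbhs_dnbhs_neq.
Unshelve. all: by end_near. Qed.

Lemma is_derive_curve R m (U : set 'rV[R]_m) (f : 'rV[R]_m -> R)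
    (g : R -> 'rV[R]_m) (t : R) (w : 'rV[R]_m) :
  open U -> smooth_on U f -> U (g t) -> is_derive t 1 g w ->
  is_derive t 1 (fun s => f (g s)) ('D_w f (g t)).
Proof.
move=> oU sf Ugt [dg <-].
have cg : {for t, continuous g} by apply/differentiable_continuous/derivable1_diffP.
have C : g (h *: 1 + t) @[h --> (0 : R)^'] --> g t.
  have ch := @line_cvg R _ t (1 : R).
  exact: cvg_comp ch cg.
have := @smooth_quotient _ _ U f (g t) _ R (0 : R)^' (fun h => g (h *: 1 + t)) (fun=> g t) id _ oU sf Ugt C (cvg_cst _) dg.
rewrite -(smooth_deriveE _ oU sf Ugt) => L.
by split; [apply/cvg_ex; eexists; exact: L|apply: cvg_lim => //; exact: L].
Qed.

Lemma lipschitz_coord R m (f : 'rV[R]_m -> R) (x0 : 'rV[R]_m) (r C : R) a b :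
  (forall y, `|y - x0| < r -> forall i, derivable f y (e_ i) /\ `|'D_(e_ i) f y| <= C) ->
  `|a - x0| < r -> `|b - x0| < r -> `|f a - f b| <= m%:R * C * `|a - b|.
Proof.
move=> H ar br; have [|xi xir ->] := @mvt_coord _ _ f x0 r a b _ ar br.
  by move=> y yr i; have [] := H y yr i.
rewrite (eq_bigr (fun i => (a - b) 0 i * 'D_(e_ i) f (xi i))); last first.
  by move=> i _; rewrite !mxE.
by apply: sum_coord_le => i; have [] := H _ (xir i) i.
Qed.

(** * Connectedness and Gronwall estimates *)

(** The local hypothesis carries [P] between any two points of a neighbourhood, so the set where [P]
    holds and the set where it fails are both relatively open. *)
Lemma connected_ind (T : topologicalType) (A : set T) (P : T -> Prop) (x : T) :
  connected A -> A x -> P x ->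
  (forall t, A t -> exists2 N, nbhs t N &
     forall s s', A s -> A s' -> N s -> N s' -> P s -> P s') ->
  forall y, A y -> P y.
Proof.
move=> cA Ax Px loc y Ay.
have loc' t : A t -> exists N, [/\ open N, N t &
    forall s s', A s -> A s' -> N s -> N s' -> P s -> P s'].
  move=> At; have [N] := loc t At; rewrite nbhsE => -[N' [oN' N't] N'N] FP.
  exists N'; split => // s s' As As' Ns Ns'; apply: FP => //; exact: N'N.
pose N t := if pselect (A t) is left At then sval (cid (loc' t At)) else set0.
have NP t : A t -> [/\ open (N t), N t t &
    forall s s', A s -> A s' -> N t s -> N t s' -> P s -> P s'].
  by move=> At; rewrite /N; case: pselect => // At'; case: cid.
have oU Q : open (\bigcup_(t in [set t | A t /\ Q t]) N t).
  by apply: bigcup_open => t [At _]; have [] := NP t At.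
suff E : A `&` P = A by move: Ay; rewrite -E => -[].
apply: cA.
- by exists x.
- exists (\bigcup_(t in [set t | A t /\ P t]) N t); first exact: oU.
  apply/seteqP; split => [t [At Pt]|t [At [s [As Ps] Nst]]].
    by split => //; exists t => //; have [] := NP t At.
  split => //; have [_ Nss H] := NP s As; exact: (H s t).
- exists (~` (\bigcup_(t in [set t | A t /\ ~ P t]) N t)).
    by apply: open_closedC; exact: oU.
  apply/seteqP; split => [t [At Pt]|t [At H]].
    split => // -[s [As Ps] Nst]; apply: Ps.
    have [_ Nss H] := NP s As; exact: (H t s).
  split => //; apply: contrapT => Pt; apply: H; exists t => //.
  by have [] := NP t At.
Qed.

(** The function e^(- c t) E(t) is nonincreasing. *)
Lemma diff_ineq_exp R (E E' : R -> R) (a b c : R) : a <= b ->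
  {within `[a, b], continuous E} ->
  (forall t, a < t < b -> is_derive t 1 E (E' t) /\ E' t <= c * E t) ->
  E b <= expR (c * (b - a)) * E a.
Proof.
move=> ab cE dE.
pose F := fun t => expR (- c * t) * E t.
have dexp (t : R) : is_derive t 1 (fun t => expR (- c * t)) (- c * expR (- c * t)).
  have d1 : is_derive t 1 (fun t : R => - c * t) (- c).
    have := @is_deriveZ _ _ _ id (- c) t 1 _ (is_derive_id _ _).
    by rewrite /GRing.scale/= mulr1.
  have := @is_derive1_comp _ expR (fun t => - c * t) t _ _ (is_derive_expR _) d1.
  by rewrite mulrC.
have dF t : a < t < b -> is_derive t 1 F (expR (- c * t) * (E' t - c * E t)).
  move=> /dE[dEt _]; have := @is_deriveM _ _ _ _ t 1 _ _ (dexp t) dEt.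
  rewrite /GRing.scale/= => H.
  rewrite (_ : _ * _ = expR (- c * t) * E' t + E t * (- c * expR (- c * t))) //.
  by ring.
have cF : {within `[a, b], continuous F}.
  move=> x; apply: (@continuousM R (subspace `[a, b]) (fun t => expR (- c * t)) E x); last exact: cE.
  move: x; apply: continuous_subspaceT => t.
  by apply/differentiable_continuous/derivable1_diffP; have [] := dexp t.
have : F b <= F a.
  apply: (ler0_derive1_le_cc _ _ cF) => //; rewrite ?in_itv/= ?lexx ?ab//.
  - by move=> t; rewrite in_itv/= => /dF[].
  - move=> t; rewrite in_itv/= => tab; rewrite derive1E.
    have [_ ->] := dF t tab; rewrite pmulr_rle0 ?expR_gt0// subr_le0.
    by have [] := dE t tab.
rewrite /F => H.
rewrite mulrBr expRB mulrAC ler_pdivlMr ?expR_gt0//.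
rewrite !mulNr !expRN in H.
move: H; rewrite ler_pdivrMl ?expR_gt0// mulrCA ler_pdivlMl ?expR_gt0//.
by rewrite mulrC.
Qed.

(** The estimate is made for the sum of the squares of the coordinates, whence m and 2 m. The [+ 1]
    makes the constant at least 1 in every dimension, hence at most its own square, so a bound on
    squared norms passes to norms without a square root. *)
Definition gronwall_const R (m : nat) (c : R) : R :=
  m%:R * expR (2 * m%:R * c) + 1.

Lemma is_derive_coord R (V : normedModType R) m (u : V -> 'rV[R]_m) x v w i :
  is_derive x v u w -> is_derive x v (fun x => u x 0 i) (w 0 i).
Proof.
by move=> [d <-]; split; [by move/derivable_mxP : d; exact|rewrite derive_mx// mxE].
Qed.

Lemma gronwall_const_ge1 R (m : nat) (c : R) : 1 <= gronwall_const m c.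
Proof. by rewrite /gronwall_const lerDr mulr_ge0 ?expR_ge0. Qed.

Lemma gronwall_const_gt0 R (m : nat) (c : R) : 0 < gronwall_const m c.
Proof. exact: lt_le_trans ltr01 (gronwall_const_ge1 _ _). Qed.

Lemma rV_norm_sq R m (x : 'rV[R]_m) :
  `|x| ^+ 2 <= \sum_i (x 0 i) ^+ 2 <= m%:R * `|x| ^+ 2.
Proof.
have E0 : 0 <= \sum_i (x 0 i) ^+ 2 by apply: sumr_ge0 => i _; exact: sqr_ge0.
apply/andP; split.
  rewrite -ler_sqrt ?exprn_even_ge0// ?sqrtr_sqr ?normr_id//.
  apply/rV_norm_le; first exact: sqrtr_ge0.
  move=> i; rewrite -sqrtr_sqr ler_sqrt//.
  by rewrite (bigD1 i)//= lerDl sumr_ge0// => j _; exact: sqr_ge0.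
apply: (@le_trans _ _ (\sum_(i < m) `|x| ^+ 2)).
  apply: ler_sum => i _; rewrite -real_normK ?num_real//.
  by rewrite lerXn2r ?nnegrE//; exact: rV_coord_le.
by rewrite sumr_const card_ord mulr_natl.
Qed.

(** The sup norm is not differentiable, the sum of squares [E] is. Its derivative is bounded in
    absolute value, so the estimate can be run in both directions of time. *)
Lemma gronwall R m (u w : R -> 'rV[R]_m) (a b L : R) :
  a <= b -> 0 <= L -> {within `[a, b], continuous u} ->
  (forall t, a < t < b -> is_derive t 1 u (w t) /\ `|w t| <= L * `|u t|) ->
  `|u b| <= gronwall_const m (L * (b - a)) * `|u a| /\
  `|u a| <= gronwall_const m (L * (b - a)) * `|u b|.
Proof.
move=> ab L0 cu dH.
pose E t := \sum_i (u t 0 i) ^+ 2.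
pose E' t := \sum_i 2 * (u t 0 i * w t 0 i).
have cE : {within `[a, b], continuous E}.
  have cS : continuous (fun y : 'rV[R]_m => \sum_i (y 0 i) ^+ 2).
    apply: continuous_big; first exact: add_continuous.
    move=> i _ y; apply: (@continuous_comp _ _ _ (fun y : 'rV[R]_m => y 0 i) (fun z => z ^+ 2)).
      exact: coord_continuous.
    exact: exprn_continuous.
  move=> x; apply: (@continuous_comp (subspace `[a, b]) _ _ u
    (fun y : 'rV[R]_m => \sum_i (y 0 i) ^+ 2) x); first exact: cu.
  exact: cS.
have dE t : a < t < b -> is_derive t 1 E (E' t).
  move=> tab; have [du _] := dH t tab.
  have dui i : is_derive t 1 (fun t => u t 0 i) (w t 0 i) by exact: is_derive_coord.
  rewrite (_ : E = \sum_i (fun t => u t 0 i ^+ 2)); last first.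
    by apply/funext => s; rewrite fct_sumE.
  apply: is_derive_sum => i.
  have H := @is_deriveM _ _ _ _ t 1 _ _ (dui i) (dui i).
  rewrite /GRing.scale/= in H.
  rewrite (_ : 2 * _ = u t 0 i * w t 0 i + u t 0 i * w t 0 i); last by ring.
  suff -> : (fun t => u t 0 i ^+ 2) = (fun t => u t 0 i) * (fun t => u t 0 i) by exact: H.
  by apply/funext => s; rewrite expr2.
have bE t : a < t < b -> `|E' t| <= 2 * m%:R * L * E t.
  move=> tab; have [_ wL] := dH t tab.
  apply: le_trans (ler_norm_sum _ _ _) _.
  apply: (@le_trans _ _ (\sum_(i < m) 2 * L * E t)).
    apply: ler_sum => i _; rewrite !normrM ger0_norm// -mulrA ler_pM2l//.
    apply: (@le_trans _ _ (`|u t| * (L * `|u t|))).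
      apply: ler_pM => //; first exact: rV_coord_le.
      by apply: le_trans wL; exact: rV_coord_le.
    rewrite mulrCA ler_wpM2l// -expr2.
    by have /andP[] := rV_norm_sq (u t).
  rewrite sumr_const card_ord -[leLHS]mulr_natl.
  by rewrite (_ : m%:R * _ = 2 * m%:R * L * E t)//; ring.
pose c := 2 * m%:R * L.
have K1 := gronwall_const_ge1 m (L * (b - a)).
have K0 := gronwall_const_gt0 m (L * (b - a)).
have conc (x y : 'rV[R]_m) : \sum_i (x 0 i) ^+ 2 <= expR (c * (b - a)) * \sum_i (y 0 i) ^+ 2 ->
    `|x| <= gronwall_const m (L * (b - a)) * `|y|.
  move=> H; have /andP[x1 _] := rV_norm_sq x; have /andP[_ y2] := rV_norm_sq y.
  have Ky : 0 <= gronwall_const m (L * (b - a)) * `|y| by rewrite mulr_ge0// ltW.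
  suff: `|x| ^+ 2 <= (gronwall_const m (L * (b - a)) * `|y|) ^+ 2.
    by rewrite ler_pXn2r ?nnegrE.
  rewrite exprMn.
  apply: (le_trans x1); apply: (le_trans H).
  apply: (@le_trans _ _ (expR (c * (b - a)) * (m%:R * `|y| ^+ 2))).
    by rewrite ler_wpM2l// expR_ge0.
  rewrite mulrA ler_wpM2r ?sqr_ge0//.
  apply: (@le_trans _ _ (gronwall_const m (L * (b - a)))).
    by rewrite /gronwall_const /c [leLHS]mulrC mulrA lerDl.
  by rewrite expr2 ler_peMl// ltW.
split; apply: conc.
  apply: (@diff_ineq_exp _ E E' a b c ab cE) => t tab; split; first exact: dE.
  by apply: le_trans (ler_norm _) _; exact: bE.
(* The backward estimate is the forward inequality for - E with rate - c. *)
have : - E b <= expR (- c * (b - a)) * - E a.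
  apply: (@diff_ineq_exp _ (fun t => - E t) (fun t => - E' t) a b (- c) ab).
    by move=> x; apply: continuousN; exact: cE.
  move=> t tab; split; first by have := dE t tab; exact: is_deriveN.
  rewrite mulrNN; apply: le_trans (ler_norm _) _; rewrite normrN; exact: bE.
rewrite mulNr expRN mulrN lerN2 ler_pdivrMl ?expR_gt0//.
Qed.

(* Makes 'M[R]_(m, n) a completeNormedModType, as the contraction theorem needs. *)
HB.instance Definition _ R (m n : nat) := Complete.on 'M[R]_(m, n).

(** A solution is a fixed point of y |-> z - Psi y + y, a contraction of the closed ball: half of
    the radius pays for the distance from [z] to [Psi y0], the other half for the contracted
    distance to [y0]. *)
Lemma perturb_id_surj R m (Psi : 'rV[R]_m -> 'rV[R]_m)
    (y0 z : 'rV[R]_m) (r : R) : 0 < r ->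
  (forall y y', `|y - y0| <= r -> `|y' - y0| <= r ->
     `|Psi y - Psi y' - (y - y')| <= 2^-1 * `|y - y'|) ->
  `|z - Psi y0| <= r / 2 -> exists2 y, `|y - y0| <= r & Psi y = z.
Proof.
move=> r0 H zr.
pose U := [set y : 'rV[R]_m | `|y - y0| <= r].
pose T y := z - Psi y + y.
have TU y : U y -> U (T y).
  move=> Uy; rewrite /U /T /=.
  rewrite (_ : z - Psi y + y - y0 = (z - Psi y0) - (Psi y - Psi y0 - (y - y0))); last first.
    by apply/rowP => i; rewrite !mxE; ring.
  apply: le_trans (ler_normB _ _) _; rewrite (splitr r) lerD//.
  apply: le_trans (H _ _ Uy _) _; first by rewrite subrr normr0 ltW.
  by rewrite mulrC ler_pM2r// invr_gt0.
have [f fE] : exists f : {fun U >-> U}, forall y, f y = T y.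
  have fT : set_fun U U T by move=> y; exact: TU.
  by exists (mkfun fT).
have ctr : is_contraction f.
  exists (2^-1 : R)%:nng; split; first by rewrite /=; lra.
  move=> [y y'] /= [Uy Uy']; rewrite !fE /T.
  rewrite (_ : z - Psi y + y - (z - Psi y' + y') = - (Psi y - Psi y' - (y - y'))); last first.
    by apply/rowP => i; rewrite !mxE; ring.
  by rewrite normrN; exact: H.
have [||p Up pE] := @banach_fixed_point R 'rV[R]_m U f ctr.
- rewrite (_ : U = closed_ball y0 r); first exact: closed_ball_closed.
  by rewrite closed_ballE//; apply/funext => y; rewrite /U /closed_ball_/= distrC.
- by exists y0; rewrite /U/= subrr normr0 ltW.
exists p => //; move: pE; rewrite fE /T => /eqP.
rewrite -subr_eq0 opprD addrCA subrr addr0 oppr_eq0 subr_eq0 => /eqP.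
by [].
Qed.

(** * Smoothness on slices and products, and of inverse matrices *)

Lemma smooth_atT R (V W : normedModType R) (f : V -> W) (x : V) :
  smooth_at setT f x <-> exists U, [/\ open U, U x & smooth_on U f].
Proof.
split=> [[U [g [oU Ux sg fg]]]|[U [oU Ux sf]]].
  by exists U; split => //; apply: smooth_on_eq sg => // y Uy; rewrite fg.
by exists U, f; split.
Qed.

Lemma pairR_continuous (T1 T2 : topologicalType) (t : T1) :
  continuous (fun y : T2 => (t, y)).
Proof.
move=> y A [[A1 A2] [/= nA1 nA2] AA].
by apply: filterS nA2 => z A2z; apply: AA; split => //; exact: nbhs_singleton.
Qed.

Lemma smooth_slice R (V W : normedModType R) (U : set (R * V))
    (G : R * V -> W) (t : R) :
  smooth_on U G -> smooth_on [set y | U (t, y)] (fun y => G (t, y)).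
Proof.
move=> sG; apply: (@smooth_affine _ _ _ _ U G (fun y => (t, y)) (fun v => (0, v))) => //.
  exact: pairR_continuous.
by move=> x v h; congr (_, _); rewrite /= scaler0 add0r.
Qed.

Lemma derive_slice R (V W : normedModType R) (G : R * V -> W) (t : R)
    (y v : V) : 'D_v (fun y => G (t, y)) y = 'D_((0 : R), v) G (t, y).
Proof.
rewrite /derive; set g1 := fun h => h^-1 *: _; set g2 := fun h => h^-1 *: _.
suff -> : g1 = g2 by [].
apply/funext => h; rewrite /g1 /g2 /=; congr (_ *: (G _ - _)).
by congr (_, _); rewrite /= scaler0 add0r.
Qed.

Lemma open_slice (T1 T2 : topologicalType) (U : set (T1 * T2)) (t : T1) :
  open U -> open [set y | U (t, y)].
Proof.
by move=> oU; apply: (@open_comp _ _ (fun y => (t, y)) U) => // y _; exact: pairR_continuous.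
Qed.

Lemma smooth_snd R (V W : normedModType R) (U : set V) (f : V -> W) :
  smooth_on U f -> smooth_on [set z : R * V | U z.2] (fun z : R * V => f z.2).
Proof.
by move=> sf; apply: (@smooth_affine _ _ _ _ U f snd snd) => // z; exact: cvg_snd.
Qed.

Lemma open_snd (T1 T2 : topologicalType) (U : set T2) :
  open U -> open [set z : T1 * T2 | U z.2].
Proof. by move=> oU; apply: (@open_comp _ _ snd U) => // z _; exact: cvg_snd. Qed.

Lemma smooth_fst R (V W : normedModType R) (U : set R) (f : R -> W) :
  smooth_on U f -> smooth_on [set z : R * V | U z.1] (fun z : R * V => f z.1).
Proof.
by move=> sf; apply: (@smooth_affine _ _ _ _ U f fst fst) => // z; exact: cvg_fst.
Qed.

Lemma smooth_id R (V : normedModType R) (U : set V) :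
  open U -> smooth_on U (fun x : V => x).
Proof.
move=> oU [|k]; first by move=> x _; exact: cvg_id.
split=> [x v _|v]; first exact: derivable_id.
apply: (@Ck_eq _ _ _ _ _ (fun=> v)) => //; last exact: smooth_cst.
by move=> x _; rewrite derive_id.
Qed.

Lemma smooth_coord R (V : normedModType R) m (U : set V) (f : V -> 'rV[R]_m) i :
  open U -> smooth_on U f -> smooth_on U (fun x => f x 0 i).
Proof.
move=> oU sf k; elim: k f sf => [|k IH] f sf.
  move=> x Ux; apply: (@continuous_comp _ _ _ f (fun y : 'rV[R]_m => y 0 i)).
    exact: (smooth_continuous sf).
  exact: coord_continuous.
have df x v : U x -> derivable f x v by move=> Ux; exact: (proj1 (sf 1%N)).
split=> [x v Ux|v].
  by have /derivable_mxP := df x v Ux; exact.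
apply: (@Ck_eq _ _ _ _ _ (fun x => ('D_v f x) 0 i)) => //.
  by move=> x Ux; rewrite (derive_mx (df x v Ux)) mxE.
by apply: IH; exact: smooth_derive.
Qed.

Lemma smooth_det R (V : normedModType R) (U : set V) m
    (A : V -> 'M[R]_m) : open U -> (forall i j, smooth_on U (fun y => A y i j)) ->
  smooth_on U (fun y => \det (A y)).
Proof.
move=> oU sA; apply: smooth_sum => // s _; apply: smoothM => //.
  exact: smooth_cst.
by apply: smooth_prod => // i _; exact: sA.
Qed.

Lemma smooth_invmx R (V : normedModType R) (U : set V) m
    (A : V -> 'M[R]_m) : open U -> (forall i j, smooth_on U (fun y => A y i j)) ->
  (forall y, U y -> A y \in unitmx) ->
  forall i j, smooth_on U (fun y => invmx (A y) i j).
Proof.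
move=> oU sA uA i j.
apply: (@smooth_on_eq _ _ _ _ (fun y => (\det (A y))^-1 *
   ((-1) ^+ (j + i) * \det (row' j (col' i (A y)))))) => //.
  by move=> y Uy; rewrite /invmx uA// !mxE /cofactor.
apply: smoothM => //.
  by apply: smoothV => //; [move=> y /uA; rewrite unitmxE unitfE|exact: smooth_det].
apply: smoothM => //; first exact: smooth_cst.
apply: smooth_det => // k l.
apply: smooth_on_eq (sA (lift j k) (lift i l)) => // y _.
by rewrite !mxE.
Qed.

(** * Hamiltonian fields and their orbits *)

(** The coordinates of X_f: in row vectors, omega (X_f, .) = df says that X_f times the matrix of
    omega is the row of partial derivatives. *)
Definition ham_field R m (A : 'rV[R]_m -> 'M[R]_m) (f : 'rV[R]_m -> R)
  (y : 'rV[R]_m) : 'rV[R]_m := (\row_i 'D_(e_ i) f y) *m invmx (A y).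

Lemma form_unit R n (M : symplectic_manifold R n) (c : chart M) y :
  chart_img c y -> Defs.form c y \in unitmx.
Proof.
move=> yc; rewrite -row_free_unit -kermx_eq0; apply/eqP/row_matrixP => i.
rewrite row0; apply: (form_nondegenerate yc) => w; rewrite /bilin.
have -> : row i (kermx (Defs.form c y)) *m Defs.form c y = 0.
  by rewrite -row_mul mulmx_ker row0.
by rewrite mul0mx mxE.
Qed.

Lemma bilin_delta R m (A : 'M[R]_m) (v : 'rV[R]_m) i :
  bilin A v (e_ i) = (v *m A) 0 i.
Proof.
rewrite /bilin mxE (bigD1 i)//= [X in _ + X]big1 => [|j ji].
  by rewrite addr0 !mxE !eqxx mulr1.
by rewrite [X in _ * X]mxE [X in _ * X]mxE (negbTE ji) andbF mulr0.
Qed.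

Lemma is_ham_vectorE R n (M : symplectic_manifold R n) (c : chart M)
    (F : M -> R) x v : chart_dom c x -> is_ham_vector F c x v ->
  v = ham_field (Defs.form c) (F \o of_coord c) (to_coord c x).
Proof.
move=> xc H; have U := form_unit (to_coord_img xc).
rewrite /ham_field; apply: (canRL (mulmxK U)); apply/rowP => i.
by rewrite -bilin_delta H mxE.
Qed.

Lemma ham_fieldE R n (M : symplectic_manifold R n) (c : chart M)
    (U : set 'rV[R]_(n + n)) (f : 'rV[R]_(n + n) -> R) y w :
  open U -> smooth_on U f -> U y -> chart_img c y ->
  bilin (Defs.form c y) (ham_field (Defs.form c) f y) w = 'D_w f y.
Proof.
move=> oU sf Uy yc; rewrite /bilin /ham_field mulmxKV ?form_unit// mxE.
by rewrite (smooth_deriveE _ oU sf Uy); apply: eq_bigr => i _; rewrite !mxE mulrC.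
Qed.

Lemma nbhs_norm_lt R (V : normedModType R) (t : V) (r : R) :
  0 < r -> nbhs t [set s | `|s - t| < r].
Proof. by move=> r0; apply/near_ball_norm; exists r. Qed.

Lemma nbhs_of_chart R m (M : manifold R m) (c : chart M) (x : M) (P : M -> Prop) :
  chart_dom c x -> nbhs x P ->
  exists2 r : R, 0 < r & forall y, `|y - to_coord c x| < r ->
    chart_img c y /\ P (of_coord c y).
Proof.
move=> xc xP; have yc := to_coord_img xc.
have : \forall y \near to_coord c x, chart_img c y /\ P (of_coord c y).
  apply: filterI; first by apply: open_nbhs_nbhs; split => //; exact: open_chart_img.
  by apply: (of_coord_cont yc); rewrite to_coordK.
by move=> /near_ball_norm.
Qed.

Lemma chart_nbhs R m (M : manifold R m) (c : chart M) (x : M) (r : R) :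
  chart_dom c x -> 0 < r ->
  nbhs x [set x' | chart_dom c x' /\ `|to_coord c x' - to_coord c x| < r].
Proof.
move=> xc r0; apply: filterI.
  by apply: open_nbhs_nbhs; split => //; exact: open_chart_dom.
have /cvgrPdist_lt/(_ _ r0) := to_coord_cont xc.
by apply: filterS => z; rewrite distrC.
Qed.

Lemma has_velocity_is_derive R n (M : symplectic_manifold R n)
    (A : set R) (g : R -> M) t c v :
  nbhs t A -> has_velocity A g t c v -> is_derive t 1 (to_coord c \o g) v.
Proof.
move=> tA [_ H].
have C : (h^-1 *: ((to_coord c \o g \o shift t) (h *: 1) - (to_coord c \o g) t))
    @[h --> (0 : R)^'] --> v.
  apply/cvgrPdist_lt => e e0; move/cvgrPdist_lt : H => /(_ e e0); rewrite near_withinE => H'.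
  have : \forall h \near (0 : R)^', A (t + h).
    have /near_ball_norm[r r0 Hr] := tA.
    by apply: filterS (dnbhs0_lt r0) => h hr; apply: Hr; rewrite addrAC subrr add0r.
  move: H'; apply: filterS2 => h H1 H2.
  by rewrite /= [h%:A]mulr1 [h + t]addrC; exact: H1.
by split; [apply/cvg_ex; exists v; exact: C|apply: cvg_lim => //; exact: C].
Qed.

(** A velocity [v] bounds the difference quotients near t by |v| + 1; this is the source of all
    continuity of orbits used later. *)
Lemma has_velocity_cvg R n (M : symplectic_manifold R n)
    (A : set R) (g : R -> M) t c v (e : R) :
  has_velocity A g t c v -> 0 < e ->
  exists2 r : R, 0 < r & forall s, A s -> `|s - t| < r ->
    chart_dom c (g t) -> chart_dom c (g s) /\ `|to_coord c (g s) - to_coord c (g t)| < e.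
Proof.
move=> [D H] e0.
have [r1 r10 H1] : exists2 r : R, 0 < r & forall s, `|s - t| < r -> A s -> chart_dom c (g s).
  by apply/near_ball_norm; exact: D.
have v0 : (0 : R) < `|v| + 1 by rewrite ltr_wpDl.
have [r2 r20 H2] : exists2 r : R, 0 < r & forall h, `|h - 0| < r -> h != 0 -> A (t + h) ->
    `|h^-1 *: (to_coord c (g (t + h)) - to_coord c (g t))| < `|v| + 1.
  apply/near_ball_norm.
  move/cvgrPdist_lt : H => /(_ 1 ltr01); rewrite near_withinE near_withinE.
  apply: filterS => h H h0 /(H h0) H'.
  rewrite -[X in `|X|](subKr v); apply: le_lt_trans (ler_normB _ _) _.
  by rewrite ltrD2l.
exists (Num.min r1 (Num.min r2 (e / (`|v| + 1)))).
  by rewrite !lt_min r10 r20 divr_gt0.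
move=> s As; rewrite !lt_min => /and3P[s1 s2 s3] gt.
split; first exact: H1.
have [->|st] := eqVneq s t; first by rewrite subrr normr0.
have st0 : s - t != 0 by rewrite subr_eq0.
have := H2 (s - t); rewrite subr0 subrKC => /(_ s2 st0 As).
rewrite normrZ normfV mulrC ltr_pdivrMr ?normr_gt0// => H3.
apply: (lt_trans H3); by rewrite mulrC -ltr_pdivlMr.
Qed.

Lemma orbit_near R n (M : symplectic_manifold R n)
    (A : set R) (F : R -> M -> R) (g : R -> M) t c (e : R) :
  ham_orbit A F g -> A t -> chart_dom c (g t) -> 0 < e ->
  exists2 r : R, 0 < r & forall s, A s -> `|s - t| < r ->
    chart_dom c (g s) /\ `|to_coord c (g s) - to_coord c (g t)| < e.
Proof.
move=> og At gt e0; have [v [Hv _]] := og t At c gt.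
have [r r0 H] := has_velocity_cvg Hv e0.
by exists r => // s As st; exact: H.
Qed.

Lemma orbit_nbhs R n (M : symplectic_manifold R n)
    (A : set R) (F : R -> M -> R) (g : R -> M) t (P : M -> Prop) :
  ham_orbit A F g -> A t -> nbhs (g t) P ->
  exists2 r : R, 0 < r & forall s, A s -> `|s - t| < r -> P (g s).
Proof.
move=> og At tP; have [c gt] := chart_cover (g t).
have [e e0 He] := nbhs_of_chart gt tP.
have [r r0 H] := orbit_near og At gt e0.
exists r => // s As st; have [sc se] := H s As st.
by have [_] := He _ se; rewrite to_coordK.
Qed.

Lemma orbit_continuous R n (M : symplectic_manifold R n)
    (A : set R) (F : R -> M -> R) (g : R -> M) (a b : R) c :
  ham_orbit A F g -> (forall s, a <= s <= b -> A s /\ chart_dom c (g s)) ->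
  {within `[a, b], continuous (to_coord c \o g)}.
Proof.
move=> og H; apply/subspace_continuousP => t; rewrite /= in_itv/= => tab.
have [At gt] := H t tab.
apply/cvgrPdist_lt => e e0; rewrite near_withinE.
have [r r0 Hr] := orbit_near og At gt e0.
have N : \forall s \near t, `|s - t| < r by apply/near_ball_norm; exists r.
apply: filterS N => s sr; rewrite /= in_itv/= => sab.
have [As gs] := H s sab.
by rewrite distrC; have [] := Hr s As sr.
Qed.

Lemma orbit_derive R n (M : symplectic_manifold R n)
    (A : set R) (F : R -> M -> R) (g : R -> M) t c :
  ham_orbit A F g -> nbhs t A -> chart_dom c (g t) ->
  is_derive t 1 (to_coord c \o g)
    (ham_field (Defs.form c) (F t \o of_coord c) (to_coord c (g t))).
Proof.
move=> og tA gt; have [v [Hv Hh]] := og t (nbhs_singleton tA) c gt.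
by rewrite -(is_ham_vectorE gt Hh); exact: has_velocity_is_derive Hv.
Qed.

Lemma interval_nbhs R (A : set R) (a b t : R) :
  is_interval A -> A a -> A b -> a < t < b -> nbhs t A.
Proof.
move=> iA Aa Ab /andP[ta tb]; near=> s.
by apply: (iA a b) => //; apply/andP; split; apply: ltW; near: s;
  [exact: lt_nbhsr|exact: lt_nbhsl].
Unshelve. all: by end_near. Qed.

Lemma ham_field0 R m (A : 'rV[R]_m -> 'M[R]_m) (f : 'rV[R]_m -> R) y :
  (\forall z \near y, f z = 0) -> ham_field A f y = 0.
Proof.
move=> f0; rewrite /ham_field (_ : \row_i _ = 0) ?mul0mx//.
apply/rowP => i; rewrite !mxE.
have E : \forall z \near y, f z = cst 0 z by apply: filterS f0.
by rewrite (near_eq_derive _ E) derive_cst.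
Qed.

Lemma derive0_eq R m (u : R -> 'rV[R]_m) (a b : R) : a <= b ->
  {within `[a, b], continuous u} ->
  (forall t, a < t < b -> is_derive t 1 u 0) -> u a = u b.
Proof.
move=> ab cu du.
have [||+ _] := @gronwall _ _ (fun t => u t - u a) (fun=> 0) a b 0 ab (lexx _).
- move=> x; apply: (@continuousB _ _ (subspace `[a, b]) u (fun=> u a) x); first exact: cu.
  exact: cst_continuous.
- move=> t tab; rewrite normr0 mul0r lexx; split => //.
  have := is_deriveB (du t tab) (is_derive_cst (u a) t (1 : R)).
  by rewrite subr0.
- by rewrite subrr normr0 mulr0 normr_le0 subr_eq0 => /eqP.
Qed.

(** While the orbit stays off the closed set [K] its velocity is 0, and it stays off [K] near any
    time at which it sits at [g t0]. Connectedness of the time set turns this local rest into rest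
    for all times. *)
Lemma orbit_stationary R n (M : symplectic_manifold R n)
    (A : set R) (F : R -> M -> R) (g : R -> M) (K : set M) (t0 : R) :
  is_interval A -> closed K -> (forall t x, A t -> ~ K x -> F t x = 0) ->
  ham_orbit A F g -> A t0 -> ~ K (g t0) -> forall t, A t -> g t = g t0.
Proof.
move=> iA clK F0 og At0 Kt0.
apply: (@connected_ind _ A (fun t => g t = g t0) t0) => //.
  exact/connected_intervalP.
(* If [g t] differs from [g t0], it still does at nearby times because [M] is Hausdorff, and the
   transfer is vacuous. *)
move=> t At; have [gtt0|gtt0] := pselect (g t = g t0); last first.
  have oU : nbhs (g t) (~` [set g t0]).
    apply: open_nbhs_nbhs; split => //; apply: closed_openC.
    by apply: accessible_closed_set1; apply: hausdorff_accessible; exact: manifold_hausdorff.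
  have [r r0 H] := orbit_nbhs og At oU.
  exists [set s | `|s - t| < r]; first exact: nbhs_norm_lt.
  by move=> s s' As As' /= sr _ /(H s As sr).
have oU : nbhs (g t) (~` K).
  by apply: open_nbhs_nbhs; split; [exact: closed_openC|rewrite /= gtt0].
have [c gc] := chart_cover (g t).
have [r1 r10 H1] := orbit_nbhs og At oU.
have [r2 r20 H2] := orbit_near og At gc ltr01.
exists [set s | `|s - t| < Num.min r1 r2].
  by apply: nbhs_norm_lt; rewrite lt_min r10.
have main a b : a <= b -> A a -> A b -> `|a - t| < Num.min r1 r2 ->
    `|b - t| < Num.min r1 r2 -> g a = g b.
  move=> ab Aa Ab ar br.
  have P s : a <= s <= b -> [/\ A s, `|s - t| < r1 & `|s - t| < r2].
    move=> /andP[as_ sb]; have : `|s - t| < Num.min r1 r2.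
      move: ar br; rewrite !ltr_norml => /andP[? ?] /andP[? ?]; apply/andP; split; lra.
    by rewrite lt_min => /andP[? ?]; split => //; apply: (iA a b) => //; rewrite as_.
  have dom s : a <= s <= b -> A s /\ chart_dom c (g s).
    by move=> /P[As _ s2]; split => //; have [] := H2 s As s2.
  have E : to_coord c (g a) = to_coord c (g b).
    apply: (@derive0_eq _ _ (to_coord c \o g) a b ab); first exact: orbit_continuous og dom.
    move=> s sab; have sab' : a <= s <= b by case/andP: sab => /ltW -> /ltW ->.
    have [As s1 s2] := P s sab'; have [_ gs] := dom s sab'.
    have := orbit_derive og (interval_nbhs iA Aa Ab sab) gs.
    rewrite ham_field0//.
    have nK : nbhs (g s) (~` K) by apply: open_nbhs_nbhs; split; [exact: closed_openC|exact: H1].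
    have [e e0 He] := nbhs_of_chart gs nK.
    apply/near_ball_norm; exists e => // y /He[_ ?]; exact: F0.
  have /dom[_ ga] : a <= a <= b by rewrite lexx.
  have /dom[_ gb] : a <= b <= b by rewrite lexx andbT.
  by rewrite -(to_coordK ga) E to_coordK.
move=> s s' As As' /= sr sr'.
by have [ss|/ltW ss] := leP s s'; [rewrite (main s s')|rewrite (main s' s)].
Qed.

Lemma smooth_on_local R (V W : normedModType R) (U : set V) (f : V -> W) :
  (forall x, U x -> exists U', [/\ open U', U' x & smooth_on U' f]) -> smooth_on U f.
Proof.
move=> H k; elim: k f H => [|k IH] f H /=.
  by move=> x /H[U' [_ U'x sf]]; exact: (smooth_continuous sf).
split=> [x v /H[U' [_ U'x sf]]|v].
  exact: (smooth_derivable sf).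
apply: IH => x /H[U' [oU' U'x sf]]; exists U'; split => //.
exact: smooth_derive.
Qed.

Lemma form_smooth_on R n (M : symplectic_manifold R n) (c : chart M) i j :
  smooth_on (chart_img c) (fun z => Defs.form c z i j).
Proof.
by apply: smooth_on_local => y yc; apply/smooth_atT; exact: form_smooth.
Qed.

Lemma form_inv_smooth R n (M : symplectic_manifold R n) (c : chart M) i j :
  smooth_on (chart_img c) (fun z => invmx (Defs.form c z) i j).
Proof.
apply: smooth_invmx; first exact: open_chart_img.
  by move=> k l; exact: form_smooth_on.
by move=> y; exact: form_unit.
Qed.

Lemma norm_pair_lt R (V : normedModType R) (t : R) (y : V) (r : R) :
  0 < r -> (`|(t, y)| < r) = (`|t| < r) && (`|y| < r).
Proof. by move=> r0; rewrite prod_normE/= gt_max. Qed.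

Lemma near_pair_norm R (V : normedModType R) (t : R) (y : V)
    (P : R * V -> Prop) : (\forall z \near (t, y), P z) ->
  exists2 r : R, 0 < r & forall s z, `|s - t| < r -> `|z - y| < r -> P (s, z).
Proof.
move=> /near_ball_norm[r r0 H]; exists r => // s z sr zr; apply: H.
by rewrite norm_pair_lt// sr.
Qed.

(** [C] exceeds every spatial partial derivative at the centre, hence near it, uniformly in time. *)
Lemma smooth_slice_lipschitz R m (U : set (R * 'rV[R]_m))
    (Y : 'I_m -> R * 'rV[R]_m -> R) (t1 : R) (y1 : 'rV[R]_m) :
  open U -> U (t1, y1) -> (forall j, smooth_on U (Y j)) ->
  exists r L : R, [/\ 0 < r, 0 <= L & forall t a b, `|t - t1| < r -> `|a - y1| < r ->
    `|b - y1| < r -> U (t, a) /\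
    `|(\row_j Y j (t, a)) - (\row_j Y j (t, b))| <= L * `|a - b|].
Proof.
move=> oU U1 sY.
pose D (j k : 'I_m) z := 'D_((0 : R), e_ k : 'rV[R]_m) (Y j) z.
pose C := \sum_j \sum_k `|D j k (t1, y1)| + 1.
have bD j k : `|D j k (t1, y1)| < C.
  rewrite /C ltr_pwDr//.
  rewrite (bigD1 j)//= (bigD1 k)//= -addrA lerDl.
  by rewrite addr_ge0// sumr_ge0// => i _; rewrite sumr_ge0.
have N1 : \forall z \near (t1, y1), forall jk : 'I_m * 'I_m, `|D jk.1 jk.2 z| < C.
  apply: (@filter_forall _ ('I_m * 'I_m)%type (fun jk z => `|D jk.1 jk.2 z| < C)
    (nbhs (t1, y1))) => -[j k] /=.
  have cD : {for (t1, y1), continuous (D j k)}.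
    exact: (smooth_continuous (smooth_derive _ (sY j))).
  have cN : `|D j k z| @[z --> (t1, y1)] --> `|D j k (t1, y1)|.
    by apply: cvg_norm; exact: cD.
  exact: (cvgr_lt _ cN).
have N2 : \forall z \near (t1, y1), U z by apply: open_nbhs_nbhs.
have [r r0 Hr] := near_pair_norm (filterI N1 N2).
have C0 : 0 <= C by rewrite addr_ge0// sumr_ge0// => i _; rewrite sumr_ge0.
exists r, (m%:R * C); split => //; first by rewrite mulr_ge0.
move=> t a b tr ar br; split; first by have [] := Hr t a tr ar.
apply/rV_norm_le; first by rewrite !mulr_ge0.
move=> j; rewrite !mxE.
apply: (@lipschitz_coord _ _ (fun y => Y j (t, y)) y1 r) => // y yr k.
have [Dz Uz] := Hr t y tr yr; rewrite derive_slice; split.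
  exact: (smooth_derivable (smooth_slice t (sY j))).
exact: (ltW (Dz (j, k))).
Qed.

(** [G] continues the family smoothly past the end points of [0, 1]; [U] is cut down so that the
    matrix of omega is smooth along it. *)
Lemma family_ham_field R n (M : symplectic_manifold R n)
    (F : R -> M -> R) (c : chart M) t1 y1 : smooth_family F ->
  `[0, 1]%classic t1 -> chart_img c y1 ->
  exists (U : set (R * 'rV[R]_(n + n))) (G : R * 'rV[R]_(n + n) -> R),
  [/\ open U, U (t1, y1), smooth_on U G, (forall z, U z -> chart_img c z.2) &
     forall t y, `[0, 1]%classic t -> U (t, y) -> F t (of_coord c y) = G (t, y)].
Proof.
move=> sF t1I y1c; have [U [G [oU U1 sG FG]]] := sF c t1 y1 t1I y1c.
exists (U `&` [set z | chart_img c z.2]), G; split.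
- by apply: openI => //; apply: open_snd; exact: open_chart_img.
- by [].
- by apply: smooth_onW sG => z [].
- by move=> z [].
- by move=> t y tI [Uty _]; exact: (FG (t, y)).
Qed.

Lemma family_ham_field_lipschitz R n (M : symplectic_manifold R n)
    (F : R -> M -> R) (c : chart M) t1 y1 : smooth_family F ->
  `[0, 1]%classic t1 -> chart_img c y1 ->
  exists r L : R, [/\ 0 < r, 0 <= L & forall t a b, `[0, 1]%classic t ->
    `|t - t1| < r -> `|a - y1| < r -> `|b - y1| < r ->
    `|ham_field (Defs.form c) (F t \o of_coord c) a -
      ham_field (Defs.form c) (F t \o of_coord c) b| <= L * `|a - b|].
Proof.
move=> sF t1I y1c.
have [U [G [oU U1 sG Uc FG]]] := family_ham_field sF t1I y1c.
pose Y (j : 'I_(n + n)) z := \sum_i 'D_((0 : R), e_ i : 'rV[R]_(n + n)) G z *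
  invmx (Defs.form c z.2) i j.
have sY j : smooth_on U (Y j).
  apply: smooth_sum => // i _; apply: smoothM => //; first exact: smooth_derive.
  apply: (@smooth_onW _ _ _ [set z | chart_img c z.2]); first by move=> z /Uc.
  exact: (smooth_snd (form_inv_smooth c i j)).
have [r [L [r0 L0 H]]] := smooth_slice_lipschitz oU U1 sY.
have E t a : `[0, 1]%classic t -> U (t, a) ->
    ham_field (Defs.form c) (F t \o of_coord c) a = \row_j Y j (t, a).
  move=> tI Uta; apply/rowP => j; rewrite /ham_field !mxE; apply: eq_bigr => i _.
  rewrite mxE; congr (_ * _).
  rewrite -(derive_slice G t a (e_ i)); apply: near_eq_derive.
  apply: (near_open (@open_slice _ _ U t oU)) => // y Uty; exact: FG.
exists r, L; split => // t a b tI tr ar br.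
have [Ua La] := H t a b tr ar br; have [Ub _] := H t b a tr br ar.
by rewrite !E.
Qed.

Lemma rV_mvt_le R m (u w : R -> 'rV[R]_m) (a b C : R) :
  a <= b -> {within `[a, b], continuous u} ->
  (forall t, a < t < b -> is_derive t 1 u (w t) /\ `|w t| <= C) ->
  `|u b - u a| <= C * (b - a).
Proof.
rewrite le_eqVlt => /orP[/eqP <-|ab] cu du.
  by rewrite !subrr normr0 mulr0.
have C0 : 0 <= C.
  have mab : a < (a + b) / 2 < b by apply/andP; split; lra.
  have [_] := du _ mab; exact: le_trans.
apply/rV_norm_le; first by rewrite mulr_ge0// subr_ge0 ltW.
move=> i; rewrite !mxE.
have di (t : R) : t \in `]a, b[ -> is_derive t 1 (fun t => u t 0 i) (w t 0 i).
  by rewrite in_itv/= => tab; have [d _] := du t tab; exact: is_derive_coord.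
have ci : {within `[a, b], continuous (fun t => u t 0 i)}.
  move=> x; apply: (@continuous_comp (subspace `[a, b]) _ _ u
    (fun y : 'rV[R]_m => y 0 i) x); first exact: cu.
  exact: coord_continuous.
have [t tab ->] := MVT ab di ci.
have ba : 0 <= b - a by rewrite subr_ge0 ltW.
rewrite normrM (ger0_norm ba) ler_wpM2r//.
rewrite in_itv/= in tab; have [_] := du t tab; apply: le_trans; exact: rV_coord_le.
Qed.

(** The last two bounds measure the change of the difference against its size at either end, so that
    two times can be compared in either order. Gronwall from each end bounds the difference in
    between, and the mean value inequality then bounds its change. *)
Lemma orbit_diff_ineq R n (M : symplectic_manifold R n)
    (A : set R) (F : R -> M -> R) (g g' : R -> M) (c : chart M) (a b L : R) :
  is_interval A -> A a -> A b -> a <= b -> 0 <= L ->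
  ham_orbit A F g -> ham_orbit A F g' ->
  (forall s, a <= s <= b -> [/\ chart_dom c (g s), chart_dom c (g' s) &
    `|ham_field (Defs.form c) (F s \o of_coord c) (to_coord c (g s)) -
      ham_field (Defs.form c) (F s \o of_coord c) (to_coord c (g' s))|
     <= L * `|to_coord c (g s) - to_coord c (g' s)|]) ->
  let u s := to_coord c (g s) - to_coord c (g' s) in
  let K := gronwall_const (n + n) (L * (b - a)) in
  [/\ `|u b| <= K * `|u a|, `|u a| <= K * `|u b|,
      `|u b - u a| <= L * K * `|u a| * (b - a) &
      `|u b - u a| <= L * K * `|u b| * (b - a)].
Proof.
move=> iA Aa Ab ab L0 og og' H u K.
have As s : a <= s <= b -> A s by apply: iA.
pose w s := ham_field (Defs.form c) (F s \o of_coord c) (to_coord c (g s)) -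
      ham_field (Defs.form c) (F s \o of_coord c) (to_coord c (g' s)).
have cu a' b' : a <= a' -> b' <= b -> {within `[a', b'], continuous u}.
  move=> aa bb x.
  apply: (@continuousB _ _ (subspace `[a', b']) (to_coord c \o g) (to_coord c \o g') x).
    apply: (orbit_continuous (c := c) og) => s /andP[s1 s2].
    have sab : a <= s <= b by rewrite (le_trans aa)// (le_trans s2).
    by split; [exact: As|have [] := H s sab].
  apply: (orbit_continuous (c := c) og') => s /andP[s1 s2].
  have sab : a <= s <= b by rewrite (le_trans aa)// (le_trans s2).
  by split; [exact: As|have [] := H s sab].
have du s : a < s < b -> is_derive s 1 u (w s) /\ `|w s| <= L * `|u s|.
  move=> sab; have sab' : a <= s <= b by case/andP: sab => /ltW -> /ltW ->.
  have [gs gs' Ls] := H s sab'; split => //.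
  have nA := interval_nbhs iA Aa Ab sab.
  exact: (is_deriveB (orbit_derive og nA gs) (orbit_derive og' nA gs')).
have Kmon x : x <= b - a -> gronwall_const (n + n) (L * x) <= K.
  move=> xb; rewrite /K /gronwall_const lerD2r ler_wpM2l// ler_expR.
  by rewrite ler_wpM2l ?mulr_ge0// ler_wpM2l.
have [G1 G2] := gronwall ab L0 (cu _ _ (lexx a) (lexx b)) du.
have mid s : a <= s <= b -> `|u s| <= K * `|u a| /\ `|u s| <= K * `|u b|.
  move=> /andP[as_ sb].
  have [H1 _] := gronwall as_ L0 (cu _ _ (lexx a) sb)
    (fun t tas => du t (introT andP (conj (proj1 (andP tas)) (lt_le_trans (proj2 (andP tas)) sb)))).
  have [_ H2] := gronwall sb L0 (cu _ _ as_ (lexx b))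
    (fun t tas => du t (introT andP (conj (le_lt_trans as_ (proj1 (andP tas))) (proj2 (andP tas))))).
  split.
    apply: (le_trans H1); rewrite ler_wpM2r// Kmon// lerD2r//.
  apply: (le_trans H2); rewrite ler_wpM2r// Kmon// lerD2l lerN2//.
have mvt C : (forall s, a <= s <= b -> `|u s| <= C) -> `|u b - u a| <= L * C * (b - a).
  move=> uC; apply: (rV_mvt_le ab (cu _ _ (lexx a) (lexx b)) (w := w)) => s sab.
  have sab' : a <= s <= b by case/andP: sab => /ltW -> /ltW ->.
  have [d wL] := du s sab; split => //; apply: (le_trans wL).
  by rewrite ler_wpM2l// uC.
by split => //; rewrite -(mulrA L K); apply: mvt => s /mid[].
Qed.

(** * Surjectivity of the maps of a Hamiltonian isotopy *)

Lemma isotopy_near R n (M : symplectic_manifold R n)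
    (phi : R -> M -> M) (t1 : R) (x0 : M) (d : chart M) (e : R) :
  smooth_isotopy phi -> `[0, 1]%classic t1 -> chart_dom d (phi t1 x0) -> 0 < e ->
  exists2 r : R, 0 < r & exists2 N : set M, nbhs x0 N &
    forall t x, `[0, 1]%classic t -> `|t - t1| < r -> N x -> chart_dom d (phi t x) /\
      `|to_coord d (phi t x) - to_coord d (phi t1 x0)| < e.
Proof.
move=> sphi t1I dx e0; have [c x0c] := chart_cover x0.
have y0c := to_coord_img x0c; set y0 := to_coord c x0 in y0c.
have xE : of_coord c y0 = x0 by exact: to_coordK.
have [|N1 [U [G [oU U1 sG FG]]]] := sphi c d t1 y0 t1I y0c; first by rewrite xE.
rewrite near_withinE in N1.
have N2 : \forall z \near (t1, y0), U z by apply: open_nbhs_nbhs.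
have N3 : \forall z \near (t1, y0), `|G (t1, y0) - G z| < e.
  have cG : {for (t1, y0), continuous G} by exact: (smooth_continuous sG).
  by move/cvgrPdist_lt : cG => /(_ e e0).
have [r r0 Hr] := near_pair_norm (filterI N1 (filterI N2 N3)).
exists r => //; exists [set x | chart_dom c x /\ `|to_coord c x - y0| < r].
  exact: chart_nbhs.
move=> t x tI tr [xc xr]; have [H1 [H2 H3]] := Hr t (to_coord c x) tr xr.
have {}H1 := H1 (conj tI I); rewrite /= to_coordK// in H1.
have E1 := FG (t1, y0) U1 (conj t1I I); rewrite /= xE in E1.
have E2 := FG (t, to_coord c x) H2 (conj tI I); rewrite /= to_coordK// in E2.
by split => //; rewrite distrC E1 E2.
Qed.

(** Openness is recorded at a single point, so that it can be propagated along [0, 1] with that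
    point fixed. *)
Definition open_at (T1 T2 : topologicalType) (f : T1 -> T2) (x : T1) :=
  forall N, nbhs x N -> nbhs (f x) (f @` N).

(* Two maps of an orbit family close in time differ, in a chart, by a
   perturbation of the identity. *)
Lemma isotopy_open_step R n (M : symplectic_manifold R n)
    (F : R -> M -> R) (phi : R -> M -> M) (x0 : M) (t1 : R) :
  smooth_isotopy phi -> generates F phi -> `[0, 1]%classic t1 ->
  exists2 r : R, 0 < r & forall t t', `[0, 1]%classic t -> `[0, 1]%classic t' ->
    `|t - t1| < r -> `|t' - t1| < r -> open_at (phi t) x0 -> open_at (phi t') x0.
Proof.
move=> sphi [sF oF] t1I; have [c gc] := chart_cover (phi t1 x0).
have yc := to_coord_img gc; set y1 := to_coord c (phi t1 x0) in yc.
have [r1 [L [r10 L0 HL]]] := family_ham_field_lipschitz sF t1I yc.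
have [r2 r20 [N0 N0x HN]] := isotopy_near sphi t1I gc r10.
have iI : is_interval (`[0, 1]%classic : set R) by exact: interval_is_interval.
pose K := gronwall_const (n + n) L.
have K1 : 1 <= K by exact: gronwall_const_ge1.
have LK0 : 0 <= L * K by rewrite mulr_ge0// (le_trans ler01).
(* Two times within [d] of [t1] are at most 2 d apart, and L K (2 d) <= 1/2 is the constant of
   [perturb_id_surj]. Also 2 d <= 1, so that [K] bounds the Gronwall factor. *)
pose d : R := (L * K + 1)^-1 / 4.
have LK1 : 0 < L * K + 1 by rewrite ltr_wpDl.
have d0 : 0 < d by rewrite /d divr_gt0// invr_gt0.
have dLK : L * K * (2 * d) <= 2^-1.
  rewrite /d mulrCA mulrA mulrA.
  rewrite (_ : _ / 4 = (L * K / (L * K + 1)) / 2); last by field; rewrite lt0r_neq0.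
  by rewrite ler_piMl// ler_pdivrMr// mul1r lerDl.
have d1 : 2 * d <= 1.
  have : (L * K + 1)^-1 <= 1 by rewrite invf_le1// lerDr.
  by rewrite /d; lra.
pose r := Num.min (Num.min r1 r2) d.
exists r; first by rewrite !lt_min r10 r20 d0.
have key a b x x' : `[0, 1]%classic a -> `[0, 1]%classic b -> a <= b ->
    `|a - t1| < r -> `|b - t1| < r -> N0 x -> N0 x' ->
    let u s := to_coord c (phi s x) - to_coord c (phi s x') in
    `|u b - u a| <= 2^-1 * `|u a| /\ `|u b - u a| <= 2^-1 * `|u b|.
  move=> aI bI ab ar br Nx Nx' u.
  have mid s : a <= s <= b -> `[0, 1]%classic s /\ `|s - t1| < r.
    move=> sab; split; first exact: (iI a b).
    move: sab ar br => /andP[? ?]; rewrite !ltr_norml => /andP[? ?] /andP[? ?].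
    by apply/andP; split; lra.
  have [|_ _ H1 H2] := @orbit_diff_ineq _ _ _ `[0, 1]%classic F (phi ^~ x) (phi ^~ x') c a b L
    iI aI bI ab L0 (oF x) (oF x').
    move=> s /mid[sI]; rewrite !lt_min => /andP[/andP[s1 s2] s3].
    have [dx xr] := HN s x sI s2 Nx; have [dx' xr'] := HN s x' sI s2 Nx'.
    by split => //; exact: HL.
  have bad : b - a <= 2 * d.
    move: ar br; rewrite !lt_min => /andP[_ ad] /andP[_ bd].
    move: ad bd; rewrite !ltr_norml => /andP[? ?] /andP[? ?]; lra.
  have ba0 : 0 <= b - a by rewrite subr_ge0.
  have gK : gronwall_const (n + n) (L * (b - a)) <= K.
    rewrite /K /gronwall_const lerD2r ler_wpM2l// ler_expR ler_wpM2l ?mulr_ge0//.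
    by rewrite ler_piMr// (le_trans bad).
  have fin v : 0 <= v -> L * gronwall_const (n + n) (L * (b - a)) * v * (b - a) <= 2^-1 * v.
    move=> v0; rewrite mulrAC ler_wpM2r//; apply: le_trans dLK.
    by apply: ler_pM => //; [rewrite mulr_ge0// ltW// gronwall_const_gt0|rewrite ler_wpM2l].
  by split; [apply: le_trans (fin _ _)|apply: le_trans (fin _ _)].
move=> t t' tI tI' tr tr' Ot N xN.
have key' x x' : N0 x -> N0 x' ->
    `|to_coord c (phi t' x) - to_coord c (phi t' x') -
      (to_coord c (phi t x) - to_coord c (phi t x'))| <=
    2^-1 * `|to_coord c (phi t x) - to_coord c (phi t x')|.
  move=> Nx Nx'; have [tt|/ltW tt] := leP t t'.
    by have [] := key t t' x x' tI tI' tt tr tr' Nx Nx'.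
  by have [_] := key t' t x x' tI' tI tt tr' tr Nx Nx'; rewrite distrC.
have tr2 : `|t - t1| < r2 by move: tr; rewrite !lt_min => /andP[/andP[]].
have tr2' : `|t' - t1| < r2 by move: tr'; rewrite !lt_min => /andP[/andP[]].
have N0x0 := nbhs_singleton N0x.
have [ctx _] := HN t x0 tI tr2 N0x0; have [ctx' _] := HN t' x0 tI' tr2' N0x0.
have [rho rho0 Hrho] := nbhs_of_chart ctx (Ot _ (filterI xN N0x)).
set y0 := to_coord c (phi t x0) in Hrho.
have ex y : exists x, `|y - y0| < rho -> [/\ N x, N0 x & to_coord c (phi t x) = y].
  have [yr|yr] := pselect (`|y - y0| < rho); last by exists x0.
  have [yc' [x [Nx N0x'] xE]] := Hrho y yr; exists x => _; split => //.
  by rewrite xE of_coordK.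
have [X XP] := choice ex.
(* [X] is an arbitrary choice of preimages under [phi t]; whatever the choice, [key'] makes [Psi]
   close to the identity. *)
pose Psi y := to_coord c (phi t' (X y)).
have y0r : `|y0 - y0| < rho by rewrite subrr normr0.
have r20' : 0 < rho / 2 by rewrite divr_gt0.
have in_rho y : `|y - y0| <= rho / 2 -> `|y - y0| < rho.
  by move=> H; apply: (le_lt_trans H); lra.
have PsiH y y' : `|y - y0| <= rho / 2 -> `|y' - y0| <= rho / 2 ->
    `|Psi y - Psi y' - (y - y')| <= 2^-1 * `|y - y'|.
  move=> /in_rho yr /in_rho yr'.
  have [_ N1 E1] := XP y yr; have [_ N2 E2] := XP y' yr'.
  by have := key' _ _ N1 N2; rewrite E1 E2.
have Psi0 : Psi y0 = to_coord c (phi t' x0).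
  have [_ N1 E1] := XP y0 y0r.
  have := key' _ _ N1 N0x0; rewrite E1 -/y0 subrr subr0 normr0 mulr0 normr_le0 subr_eq0.
  by move/eqP.
have r40 : 0 < rho / 4 by rewrite divr_gt0.
apply: filterS (chart_nbhs ctx' r40) => x'' [xc'' xr''].
have [|y yr yE] := perturb_id_surj (z := to_coord c x'') r20' PsiH.
  by rewrite Psi0; apply: (le_trans (ltW xr'')); lra.
have [Nx N1 _] := XP y (in_rho y yr); exists (X y) => //.
have [cX _] := HN t' (X y) tI' tr2' N1.
by rewrite -(to_coordK cX) -/(Psi y) yE to_coordK.
Qed.

(** The image is open because openness at each point propagates from [phi 0 = id]. It is closed
    because [psi] fixes every point off the compact set [K]: a point outside the image avoids the
    compact set psi(K) and is moved by [psi]. Both persist nearby, whereas an image point off psi(K)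
    comes from a point off [K] and is fixed. *)
Lemma Ham_c_surj R n (M : symplectic_manifold R n) (psi : M -> M) :
  connected [set: M] -> Ham_c psi -> forall y, exists x, psi x = y.
Proof.
move=> cM [F [phi [[K cK FK] sphi gF phi0 phi1]]] y.
have I0 : (`[0, 1]%classic : set R) 0 by rewrite /= in_itv/= lexx ler01.
have I1 : (`[0, 1]%classic : set R) 1 by rewrite /= in_itv/= lexx ler01.
have clK : closed K by apply: compact_closed cK; exact: manifold_hausdorff.
have iI : is_interval (`[0, 1]%classic : set R) by exact: interval_is_interval.
have Kphi x : ~ K x -> psi x = x.
  move=> Kx; rewrite -phi1; have K0 : ~ K (phi 0 x) by rewrite phi0.
  have F0 t z : `[0, 1]%classic t -> ~ K z -> F t z = 0 by move=> tI Kz; exact: FK.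
  by rewrite (orbit_stationary iI clK F0 (proj2 gF x) I0 K0 I1) phi0.
have op x : open_at psi x.
  rewrite -phi1; suff : forall t, `[0, 1]%classic t -> open_at (phi t) x by exact.
  have op0 : open_at (phi 0) x by rewrite phi0 => N; rewrite image_id.
  refine (@connected_ind R (`[0, 1]%classic : set R) (fun t : R => open_at (phi t) x) (0 : R) _ I0 op0 _).
    exact: segment_connected.
  move=> t tI; have [r r0 H] := isotopy_open_step x sphi gF tI.
  exists [set s | `|s - t| < r]; first exact: nbhs_norm_lt.
  by move=> s s' sI sI' /= sr sr'; exact: H.
have cpsi x (N : set M) : nbhs (psi x) N -> nbhs x (psi @^-1` N).
  move=> xN; have [c xc] := chart_cover (psi x).
  have [e e0 He] := nbhs_of_chart xc xN.
  rewrite -phi1 in xc He.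
  have [r r0 [N' xN' HN]] := isotopy_near sphi I1 xc e0.
  apply: filterS xN' => z Nz; have [|zc zr] := HN 1 z I1 _ Nz; first by rewrite subrr normr0.
  by have [_] := He _ zr; rewrite to_coordK// phi1.
apply: (@connected_ind _ [set: M] (fun y => exists x, psi x = y) (psi y)) => //.
  by exists y.
move=> z _; have [[x <-]|nz] := pselect (exists x, psi x = z).
  exists (psi @` setT); first by apply: op; exact: filterT.
  by move=> s s' _ _ _ [x' _ <-] _; exists x'.
have zz : psi z <> z by move=> E; apply: nz; exists z.
have clPK : closed (psi @` K).
  apply: compact_closed; first exact: manifold_hausdorff.
  apply: continuous_compact => //; apply: continuous_subspaceT => x N; exact: cpsi.
have N1 : nbhs z (~` (psi @` K)).
  apply: open_nbhs_nbhs; split; first exact: closed_openC.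
  by move=> [x _ xz]; apply: nz; exists x.
have N2 : nbhs z [set w | psi w <> w].
  have := @manifold_hausdorff _ _ M; rewrite open_hausdorff => /(_ (psi z) z (introN eqP zz)).
  move=> [[A B] /= [/set_mem Az /set_mem Bz] [oA oB AB]].
  have n1 : nbhs z (psi @^-1` A) by apply: cpsi; exact: open_nbhs_nbhs.
  have n2 : nbhs z B by exact: open_nbhs_nbhs.
  apply: filterS (filterI n1 n2) => w [Aw Bw] E.
  have : (A `&` B) w by split => //; rewrite -E.
  by rewrite (eqP AB).
exists (~` (psi @` K) `&` [set w | psi w <> w]); first exact: filterI.
move=> s s' _ _ [Ks ss] _ [x xs]; exfalso.
have [Kx|Kx] := pselect (K x); first by apply: Ks; exists x.
by apply: ss; rewrite -xs !Kphi// Kphi.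
Qed.

(** * Global bounds for compactly supported functions; bilinear forms *)

Lemma zero_off_derive R (V W : normedModType R) (K : set V) (f : V -> W) v x :
  closed K -> (forall y, ~ K y -> f y = 0) -> ~ K x -> 'D_v f x = 0.
Proof.
move=> clK f0 Kx; have oK : open (~` K) by exact: closed_openC.
have E : \forall z \near x, f z = cst 0 z by apply: (near_open oK Kx).
by rewrite (near_eq_derive _ E) derive_cst.
Qed.

Lemma smooth_compact_bounded R m (K : set 'rV[R]_m) (f : 'rV[R]_m -> R) :
  compact K -> {in setT, continuous f} -> (forall y, ~ K y -> f y = 0) ->
  exists2 C : R, 0 <= C & forall y, `|f y| <= C.
Proof.
move=> cK cf f0.
have cfK : compact (f @` K).
  by apply: continuous_compact => //; apply: continuous_subspaceT => y; apply: cf; rewrite inE.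
have [N [Nr HN]] := compact_bounded cfK.
have HB : forall y, K y -> `|f y| <= N + 1 by move=> y Ky; apply: HN; [rewrite ltrDl|exists y].
exists `|N + 1| => // y; have [Ky|Ky] := pselect (K y).
  by apply: (le_trans (HB y Ky)); exact: ler_norm.
by rewrite f0// normr0.
Qed.

Lemma rV_compact_closed R m (K : set 'rV[R]_m) : compact K -> closed K.
Proof. by apply: compact_closed; exact: norm_hausdorff. Qed.

Lemma compact_partials_bounded R m (K : set 'rV[R]_m) (f : 'rV[R]_m -> R) :
  compact K -> smooth_on setT f -> (forall y, ~ K y -> f y = 0) ->
  exists2 C : R, 0 <= C & forall i y, `|'D_(e_ i) f y| <= C.
Proof.
move=> cK sf f0.
have H (i : 'I_m) : exists C : R, 0 <= C /\ forall y, `|'D_(e_ i) f y| <= C.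
  have [||C C0 HC] := @smooth_compact_bounded _ _ K (fun y => 'D_(e_ i) f y) cK.
  - by move=> y _; exact: (smooth_continuous (smooth_derive (e_ i) sf)).
  - by move=> y Ky; apply: zero_off_derive Ky => //; exact: rV_compact_closed.
  by exists C.
have [C HC] := choice H.
exists (\sum_i C i) => [|i y]; first by apply: sumr_ge0 => i _; have [] := HC i.
have [_ H1] := HC i; apply: (le_trans (H1 y)).
by rewrite (bigD1 i)//= lerDl sumr_ge0// => j _; have [] := HC j.
Qed.

Lemma compact_lipschitz R m (K : set 'rV[R]_m) (f : 'rV[R]_m -> R) :
  compact K -> smooth_on setT f -> (forall y, ~ K y -> f y = 0) ->
  exists2 L : R, 0 <= L & forall a b, `|f a - f b| <= L * `|a - b|.
Proof.
move=> cK sf f0; have [C C0 HC] := compact_partials_bounded cK sf f0.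
exists (m%:R * C) => [|a b]; first by rewrite mulr_ge0.
apply: (@lipschitz_coord _ _ f b (`|a - b| + 1)).
- by move=> y _ i; split; [exact: (smooth_derivable sf)|exact: HC].
- by rewrite ltrDl.
- by rewrite subrr normr0 ltr_wpDl.
Qed.

Lemma compact_quad_remainder R m (K : set 'rV[R]_m) (f : 'rV[R]_m -> R) :
  compact K -> smooth_on setT f -> (forall y, ~ K y -> f y = 0) ->
  exists2 C : R, 0 <= C & forall a z, `|f a - f z - 'D_(a - z) f z| <= C * `|a - z| ^+ 2.
Proof.
move=> cK sf f0.
have H (i : 'I_m) : exists C : R, 0 <= C /\ forall a b,
    `|'D_(e_ i) f a - 'D_(e_ i) f b| <= C * `|a - b|.
  have [||C C0 HC] := @compact_lipschitz _ _ K (fun y => 'D_(e_ i) f y) cK.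
  - exact: smooth_derive.
  - by move=> y Ky; apply: zero_off_derive Ky => //; exact: rV_compact_closed.
  by exists C.
have [C HC] := choice H.
have C0 i : 0 <= C i by have [] := HC i.
have S0 : 0 <= \sum_i C i by apply: sumr_ge0.
exists (m%:R * (2 * \sum_i C i)) => [|a z]; first by rewrite !mulr_ge0.
have [->|az] := eqVneq a z.
  by rewrite !subrr derive0 subrr !normr0 expr0n/= mulr0.
have p : 0 < `|a - z| by rewrite normr_gt0 subr_eq0.
(* Balls are open, so a radius larger than |a - z| is taken; the factor 2 enters the constant. *)
have r1 : `|a - z| < 2 * `|a - z| by lra.
have r2 : `|z - z| < 2 * `|a - z| by rewrite subrr normr0 mulr_gt0.
have df y (_ : `|y - z| < 2 * `|a - z|) i : derivable f y (e_ i) by exact: (smooth_derivable sf).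
have [xi xir ->] := mvt_coord df r1 r2.
rewrite (smooth_deriveE _ openT sf I) -sumrB.
rewrite (eq_bigr (fun i => (a - z) 0 i * ('D_(e_ i) f (xi i) - 'D_(e_ i) f z))); last first.
  by move=> i _; rewrite !mxE mulrBr.
rewrite expr2 !mulrA -(mulrA m%:R).
apply: le_trans (sum_coord_le (C := 2 * (\sum_i C i) * `|a - z|) _ _) _; last first.
  by rewrite mulrA.
move=> i; have [_ HCi] := HC i; apply: (le_trans (HCi _ _)).
apply: (@le_trans _ _ (C i * (2 * `|a - z|))); first by rewrite ler_wpM2l// ltW.
rewrite mulrA [C i * 2]mulrC ler_wpM2r// ler_wpM2l//.
by rewrite (bigD1 i)//= lerDl sumr_ge0.
Qed.

Lemma bilinE R m (A : 'M[R]_m) (v w : 'rV[R]_m) :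
  bilin A v w = \sum_i \sum_j v 0 i * A i j * w 0 j.
Proof.
rewrite /bilin mxE exchange_big; apply: eq_bigr => j _.
by rewrite !mxE mulr_suml.
Qed.

Lemma bilinDl R m (A : 'M[R]_m) (u v w : 'rV[R]_m) :
  bilin A (u + v) w = bilin A u w + bilin A v w.
Proof. by rewrite /bilin !mulmxDl mxE. Qed.

Lemma bilinDr R m (A : 'M[R]_m) (u v w : 'rV[R]_m) :
  bilin A u (v + w) = bilin A u v + bilin A u w.
Proof. by rewrite /bilin linearD mulmxDr mxE. Qed.

Lemma bilinNl R m (A : 'M[R]_m) (v w : 'rV[R]_m) :
  bilin A (- v) w = - bilin A v w.
Proof. by rewrite /bilin !mulNmx mxE. Qed.

Lemma bilinNr R m (A : 'M[R]_m) (v w : 'rV[R]_m) :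
  bilin A v (- w) = - bilin A v w.
Proof. by rewrite /bilin linearN mulmxN mxE. Qed.

Lemma bilinZl R m (A : 'M[R]_m) k (v w : 'rV[R]_m) :
  bilin A (k *: v) w = k * bilin A v w.
Proof. by rewrite /bilin -!scalemxAl mxE. Qed.

Lemma bilinZr R m (A : 'M[R]_m) k (v w : 'rV[R]_m) :
  bilin A v (k *: w) = k * bilin A v w.
Proof. by rewrite /bilin linearZ -scalemxAr mxE. Qed.

Lemma form_antisym R n (M : symplectic_manifold R n) (c : chart M) y v w :
  chart_img c y -> bilin (Defs.form c y) v w = - bilin (Defs.form c y) w v.
Proof.
move=> yc; have := form_alternating yc (v + w).
rewrite bilinDl !bilinDr !(form_alternating yc) add0r addr0 => /eqP.
by rewrite addr_eq0 => /eqP.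
Qed.

Lemma bilin_norm_le R m (A : 'M[R]_m) (C : R) (v w : 'rV[R]_m) :
  (forall i j, `|A i j| <= C) -> `|bilin A v w| <= m%:R * (m%:R * C) * `|v| * `|w|.
Proof.
move=> AC; rewrite bilinE.
rewrite (eq_bigr (fun i => v 0 i * \sum_j w 0 j * A i j)); last first.
  by move=> i _; rewrite mulr_sumr; apply: eq_bigr => j _; ring.
rewrite (_ : _ * `|v| * `|w| = m%:R * (m%:R * C * `|w|) * `|v|); last by ring.
apply: sum_coord_le => i.
by apply: sum_coord_le => j.
Qed.

(** * Hamiltonians supported in one chart *)

(* Asking for symmetric second derivatives spares Schwarz' theorem: it will be
   checked directly on the bump functions. *)
Definition generator R n (M : symplectic_manifold R n) (c : chart M)
    (K : set 'rV[R]_(n + n)) (b : 'rV[R]_(n + n) -> R) : Prop :=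
  [/\ compact K, K `<=` chart_img c, smooth_on setT b, (forall y, ~ K y -> b y = 0) &
      forall u v y, 'D_u (fun z => 'D_v b z) y = 'D_v (fun z => 'D_u b z) y].

Lemma generator_field0 R n (M : symplectic_manifold R n) (c : chart M)
    K (b : 'rV[R]_(n + n) -> R) y :
  generator c K b -> ~ K y -> ham_field (Defs.form c) b y = 0.
Proof.
move=> [cK _ _ b0 _] Ky; apply: ham_field0.
have oK : open (~` K) by apply: closed_openC; exact: rV_compact_closed.
exact: (near_open oK Ky).
Qed.

(** [form c] is arbitrary off the image of the chart, but there the partial derivatives of [b]
    vanish: the image of the chart and the open complement of [K] cover everything. *)
Lemma generator_field_smooth R n (M : symplectic_manifold R n) (c : chart M)
    K (b : 'rV[R]_(n + n) -> R) j :
  generator c K b -> smooth_on setT (fun y => ham_field (Defs.form c) b y 0 j).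
Proof.
move=> gb; have [cK Kc sb b0 _] := gb.
have oK : open (~` K) by apply: closed_openC; exact: rV_compact_closed.
apply: (@smooth_onW _ _ _ (chart_img c `|` ~` K)).
  by move=> y _; have [Ky|Ky] := pselect (K y); [left; exact: Kc|right].
apply: smooth_on_setU.
  apply: (@smooth_on_eq _ _ _ _ (fun y => \sum_i 'D_(e_ i) b y * invmx (Defs.form c y) i j)).
  - exact: open_chart_img.
  - by move=> y _; rewrite /ham_field mxE; apply: eq_bigr => i _; rewrite mxE.
  - apply: smooth_sum; first exact: open_chart_img.
    move=> i _; apply: smoothM; [exact: open_chart_img| |exact: form_inv_smooth].
    by apply: smooth_onW (smooth_derive (e_ i) sb).
apply: (@smooth_on_eq _ _ _ _ (fun=> 0)) => //; last exact: smooth_cst.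
by move=> y Ky; rewrite (generator_field0 gb Ky) mxE.
Qed.

Lemma row_choice_bound R m (T : Type) (P : 'I_m -> T -> R) (Q : T -> R) :
  (forall t, 0 <= Q t) ->
  (forall j, exists2 C : R, 0 <= C & forall t, P j t <= C * Q t) ->
  exists2 C : R, 0 <= C & forall j t, P j t <= C * Q t.
Proof.
move=> Q0 H; have H' j : exists C : R, 0 <= C /\ forall t, P j t <= C * Q t.
  by have [C C0 HC] := H j; exists C.
have [C HC] := choice H'.
have C0 i : 0 <= C i by have [] := HC i.
exists (\sum_i C i); first exact: sumr_ge0.
move=> j t; have [_ Hj] := HC j; apply: (le_trans (Hj t)).
by rewrite ler_wpM2r// (bigD1 j)//= lerDl sumr_ge0.
Qed.

Lemma generator_lipschitz R n (M : symplectic_manifold R n) (c : chart M)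
    K (b : 'rV[R]_(n + n) -> R) : generator c K b ->
  exists2 L : R, 0 <= L & forall x y,
    `|ham_field (Defs.form c) b x - ham_field (Defs.form c) b y| <= L * `|x - y|.
Proof.
move=> gb; have [cK _ _ _ _] := gb.
have [||L L0 HL] := @row_choice_bound R (n + n) ('rV[R]_(n + n) * 'rV[R]_(n + n))
  (fun j p => `|ham_field (Defs.form c) b p.1 0 j - ham_field (Defs.form c) b p.2 0 j|)
  (fun p => `|p.1 - p.2|).
- by [].
- move=> j; have [L L0 HL] := compact_lipschitz cK (generator_field_smooth j gb)
    (fun y Ky => etrans (congr1 (fun v : 'rV_(n + n) => v 0 j) (generator_field0 gb Ky)) (mxE _ _ _ _)).
  by exists L => // -[x y]; exact: HL.
- exists L => // x y; apply/rV_norm_le; first by rewrite mulr_ge0.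
  move=> j; have := HL j (x, y); rewrite /= !mxE => H; exact: H.
Qed.

Definition row_derive R m (X : 'rV[R]_m -> 'rV[R]_m) (v z : 'rV[R]_m) :
  'rV[R]_m := \row_j 'D_v (fun y => X y 0 j) z.

Lemma generator_quad R n (M : symplectic_manifold R n) (c : chart M)
    K (b : 'rV[R]_(n + n) -> R) : generator c K b ->
  exists2 C : R, 0 <= C & forall x z,
    `|ham_field (Defs.form c) b x - ham_field (Defs.form c) b z -
      row_derive (ham_field (Defs.form c) b) (x - z) z| <= C * `|x - z| ^+ 2.
Proof.
move=> gb; have [cK _ _ _ _] := gb.
pose X := ham_field (Defs.form c) b.
have [||L L0 HL] := @row_choice_bound R (n + n) ('rV[R]_(n + n) * 'rV[R]_(n + n))
  (fun j p => `|X p.1 0 j - X p.2 0 j - 'D_(p.1 - p.2) (fun y => X y 0 j) p.2|)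
  (fun p => `|p.1 - p.2| ^+ 2).
- by move=> p; rewrite sqr_ge0.
- move=> j; have [L L0 HL] := compact_quad_remainder cK (generator_field_smooth j gb)
    (fun y Ky => etrans (congr1 (fun v : 'rV_(n + n) => v 0 j) (generator_field0 gb Ky)) (mxE _ _ _ _)).
  by exists L => // -[x y]; exact: HL.
- exists L => // x y; apply/rV_norm_le; first by rewrite mulr_ge0 ?sqr_ge0.
  move=> j; have := HL j (x, y); rewrite /= !mxE => H; exact: H.
Qed.

Lemma bilin_form_is_derive R n (M : symplectic_manifold R n) (c : chart M)
    (v w u : 'rV[R]_(n + n)) y : chart_img c y ->
  is_derive y u (fun z => bilin (Defs.form c z) v w : R)
    (\sum_i \sum_j v 0 i * 'D_u (fun z => Defs.form c z i j) y * w 0 j).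
Proof.
move=> yc.
rewrite (_ : (fun z => _) = \sum_i \sum_j (fun z => v 0 i * Defs.form c z i j * w 0 j)).
  apply: is_derive_sum => i; apply: is_derive_sum => j.
  have d : is_derive y u (fun z => Defs.form c z i j) ('D_u (fun z => Defs.form c z i j) y).
    by apply: derivableP; exact: (smooth_derivable (form_smooth_on c i j)).
  have := is_deriveZ (v 0 i * w 0 j) d; rewrite /GRing.scale/= mulrAC.
  congr (is_derive _ _ _ _); apply/funext => z; by rewrite mulrAC.
apply/funext => z; rewrite bilinE fct_sumE; apply: eq_bigr => i _.
by rewrite fct_sumE.
Qed.

(* The infinitesimal form of the invariance of omega under the flow of a
   Hamiltonian field, from d omega = 0 and the symmetry of second derivatives. *)
Lemma ham_field_lie R n (M : symplectic_manifold R n) (c : chart M)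
    K (b : 'rV[R]_(n + n) -> R) z v w : generator c K b -> chart_img c z ->
  let X := ham_field (Defs.form c) b in
  bilin (Defs.form c z) (row_derive X v z) w + bilin (Defs.form c z) v (row_derive X w z) +
  'D_(X z) (fun y => bilin (Defs.form c y) v w : R) z = 0.
Proof.
move=> gb zc X; have [_ _ sb _ sym] := gb.
(* Differentiate the identity omega (X, u') = D_u' b in the direction u. *)
have half u u' : bilin (Defs.form c z) (row_derive X u z) u' =
    'D_u (fun y => 'D_u' b y) z - 'D_u (fun y => bilin (Defs.form c y) (X z) u' : R) z.
  apply/eqP; rewrite eq_sym subr_eq; apply/eqP.
  transitivity ('D_u (fun y => bilin (Defs.form c y) (X y) u' : R) z).
    apply: near_eq_derive; apply: (near_open (@open_chart_img _ _ _ c) zc) => y yc.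
    by rewrite (ham_fieldE _ openT sb I yc).
  have dX i : is_derive z u (fun y => X y 0 i) (row_derive X u z 0 i).
    rewrite mxE; apply: derivableP.
    exact: (smooth_derivable (generator_field_smooth i gb)).
  have dA i j : is_derive z u (fun y => Defs.form c y i j) ('D_u (fun y => Defs.form c y i j) z).
    by apply: derivableP; exact: (smooth_derivable (form_smooth_on c i j)).
  have [_ ->] := bilin_form_is_derive (X z) u' u zc.
  have E : (fun y => bilin (Defs.form c y) (X y) u') =
     \sum_i \sum_j (u' 0 j *: ((fun y => X y 0 i) * (fun y => Defs.form c y i j))).
    apply/funext => y; rewrite bilinE fct_sumE; apply: eq_bigr => i _.
    by rewrite fct_sumE; apply: eq_bigr => j _; rewrite /= mulrC.
  have D : is_derive z u (fun y => bilin (Defs.form c y) (X y) u')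
    (\sum_i \sum_j u' 0 j *: (X z 0 i *: 'D_u (fun y => Defs.form c y i j) z +
       Defs.form c z i j *: row_derive X u z 0 i)).
    rewrite E; apply: is_derive_sum => i; apply: is_derive_sum => j.
    by apply: is_deriveZ; exact: is_deriveM.
  have [_ ->] := D.
  rewrite bilinE -big_split; apply: eq_bigr => i _; rewrite -big_split; apply: eq_bigr => j _.
  by rewrite /GRing.scale/=; ring.
(* The second derivatives of [b] cancel by symmetry, and what remains is d omega (X, v, w). *)
rewrite half [bilin _ v _](form_antisym _ _ zc) half (sym w v).
have cl := form_closed zc (X z) v w.
have anti : 'D_v (fun y => bilin (Defs.form c y) w (X z) : R) z =
   - 'D_v (fun y => bilin (Defs.form c y) (X z) w : R) z.
  have [d _] := bilin_form_is_derive (X z) w v zc.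
  rewrite -deriveN//; apply: near_eq_derive.
  by apply: (near_open (@open_chart_img _ _ _ c) zc) => y yc; rewrite form_antisym.
rewrite anti in cl.
set a := 'D_v _ z in cl *; lra.
Qed.

(** * Invariance of omega under a flow, on small differences *)

Definition solution R m (X : 'rV[R]_m -> 'rV[R]_m) (z : R -> 'rV[R]_m) :=
  forall s : R, is_derive s 1 z (X (z s)).

Lemma solution_continuous R m (X : 'rV[R]_m -> 'rV[R]_m) z :
  solution X z -> continuous z.
Proof.
move=> sz s; apply: differentiable_continuous; apply/derivable1_diffP.
by have [] := sz s.
Qed.

Lemma solution_gronwall R m (X : 'rV[R]_m -> 'rV[R]_m) (L : R) z1 z2 :
  0 <= L -> (forall x y, `|X x - X y| <= L * `|x - y|) ->
  solution X z1 -> solution X z2 ->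
  forall s, `|z1 s - z2 s| <= gronwall_const m (L * `|s|) * `|z1 0 - z2 0|.
Proof.
move=> L0 HL s1 s2 s.
have d (t : R) : is_derive t 1 (fun t => z1 t - z2 t) (X (z1 t) - X (z2 t)) /\
    `|X (z1 t) - X (z2 t)| <= L * `|z1 t - z2 t|.
  by split => //; exact: is_deriveB.
have cu : continuous (fun t => z1 t - z2 t).
  move=> t; apply: continuousB; exact: solution_continuous.
have [s0|/ltW s0] := leP 0 s.
  have [] := gronwall s0 L0 (continuous_subspaceT cu) (fun t _ => d t).
  by rewrite subr0 ger0_norm.
have [_] := gronwall s0 L0 (continuous_subspaceT cu) (fun t _ => d t).
by rewrite sub0r ler0_norm.
Qed.

Lemma solution_mvt R (f df : R -> R) (s C : R) :
  (forall t : R, is_derive t 1 f (df t)) -> (forall t, `|t| <= `|s| -> `|df t| <= C) ->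
  `|f s - f 0| <= C * `|s|.
Proof.
move=> d dC.
have [t t01] := @mvt_line R R f df 0 1 s (fun t _ => d _).
rewrite !addr0 [s%:A]mulr1 [(t * s)%:A]mulr1 => ->.
rewrite normrM mulrC ler_wpM2r// dC// normrM.
by case/andP: t01 => t0 t1; rewrite ger0_norm// ler_piMl.
Qed.

Lemma curve_bounded R (f : R -> R) (s : R) : continuous f ->
  exists2 C : R, 0 <= C & forall t, `|t| <= `|s| -> `|f t| <= C.
Proof.
move=> cf.
have cS : compact (f @` `[- `|s|, `|s|]).
  by apply: continuous_compact; [exact: continuous_subspaceT|exact: segment_compact].
have [N [Nr HN]] := compact_bounded cS.
exists `|N + 1| => // t ts; apply: le_trans (ler_norm _).
by apply: HN; [rewrite ltrDl|exists t => //; rewrite /= in_itv/= -ler_norml].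
Qed.

(** If X were affine around z, the time derivative of omega (z1 - z, z2 - z) would vanish by
    [ham_field_lie]. What remains is the Taylor remainder of X, quadratic in one displacement and
    paired with the other. The bound keeps both displacements as factors, so that one of them can be
    divided out while the other is held fixed. *)
Lemma flow_symplectic R n (M : symplectic_manifold R n) (c : chart M)
    K (b : 'rV[R]_(n + n) -> R) (z : R -> 'rV[R]_(n + n)) (s : R) :
  generator c K b -> solution (ham_field (Defs.form c) b) z ->
  (forall t, chart_img c (z t)) ->
  exists2 C : R, 0 <= C & forall z1 z2,
    solution (ham_field (Defs.form c) b) z1 -> solution (ham_field (Defs.form c) b) z2 ->
    `|bilin (Defs.form c (z s)) (z1 s - z s) (z2 s - z s) -
      bilin (Defs.form c (z 0)) (z1 0 - z 0) (z2 0 - z 0)| <=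
    C * (`|z1 0 - z 0| * `|z2 0 - z 0| * (`|z1 0 - z 0| + `|z2 0 - z 0|)).
Proof.
move=> gb sz zc; set X := ham_field (Defs.form c) b in sz *.
have [L L0 HL] := generator_lipschitz gb.
have [Q Q0 HQ] := generator_quad gb.
have dA i j (t : R) : is_derive t 1 (fun t => Defs.form c (z t) i j)
    ('D_(X (z t)) (fun y => Defs.form c y i j) (z t)).
  exact: (is_derive_curve (@open_chart_img _ _ _ c) (form_smooth_on c i j) (zc t) (sz t)).
have [B B0 HB] : exists2 B : R, 0 <= B & forall t, `|t| <= `|s| ->
    forall i j, `|Defs.form c (z t) i j| <= B.
  have H (p : 'I_(n + n) * 'I_(n + n)) : exists C : R, 0 <= C /\
      forall t, `|t| <= `|s| -> `|Defs.form c (z t) p.1 p.2| <= C.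
    have [|C C0 HC] := @curve_bounded _ (fun t => Defs.form c (z t) p.1 p.2) s.
      move=> t; apply: differentiable_continuous; apply/derivable1_diffP.
      by have [] := dA p.1 p.2 t.
    by exists C.
  have [C HC] := choice H.
  have C0 p : 0 <= C p by have [] := HC p.
  exists (\sum_p C p); first exact: sumr_ge0.
  move=> t ts i j; have [_ Hij] := HC (i, j); apply: (le_trans (Hij t ts)).
  by rewrite (bigD1 (i, j))//= lerDl sumr_ge0.
pose G := gronwall_const (n + n) (L * `|s|).
have G0 : 0 <= G by apply: ltW; exact: gronwall_const_gt0.
pose N := (n + n)%:R * ((n + n)%:R * B).
have N0 : 0 <= N by rewrite /N !mulr_ge0.
exists (N * Q * (G * G * G) * `|s|); first by rewrite !mulr_ge0.
move=> z1 z2 sz1 sz2.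
set a0 := `|z1 0 - z 0|; set k0 := `|z2 0 - z 0|.
pose a t := z1 t - z t; pose k t := z2 t - z t.
have da (t : R) : is_derive t 1 a (X (z1 t) - X (z t)) by exact: is_deriveB.
have dk (t : R) : is_derive t 1 k (X (z2 t) - X (z t)) by exact: is_deriveB.
have aG t : `|t| <= `|s| -> `|a t| <= G * a0.
  move=> ts; apply: le_trans (solution_gronwall L0 HL sz1 sz t) _.
  rewrite ler_wpM2r// /G /gronwall_const lerD2r ler_wpM2l// ler_expR.
  by rewrite ler_wpM2l ?mulr_ge0// ler_wpM2l.
have kG t : `|t| <= `|s| -> `|k t| <= G * k0.
  move=> ts; apply: le_trans (solution_gronwall L0 HL sz2 sz t) _.
  rewrite ler_wpM2r// /G /gronwall_const lerD2r ler_wpM2l// ler_expR.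
  by rewrite ler_wpM2l ?mulr_ge0// ler_wpM2l.
pose Om t := bilin (Defs.form c (z t)) (a t) (k t).
pose dOm t := bilin (Defs.form c (z t)) (X (z1 t) - X (z t)) (k t) +
   bilin (Defs.form c (z t)) (a t) (X (z2 t) - X (z t)) +
   'D_(X (z t)) (fun y => bilin (Defs.form c y) (a t) (k t) : R) (z t).
have dOmE (t : R) : is_derive t 1 Om (dOm t).
  have E : Om = \sum_i \sum_j ((fun t => a t 0 i) * (fun t => Defs.form c (z t) i j) *
      (fun t => k t 0 j)).
    apply/funext => t'; rewrite /Om bilinE fct_sumE; apply: eq_bigr => i _.
    by rewrite fct_sumE.
  have D : is_derive t 1 Om (\sum_i \sum_j
     ((a t 0 i * Defs.form c (z t) i j) *: (X (z2 t) - X (z t)) 0 j + k t 0 j *: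
      (a t 0 i *: 'D_(X (z t)) (fun y => Defs.form c y i j) (z t) +
       Defs.form c (z t) i j *: (X (z1 t) - X (z t)) 0 i))).
    rewrite E; apply: is_derive_sum => i; apply: is_derive_sum => j.
    have d1 := is_deriveM (is_derive_coord i (da t)) (dA i j t).
    have d2 := is_deriveM d1 (is_derive_coord j (dk t)).
    exact: d2.
  rewrite (_ : dOm t = \sum_i \sum_j
     ((a t 0 i * Defs.form c (z t) i j) *: (X (z2 t) - X (z t)) 0 j + k t 0 j *:
      (a t 0 i *: 'D_(X (z t)) (fun y => Defs.form c y i j) (z t) +
       Defs.form c (z t) i j *: (X (z1 t) - X (z t)) 0 i)))//.
  have [_ D2] := bilin_form_is_derive (a t) (k t) (X (z t)) (zc t).
  rewrite /dOm D2 !bilinE -!big_split; apply: eq_bigr => i _; rewrite -!big_split.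
  by apply: eq_bigr => j _; rewrite /GRing.scale/=; ring.
have bd t : `|t| <= `|s| -> `|dOm t| <= N * Q * (G * G * G) * (a0 * k0 * (a0 + k0)).
  move=> ts; have lie := ham_field_lie (a t) (k t) gb (zc t).
  rewrite /= -/X in lie.
  (* Subtracting the vanishing sum of [ham_field_lie] leaves only the Taylor remainders of [X]. *)
  have -> : dOm t =
      bilin (Defs.form c (z t)) (X (z1 t) - X (z t) - row_derive X (a t) (z t)) (k t) +
      bilin (Defs.form c (z t)) (a t) (X (z2 t) - X (z t) - row_derive X (k t) (z t)).
    rewrite -[LHS]subr0 -lie /dOm !bilinDl !bilinDr !bilinNl !bilinNr; ring.
  have b1 := bilin_norm_le (X (z1 t) - X (z t) - row_derive X (a t) (z t)) (k t) (HB t ts).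
  have b2 := bilin_norm_le (a t) (X (z2 t) - X (z t) - row_derive X (k t) (z t)) (HB t ts).
  have q1 := HQ (z1 t) (z t); have q2 := HQ (z2 t) (z t).
  have A := aG t ts; have Kk := kG t ts.
  rewrite -/X -/(a t) in q1; rewrite -/X -/(k t) in q2.
  have a00 : 0 <= a0 := normr_ge0 _.
  have k00 : 0 <= k0 := normr_ge0 _.
  have A2 : `|a t| ^+ 2 <= (G * a0) ^+ 2 by rewrite lerXn2r ?nnegrE ?mulr_ge0.
  have K2 : `|k t| ^+ 2 <= (G * k0) ^+ 2 by rewrite lerXn2r ?nnegrE ?mulr_ge0.
  have aux (x p q e f : R) : x <= N * e * f -> 0 <= e -> 0 <= f -> e <= p -> f <= q ->
      x <= N * p * q.
    move=> xN e0 f0 ep fq; apply: (le_trans xN).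
    by apply: ler_pM; rewrite ?mulr_ge0 ?ler_wpM2l.
  have q1' := le_trans q1 (ler_wpM2l Q0 A2).
  have q2' := le_trans q2 (ler_wpM2l Q0 K2).
  have c1 := aux _ _ _ _ _ b1 (normr_ge0 _) (normr_ge0 _) q1' Kk.
  have c2 := aux _ _ _ _ _ b2 (normr_ge0 _) (normr_ge0 _) A q2'.
  apply: le_trans (ler_normD _ _) _.
  apply: (le_trans (lerD c1 c2)).
  rewrite le_eqVlt; apply/orP; left; apply/eqP; ring.
have := @solution_mvt _ Om dOm s _ dOmE bd.
by move=> H; apply: (le_trans H); rewrite [leRHS]mulrAC.
Qed.

(** * Functions and flows carried by one chart *)

Definition chart_extend R m (M : manifold R m) (c : chart M)
  (b : 'rV[R]_m -> R) (x : M) : R :=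
  if `[< chart_dom c x >] then b (to_coord c x) else 0.

Lemma chart_extendE R m (M : manifold R m) (c : chart M)
  (b : 'rV[R]_m -> R) (x : M) : chart_dom c x -> chart_extend c b x = b (to_coord c x).
Proof. by move=> xc; rewrite /chart_extend; case: asboolP. Qed.

Lemma chart_extend_of R m (M : manifold R m) (c : chart M)
  (b : 'rV[R]_m -> R) y : chart_img c y -> chart_extend c b (of_coord c y) = b y.
Proof. by move=> yc; rewrite chart_extendE ?of_coordK//; exact: of_coord_dom. Qed.

Lemma chart_compact R m (M : manifold R m) (c : chart M) K :
  compact K -> K `<=` chart_img c -> compact (of_coord c @` K).
Proof.
move=> cK Kc; apply: continuous_compact => //; apply/subspace_continuousP => y Ky.
by apply: cvg_within_filter; exact: (of_coord_cont (Kc _ Ky)).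
Qed.

Lemma chart_closed R m (M : manifold R m) (c : chart M) K :
  compact K -> K `<=` chart_img c -> closed (of_coord c @` K).
Proof.
by move=> cK Kc; apply: compact_closed; [exact: manifold_hausdorff|exact: chart_compact].
Qed.

Lemma chart_extend0 R m (M : manifold R m) (c : chart M) K
  (b : 'rV[R]_m -> R) (x : M) : (forall y, ~ K y -> b y = 0) ->
  ~ (of_coord c @` K) x -> chart_extend c b x = 0.
Proof.
move=> b0 Kx; rewrite /chart_extend; case: asboolP => // xc.
by apply: b0 => Ky; apply: Kx; exists (to_coord c x) => //; rewrite to_coordK.
Qed.

Lemma generator_orbit_out R n (M : symplectic_manifold R n) (c : chart M)
    K b (l : R) (g : R -> M) s0 : generator c K b ->
  ham_orbit setT (fun=> fun x => l * chart_extend c b x) g ->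
  ~ (of_coord c @` K) (g s0) -> forall s, g s = g s0.
Proof.
move=> [cK Kc _ b0 _] og Ks s.
apply: (@orbit_stationary _ _ _ setT _ g (of_coord c @` K) s0) og _ _ _ _ => //.
- exact: chart_closed.
- by move=> _ x _ Kx; rewrite (chart_extend0 b0 Kx) mulr0.
Qed.

(** A point of the orbit lies either in the support, which is inside the chart, or at rest in the
    starting point. *)
Lemma generator_orbit_dom R n (M : symplectic_manifold R n) (c : chart M)
    K b (l : R) (g : R -> M) : generator c K b ->
  ham_orbit setT (fun=> fun x => l * chart_extend c b x) g ->
  chart_dom c (g 0) -> forall s, chart_dom c (g s).
Proof.
move=> gb og g0 s; have [Ks|Ks] := pselect ((of_coord c @` K) (g s)).
  by have [_ Kc _ _ _] := gb; have [y Ky <-] := Ks; apply: of_coord_dom; exact: Kc.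
by rewrite -(generator_orbit_out gb og Ks 0).
Qed.

Lemma ham_fieldZ R n (M : symplectic_manifold R n) (c : chart M)
    (b : 'rV[R]_(n + n) -> R) (l : R) y : smooth_on setT b -> chart_img c y ->
  ham_field (Defs.form c) ((fun x => l * chart_extend c b x) \o of_coord c) y =
  l *: ham_field (Defs.form c) b y.
Proof.
move=> sb yc; rewrite /ham_field scalemxAl; congr (_ *m _).
apply/rowP => i; rewrite !mxE -[RHS]/(l *: 'D_(e_ i) b y).
rewrite -deriveZ; last exact: (smooth_derivable sb).
apply: near_eq_derive; apply: (near_open (@open_chart_img _ _ _ c) yc) => z zc.
by rewrite /= chart_extend_of.
Qed.

Lemma generator_orbit_solution R n (M : symplectic_manifold R n) (c : chart M)
    K b (l : R) (g : R -> M) : generator c K b ->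
  ham_orbit setT (fun=> fun x => l * chart_extend c b x) g ->
  chart_dom c (g 0) ->
  solution (fun y => l *: ham_field (Defs.form c) b y) (to_coord c \o g).
Proof.
move=> gb og g0 s; have gs := generator_orbit_dom gb og g0 s.
have := orbit_derive og filterT gs.
have [_ _ sb _ _] := gb; rewrite (ham_fieldZ _ sb (to_coord_img gs)); exact.
Qed.

(** Starting points outside the image of the chart are included, where the field of a generator
    vanishes and nothing moves. Trajectories can then be compared for arbitrary perturbed initial
    points. *)
Definition coord_flow R n (M : symplectic_manifold R n) (c : chart M)
    (b : 'rV[R]_(n + n) -> R) (theta : 'rV[R]_(n + n) -> R -> 'rV[R]_(n + n)) :=
  [/\ forall y, theta y 0 = y, forall y, solution (ham_field (Defs.form c) b) (theta y) &
      forall y s, chart_img c y -> chart_img c (theta y s)].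

Lemma coord_flow_exists R n (M : symplectic_manifold R n) (c : chart M) K b
    (Phi : R -> M -> M) : generator c K b ->
  is_flow (chart_extend c b) Phi -> exists theta, coord_flow c b theta.
Proof.
move=> gb fl.
have E : chart_extend c b = fun x => 1 * chart_extend c b x.
  by apply/funext => x; rewrite mul1r.
have og x : ham_orbit setT (fun=> fun x => 1 * chart_extend c b x) (fun s => Phi s x).
  by have [_] := fl x; rewrite -E.
exists (fun y s => if `[< chart_img c y >] then to_coord c (Phi s (of_coord c y)) else y).
split=> [y|y|y s yc].
- case: asboolP => // yc; have [-> _] := fl (of_coord c y); exact: of_coordK.
- case: asboolP => yc.
    have d0 : chart_dom c (Phi 0 (of_coord c y)).
      by have [-> _] := fl (of_coord c y); exact: of_coord_dom.
    move=> s; have := generator_orbit_solution gb (og _) d0 s.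
    by rewrite /= scale1r.
  move=> s; rewrite (generator_field0 gb).
    exact: is_derive_cst.
  by have [_ Kc _ _ _] := gb => Ky; apply: yc; exact: Kc.
- case: asboolP => // _; apply: to_coord_img.
  apply: (generator_orbit_dom gb (og _)).
  by have [-> _] := fl (of_coord c y); exact: of_coord_dom.
Qed.

Lemma solution_rescale R m (X : 'rV[R]_m -> 'rV[R]_m) z (l : R) :
  solution X z -> solution (fun y => l *: X y) (fun s => z (l * s)).
Proof.
move=> sz s; have /is_derive_along : is_derive (s *: l + 0) (l : R) z (l *: X (z (l * s))).
  rewrite addr0 [s *: l]mulrC; have [d D] := sz (l * s).
  by rewrite -D; exact: derive_scale1.
by rewrite (_ : (fun h : R => z (h *: l + 0)) = (fun s => z (l * s)))//;
  apply/funext => h; rewrite addr0 [h *: l]mulrC.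
Qed.

(** The time-1 map of the flow of l b is the time-l map of the flow of b, with uniqueness from
    Gronwall. One [theta] thus serves all times t and all eps. *)
Lemma flow_coord_flow R n (M : symplectic_manifold R n) (c : chart M) K b
    (theta : 'rV[R]_(n + n) -> R -> 'rV[R]_(n + n)) (l : R) (Phi : R -> M -> M) x :
  generator c K b -> coord_flow c b theta ->
  is_flow (fun x => l * chart_extend c b x) Phi -> chart_dom c x ->
  chart_dom c (Phi 1 x) /\ to_coord c (Phi 1 x) = theta (to_coord c x) l.
Proof.
move=> gb [th0 ths _] fl xc; have [Phi0 og] := fl x.
have d0 : chart_dom c (Phi 0 x) by rewrite Phi0.
split; first exact: (generator_orbit_dom gb og d0 1).
have s1 := generator_orbit_solution gb og d0.
have s2 := solution_rescale l (ths (to_coord c x)).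
have [L L0 HL] := generator_lipschitz gb.
have HL' y y' : `|l *: ham_field (Defs.form c) b y - l *: ham_field (Defs.form c) b y'| <=
    (`|l| * L) * `|y - y'|.
  by rewrite -scalerBr normrZ -mulrA ler_wpM2l.
have lL0 : 0 <= `|l| * L by rewrite mulr_ge0.
have := solution_gronwall lL0 HL' s1 s2 1.
rewrite /= Phi0 mulr0 th0 subrr normr0 mulr0 normr_le0 subr_eq0 mulr1.
by move/eqP.
Qed.

Lemma flow_out R n (M : symplectic_manifold R n) (c : chart M) K b
    (l : R) (Phi : R -> M -> M) x : generator c K b ->
  is_flow (fun x => l * chart_extend c b x) Phi -> ~ (of_coord c @` K) x ->
  Phi 1 x = x.
Proof.
move=> gb fl Kx; have [Phi0 og] := fl x.
have K0 : ~ (of_coord c @` K) (Phi 0 x) by rewrite Phi0.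
by rewrite -[RHS]Phi0; exact: (generator_orbit_out gb og K0).
Qed.

Lemma generator_conserved R n (M : symplectic_manifold R n) (c : chart M) K b z :
  generator c K b -> solution (ham_field (Defs.form c) b) z ->
  (forall s, chart_img c (z s)) -> forall s, b (z s) = b (z 0).
Proof.
move=> gb sz zc s; have [_ _ sb _ _] := gb.
have d (t : R) : is_derive t 1 (fun t => b (z t)) 0.
  have D := is_derive_curve openT sb I (sz t).
  by rewrite -(ham_fieldE _ openT sb I (zc t)) (form_alternating (zc t)) in D.
have H := @solution_mvt _ (fun t => b (z t)) (fun=> 0) s 0 d.
apply/eqP; rewrite -subr_eq0 -normr_le0.
by have := H (fun t _ => ltac:(by rewrite normr0)); rewrite mul0r.
Qed.

(** * The Hamiltonian of a deformed path *)

Lemma family_smooth_slice R n (M : symplectic_manifold R n)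
    (F : R -> M -> R) (c : chart M) t y : smooth_family F ->
  `[0, 1]%classic t -> chart_img c y ->
  exists U, [/\ open U, U y, smooth_on U (F t \o of_coord c) & U `<=` chart_img c].
Proof.
move=> sF tI yc; have [U [G [oU Uy sG Uc FG]]] := family_ham_field sF tI yc.
exists [set y | U (t, y)]; split => //; first exact: open_slice.
  apply: smooth_on_eq (smooth_slice t sG); first exact: open_slice.
  by move=> z Uz; rewrite /= FG.
by move=> z /Uc.
Qed.

Lemma smooth_littleo R m (U : set 'rV[R]_m) (f : 'rV[R]_m -> R) z
    (I : Type) (F : set_system I) (a : I -> 'rV[R]_m) (k : I -> R) (G : R) :
  Filter F -> open U -> smooth_on U f -> U z -> 0 <= G ->
  a @ F --> z -> (\forall i \near F, `|a i - z| <= G * `|k i|) ->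
  (k i)^-1 * (f (a i) - f z - 'D_(a i - z) f z) @[i --> F] --> (0 : R).
Proof.
move=> FF oU sf Uz G0 az aG; apply/cvgrPdist_le => e e0.
have G1 : 0 < G + 1 by rewrite ltr_wpDl.
have eta0 : 0 < e / (G + 1) by rewrite divr_gt0.
have [r r0 H] := smooth_strict_diff oU sf Uz eta0.
near=> i; rewrite sub0r normrN normrM normfV.
have [|| _ Hi] := H (a i) z.
- near: i; move/cvgrPdist_lt : az => /(_ _ r0); apply: filterS => i; by rewrite distrC.
- by rewrite subrr normr0.
rewrite (smooth_deriveE _ oU sf Uz).
have aGi : `|a i - z| <= G * `|k i| by near: i.
have [->|k0] := eqVneq (k i) 0; first by rewrite normr0 invr0 mul0r ltW.
rewrite ler_pdivrMl ?normr_gt0//; apply: (le_trans Hi).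
apply: (@le_trans _ _ (e / (G + 1) * (G * `|k i|))); first by rewrite ler_wpM2l// ltW.
rewrite mulrA [leRHS]mulrC ler_wpM2r// mulrAC ler_pdivrMr// (ler_wpM2l (ltW e0))//.
by rewrite lerDl.
Unshelve. all: by end_near. Qed.

Lemma rV_mvt_abs R m (u w : R -> 'rV[R]_m) (s C : R) : 0 <= C ->
  (forall t : R, is_derive t 1 u (w t)) -> (forall t, `|t| <= `|s| -> `|w t| <= C) ->
  `|u s - u 0| <= C * `|s|.
Proof.
move=> C0 du wC; apply/rV_norm_le; first by rewrite mulr_ge0.
move=> i; rewrite !mxE.
apply: (@solution_mvt _ (fun t => u t 0 i) (fun t => w t 0 i)) => [t|t ts].
  exact: is_derive_coord.
by apply: le_trans (wC t ts); exact: rV_coord_le.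
Qed.

Lemma is_derive_scalel1 R (V : normedModType R) (v : V) (t : R) :
  is_derive t 1 (fun t : R => t *: v) v.
Proof.
have /is_derive_along := @is_derive_id R V (t *: v + 0) v.
by rewrite (_ : (fun h : R => h *: v + 0) = (fun t : R => t *: v))//;
  apply/funext => h; rewrite addr0.
Qed.

(** Both the trajectory and the time vary with [i]. After subtraction of the uniform motion with
    velocity X (z s), the remaining curve has small speed by the Lipschitz bound on [X]. *)
Lemma flow_time_lim R m (X : 'rV[R]_m -> 'rV[R]_m) (L B : R)
    (z : R -> 'rV[R]_m) (I : Type) (F : set_system I) (z1 : I -> R -> 'rV[R]_m)
    (s : R) (s1 k : I -> R) (d : R) :
  Filter F -> 0 <= L -> (forall x y, `|X x - X y| <= L * `|x - y|) ->
  (forall x, `|X x| <= B) -> solution X z -> (forall i, solution X (z1 i)) ->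
  z1 i 0 @[i --> F] --> z 0 -> s1 @ F --> s ->
  (k i)^-1 * (s1 i - s) @[i --> F] --> d ->
  (k i)^-1 *: (z1 i (s1 i) - z1 i s) @[i --> F] --> d *: X (z s).
Proof.
move=> FF L0 HL HB sz sz1 z10 s1s kd.
have B0 : 0 <= B by apply: le_trans (HB 0).
pose G := gronwall_const m (L * `|s|).
have G0 : 0 <= G by rewrite ltW// gronwall_const_gt0.
pose err i := z1 i (s1 i) - z1 i s - (s1 i - s) *: X (z s).
have dz i (t : R) : is_derive t 1 (fun t => z1 i (t + s)) (X (z1 i (t + s))).
  have D : is_derive (t *: (1 : R) + s) 1 (z1 i) (X (z1 i (t + s))).
    by rewrite [t%:A]mulr1; exact: sz1.
  have /is_derive_along := D.
  rewrite (_ : (fun h : R => z1 i (h *: (1 : R) + s)) = (fun t => z1 i (t + s)))//.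
  by apply/funext => h; rewrite [h%:A]mulr1.
have errE i : `|err i| <= (L * (B * `|s1 i - s| + G * `|z1 i 0 - z 0|)) * `|s1 i - s|.
  pose w t := z1 i (t + s) - t *: X (z s).
  have dw (t : R) : is_derive t 1 w (X (z1 i (t + s)) - X (z s)).
    by apply: is_deriveB; exact: is_derive_scalel1.
  have -> : err i = w (s1 i - s) - w 0.
    rewrite /err /w subrK add0r scale0r subr0; apply/rowP => j; rewrite !mxE; ring.
  apply: (rV_mvt_abs _ dw); first by rewrite mulr_ge0// addr_ge0// mulr_ge0.
  move=> t ts; apply: (le_trans (HL _ _)); rewrite ler_wpM2l//.
  rewrite -(subrKA (z1 i s)); apply: le_trans (ler_normD _ _) _; apply: lerD.
    have := @rV_mvt_abs _ _ (fun t => z1 i (t + s)) (fun t => X (z1 i (t + s))) t B B0 (dz i)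
      (fun t' _ => HB _).
    by rewrite add0r => H; apply: (le_trans H); rewrite ler_wpM2l.
  exact: (solution_gronwall L0 HL (sz1 i) sz s).
have err0 : (k i)^-1 *: err i @[i --> F] --> (0 : 'rV[R]_m).
  have c1 : `|(k i)^-1 * (s1 i - s)| * (L * (B * `|s1 i - s| + G * `|z1 i 0 - z 0|))
      @[i --> F] --> `|d| * (L * (B * `|s - s| + G * `|z 0 - z 0|)).
    apply: cvgM; first exact: cvg_norm.
    apply: cvgMl_tmp; apply: cvgD; apply: cvgMl_tmp; apply: cvg_norm.
      by apply: cvgB => //; exact: cvg_cst.
    by apply: cvgB => //; exact: cvg_cst.
  rewrite !subrr !normr0 !mulr0 addr0 !mulr0 in c1.
  apply/cvgrPdist_le => e e0; move/cvgrPdist_le : c1 => /(_ e e0); apply: filterS => i.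
  rewrite !sub0r !normrN => H.
  apply: le_trans (le_trans (ler_norm _) H); rewrite normrZ.
  apply: le_trans (ler_wpM2l (normr_ge0 _) (errE i)) _.
  by rewrite normrM [leLHS]mulrCA mulrC.
have c2 : ((k i)^-1 * (s1 i - s)) *: X (z s) @[i --> F] --> d *: X (z s).
  exact: cvgZr_tmp.
rewrite -[d *: _]addr0; apply: cvg_trans (cvgD c2 err0).
apply: near_eq_cvg; near=> i; rewrite /err addrfctE.
by rewrite -scalerA -scalerDr addrC subrK.
Unshelve. all: by end_near. Qed.

Lemma bilin_cvgl R m (A : 'M[R]_m) (I : Type) (F : set_system I)
    (v : I -> 'rV[R]_m) (v0 w : 'rV[R]_m) : Filter F ->
  v @ F --> v0 -> bilin A (v i) w @[i --> F] --> bilin A v0 w.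
Proof.
move=> FF vv; rewrite bilinE.
under eq_cvg do rewrite bilinE.
apply: cvg_big; first exact: add_continuous.
move=> i _; apply: cvg_big; first exact: add_continuous.
move=> j _; apply: cvgMr_tmp; apply: cvgMr_tmp.
apply: (@continuous_cvg _ _ _ _ _ _ (fun y : 'rV[R]_m => y 0 i)) vv.
exact: coord_continuous.
Qed.

Lemma generator_bounded R n (M : symplectic_manifold R n) (c : chart M)
    K (b : 'rV[R]_(n + n) -> R) : generator c K b ->
  exists B : R, forall x, `|ham_field (Defs.form c) b x| <= B.
Proof.
move=> gb; have [cK _ _ _ _] := gb.
have [||L L0 HL] := @row_choice_bound R (n + n) 'rV[R]_(n + n)
  (fun j x => `|ham_field (Defs.form c) b x 0 j|) (fun=> 1).
- by [].
- move=> j; have [||C C0 HC] := @smooth_compact_bounded _ _ K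
    (fun x => ham_field (Defs.form c) b x 0 j) cK.
  + by move=> y _; exact: (smooth_continuous (generator_field_smooth j gb)).
  + by move=> y Ky; rewrite (generator_field0 gb Ky) mxE.
  by exists C => // x; rewrite mulr1.
- exists L => x; apply/rV_norm_le => // j; by rewrite -[L]mulr1.
Qed.

Lemma is_derive_cvg R (W : normedModType R) (g : R -> W) (t : R) w :
  is_derive t 1 g w -> h^-1 *: (g (h *: 1 + t) - g t) @[h --> (0 : R)^'] --> w.
Proof. by move=> [dg <-]; exact: dg. Qed.

Lemma curve_cvg R (W : normedModType R) (g : R -> W) (t : R) w :
  is_derive t 1 g w -> g (h *: 1 + t) @[h --> (0 : R)^'] --> g t.
Proof.
move=> [dg _]; have cg : {for t, continuous g}.
  by apply/differentiable_continuous/derivable1_diffP.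
exact: cvg_comp (@line_cvg R _ t (1 : R)) cg.
Qed.

(* The field of the composed path, paired with a vector carried by the flow:
   [theta] preserves omega to first order, and [b] is constant along it. *)
Lemma composed_path_derive R n (M : symplectic_manifold R n) (c : chart M) K b
    theta (u : R -> 'rV[R]_(n + n)) (sg : R -> R) (t : R) (v V : 'rV[R]_(n + n)) (d : R)
    (U : set 'rV[R]_(n + n)) (f : 'rV[R]_(n + n) -> R) :
  generator c K b -> coord_flow c b theta ->
  chart_img c (u t) -> is_derive t 1 u v -> is_derive t 1 sg d ->
  is_derive t 1 (fun s => theta (u s) (sg s)) V ->
  open U -> smooth_on U f -> U (theta (u t) (sg t)) ->
  (forall w, bilin (Defs.form c (theta (u t) (sg t))) V w = 'D_w f (theta (u t) (sg t))) ->
  forall w, is_derive (u t) w (fun y => f (theta y (sg t)) - d * b y)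
    (bilin (Defs.form c (u t)) v w).
Proof.
move=> gb [th0 ths thc] yc du dsg dp oU sf Uz HV w.
set y := u t in yc *; set s := sg t in Uz HV dp *; set z := theta y s in Uz HV *.
set X := ham_field (Defs.form c) b in ths.
have [_ _ sb _ _] := gb.
have [L L0 HL] := generator_lipschitz gb.
have [B HB] := generator_bounded gb.
have zc : chart_img c z by exact: thc.
have FF : Filter (0 : R)^' by exact: _.
(* [J] stands in for the differential of the time-s map applied to [v]: the velocity of the composed
   path without the part caused by the changing flow time. *)
pose J := V - d *: X z.
have uc := curve_cvg du; have uq := is_derive_cvg du; rewrite -/y in uc uq.
have Jlim : h^-1 *: (theta (u (h *: 1 + t)) s - z) @[h --> (0 : R)^'] --> J.
  have th00 : theta (u (h *: 1 + t)) 0 @[h --> (0 : R)^'] --> theta y 0.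
    by rewrite th0; under eq_cvg do rewrite th0.
  have tl := @flow_time_lim _ _ X L B (theta y) R (0 : R)^' (fun h => theta (u (h *: 1 + t)))
    s (fun h => sg (h *: 1 + t)) id d FF L0 HL HB (ths y) (fun h => ths _) th00
    (curve_cvg dsg) (is_derive_cvg dsg).
  have TL := cvgB (is_derive_cvg dp) tl; rewrite -/z -/J in TL; have {}TL := TL FF.
  refine (cvg_trans _ TL); apply: (@near_eq_cvg _ _ (0 : R)^' FF); near=> h.
  rewrite addrfctE opprfctE -scalerBr; congr (_ *: _).
  apply/rowP => j; rewrite !mxE; ring.
have [C C0 HC] := flow_symplectic s gb (ths y) (fun t => thc y t yc).
rewrite th0 -/z in HC.
have key y2 : `|bilin (Defs.form c z) J (theta y2 s - z) - bilin (Defs.form c y) v (y2 - y)|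
    <= C * (`|v| * `|y2 - y| * (`|y - y| + `|y2 - y|)).
  have lhs : `|bilin (Defs.form c z) (h^-1 *: (theta (u (h *: 1 + t)) s - z)) (theta y2 s - z) -
      bilin (Defs.form c y) (h^-1 *: (u (h *: 1 + t) - y)) (y2 - y)| @[h --> (0 : R)^'] -->
      `|bilin (Defs.form c z) J (theta y2 s - z) - bilin (Defs.form c y) v (y2 - y)|.
    by apply: cvg_norm; apply: cvgB; apply: bilin_cvgl.
  have rhs : C * (`|h^-1 *: (u (h *: 1 + t) - y)| * `|y2 - y| *
      (`|u (h *: 1 + t) - y| + `|y2 - y|)) @[h --> (0 : R)^'] -->
      C * (`|v| * `|y2 - y| * (`|y - y| + `|y2 - y|)).
    apply: cvgMl_tmp; apply: cvgM.
      by apply: cvgMr_tmp; exact: cvg_norm.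
    apply: cvgD; last exact: cvg_cst.
    by apply: cvg_norm; apply: cvgB => //; exact: cvg_cst.
  apply: (ler_cvg_to lhs rhs); near=> h.
  rewrite !bilinZl -mulrBr normrM normrZ.
  have := HC _ _ (ths (u (h *: 1 + t))) (ths y2); rewrite !th0 => H.
  apply: le_trans (ler_wpM2l (normr_ge0 _) H) _.
  by rewrite mulrCA -!mulrA.
pose a k := theta (k *: w + y) s.
pose G := gronwall_const (n + n) (L * `|s|) * `|w|.
have G0 : 0 <= G by rewrite mulr_ge0// ltW// gronwall_const_gt0.
have aG k : `|a k - z| <= G * `|k|.
  apply: le_trans (solution_gronwall L0 HL (ths _) (ths y) s) _.
  by rewrite !th0 addrK normrZ /G [`|k| * _]mulrC mulrA.
have az : a k @[k --> (0 : R)^'] --> z.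
  apply/cvgrPdist_le => e e0.
  have G1 : 0 < G + 1 by rewrite ltr_wpDl.
  near=> k; rewrite distrC; apply: (le_trans (aG k)).
  have : `|k| <= e / (G + 1) by near: k; apply: dnbhs0_le; rewrite divr_gt0.
  move=> ke; apply: (@le_trans _ _ (G * (e / (G + 1)))); first by rewrite ler_wpM2l.
  by rewrite mulrA ler_pdivrMr// mulrC (ler_wpM2l (ltW e0))// lerDl.
have nG : \forall k \near (0 : R)^', `|a k - z| <= G * `|k| by near=> k; exact: aG.
have l1 := @smooth_littleo _ _ U f z R (0 : R)^' a id G FF oU sf Uz G0 az nG.
have l2 := @smooth_littleo _ _ setT b z R (0 : R)^' a id G FF openT sb I G0 az nG.
have l3 : k^-1 * (bilin (Defs.form c z) J (a k - z) - k * bilin (Defs.form c y) v w)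
    @[k --> (0 : R)^'] --> (0 : R).
  pose D := C * (`|v| * `|w| * `|w|).
  have D0 : 0 <= D by rewrite !mulr_ge0.
  have D1 : 0 < D + 1 by rewrite ltr_wpDl.
  apply/cvgrPdist_le => e e0; near=> k; rewrite sub0r normrN normrM normfV.
  have k0 : k != 0 by near: k; exact: nbhs_dnbhs_neq.
  rewrite ler_pdivrMl ?normr_gt0//.
  have := key (k *: w + y); rewrite addrK bilinZr => H; apply: (le_trans H).
  rewrite subrr normr0 add0r normrZ.
  have ke : `|k| <= e / (D + 1) by near: k; apply: dnbhs0_le; rewrite divr_gt0.
  rewrite (_ : C * _ = `|k| * (D * `|k|)); last by rewrite /D; ring.
  rewrite ler_wpM2l//; apply: (@le_trans _ _ (D * (e / (D + 1)))); first by rewrite ler_wpM2l.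
  by rewrite mulrA ler_pdivrMr// mulrC (ler_wpM2l (ltW e0))// lerDl.
have bE y' : chart_img c y' -> b (theta y' s) = b y'.
  move=> yc'; rewrite (generator_conserved gb (ths y') (fun s => thc y' s yc')).
  by rewrite th0.
(* To first order f varies by omega (V, .) and d b by omega (d X, .). The difference is omega (J,
   .), which [l3] identifies with k omega (v, w). *)
have lim : k^-1 *: ((f (theta (k *: w + y) s) - d * b (k *: w + y)) -
    (f (theta y s) - d * b y)) @[k --> (0 : R)^'] --> bilin (Defs.form c y) v w.
  have lc : (fun=> bilin (Defs.form c y) v w) @ (0 : R)^' --> bilin (Defs.form c y) v w by exact: cvg_cst.
  have L1 := @cvgMl_tmp _ _ _ FF _ d _ l2.
  have L' := @cvgD _ _ _ _ FF _ _ _ _ (@cvgB _ _ _ _ FF _ _ _ _ l1 L1) (@cvgD _ _ _ _ FF _ _ _ _ l3 lc).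
  rewrite mulr0 subr0 add0r add0r in L'.
  refine (cvg_trans _ L'); apply: (@near_eq_cvg _ _ (0 : R)^' FF); near=> k.
  have k0 : k != 0 by near: k; exact: nbhs_dnbhs_neq.
  have kc : chart_img c (k *: w + y).
    near: k; apply: (@line_cvg R _ y w).
    by apply: open_nbhs_nbhs; split => //; exact: open_chart_img.
  rewrite !fctE /= -[in RHS]bE// -[in RHS](bE y)// -/z -/(a k).
  rewrite -HV -(ham_fieldE _ openT sb I zc) -/X.
  have -> : bilin (Defs.form c z) V (a k - z) =
     d * bilin (Defs.form c z) (X z) (a k - z) + bilin (Defs.form c z) J (a k - z).
    by rewrite -bilinZl -bilinDl /J subrKC.
  rewrite /GRing.scale/=; by field.
split; first by apply/cvg_ex; exists (bilin (Defs.form c y) v w); exact: lim.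
by apply: cvg_lim => //; exact: lim.
Unshelve. all: by end_near. Qed.

Lemma chart_locally_const R m (M : manifold R m) (d : chart M) (x : M)
    (D : M -> R) (r : R) : chart_dom d x -> 0 < r ->
  (forall y, `|y - to_coord d x| < r -> forall w,
     is_derive y w (D \o of_coord d) 0) ->
  exists2 N, nbhs x N & forall z, N z -> D z = D x.
Proof.
move=> xd r0 H.
exists [set z | chart_dom d z /\ `|to_coord d z - to_coord d x| < r]; first exact: chart_nbhs.
move=> z [zd zr].
have := @lipschitz_coord _ _ (D \o of_coord d) (to_coord d x) r 0 (to_coord d z) (to_coord d x).
rewrite /= !to_coordK// mulr0 mul0r normr_le0 subr_eq0 => L; apply/eqP; apply: L => //.
  by move=> y yr i; have [dy ->] := H y yr (delta_mx 0 i); rewrite normr0.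
by rewrite subrr normr0.
Qed.

Lemma family_ham_fieldE R n (M : symplectic_manifold R n) (F : R -> M -> R)
    (c : chart M) t y w : smooth_family F -> `[0, 1]%classic t -> chart_img c y ->
  is_derive y w (F t \o of_coord c)
    (bilin (Defs.form c y) (ham_field (Defs.form c) (F t \o of_coord c) y) w).
Proof.
move=> sF tI yc; have [U [oU Uy sU _]] := family_smooth_slice sF tI yc.
by rewrite (ham_fieldE _ oU sU Uy yc); apply: derivableP; exact: (smooth_derivable sU).
Qed.

Definition cutoff R (t : R) : R := t * (1 - t).

Lemma cutoff_is_derive R (e t : R) :
  is_derive t 1 (fun s => e * cutoff s) (e * (1 - 2 * t)).
Proof.
have d1 : is_derive t 1 (fun s : R => 1 - s) (-1).
  have := @is_deriveB R R R (cst 1) id t 1 _ _ (is_derive_cst _ _ _) (is_derive_id _ _).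
  by rewrite sub0r.
have d2 := @is_deriveM R R id _ t 1 _ _ (is_derive_id t 1) d1.
have := is_deriveZ e d2; rewrite /GRing.scale/= => d3.
by rewrite (_ : e * (1 - 2 * t) = e * (t * -1 + (1 - t) * 1))//; ring.
Qed.

(** The constant [k] may depend on [e] and [t], since generating Hamiltonians are only determined up
    to such constants. The clause for e = 0 makes the oscillation at e = 0 exactly that of [H t],
    where other values of e only get lower bounds. *)
Lemma deformed_hamiltonian R n (M : symplectic_manifold R n) (c : chart M) K b
    theta (phi psi : R -> M -> M) (H He : R -> M -> R) (e t : R) :
  connected [set: M] -> generator c K b -> coord_flow c b theta ->
  generates H phi -> generates He psi ->
  (forall y, exists x, phi t x = y) ->
  is_deformation phi (fun t x => cutoff t * chart_extend c b x) e psi ->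
  0 < t < 1 ->
  exists (Psi : M -> M) (k : R), (e = 0 -> forall x, Psi x = x) /\ forall x,
    He t (Psi x) = H t x + e * (1 - 2 * t) * chart_extend c b x + k.
Proof.
move=> cM gb cf [sH oH] [sHe oHe] sphi def t01.
have [cK Kc sb b0 _] := gb.
have tI : `[0, 1]%classic t by rewrite /= in_itv/=; case/andP: t01 => /ltW -> /ltW ->.
have nI : nbhs t (`[0, 1]%classic : set R).
  apply: (@interval_nbhs _ _ 0 1) => //; first exact: interval_is_interval.
    by rewrite /= in_itv/= lexx ler01.
  by rewrite /= in_itv/= lexx ler01.
pose sg s := e * cutoff s.
have ex s : exists P : R -> M -> M, `[0, 1]%classic s ->
    is_flow (fun x => sg s * chart_extend c b x) P /\
    forall x, psi s x = P 1 (phi s x).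
  have [sI|sI] := pselect (`[0, 1]%classic s); last by exists (fun _ x => x).
  have [P fP pP] := def s sI; exists P => _; split => //.
  rewrite (_ : (fun x => sg s * chart_extend c b x) = (fun x => e * (cutoff s * chart_extend c b x)))//.
  by apply/funext => x; rewrite mulrA.
have [PhiF PhiP] := choice ex.
have [flt psit] := PhiP t tI.
exists (PhiF t 1).
pose D x := He t (PhiF t 1 x) - H t x - e * (1 - 2 * t) * chart_extend c b x.
suff DC : forall x y, D x = D y.
  (* For e = 0 the Hamiltonian is 0 everywhere, so [orbit_stationary] applies with an empty
     support. *)
  have id0 : e = 0 -> forall x, PhiF t 1 x = x.
    move=> e0 x; have [Phi0 og] := flt x.
    have z0 s z : setT s -> ~ (set0 : set M) z -> sg t * chart_extend c b z = 0.
      by move=> _ _; rewrite /sg e0 !mul0r.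
    have n0 : ~ (set0 : set M) (PhiF t 0 x) by [].
    rewrite -[RHS]Phi0.
    have iT : is_interval (setT : set R) by [].
    have z1 (s : R) z : setT s -> ~ (set0 : set M) z -> (fun=> fun x => sg t * chart_extend c b x) s z = 0 by exact: z0.
    have E := @orbit_stationary _ _ _ setT _ (fun s => PhiF t s x) set0 0 iT (@closed0 M) z1 og I n0 1 I.
    exact: E.
  have [[x0 _]|nM] := pselect (exists x0 : M, True); last first.
    by exists 0; split => // x; exfalso; apply: nM; exists x.
  by exists (D x0); split => // x; rewrite -(DC x) /D; ring.
(* On the support this is [composed_path_derive]. Off it the original and the deformed orbit
   coincide near time t, so the two Hamiltonian fields agree there. *)
have loc x : exists2 N, nbhs x N & forall z, N z -> D z = D x.
  have [Kx|Kx] := pselect ((of_coord c @` K) x).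
    have xc : chart_dom c x by have [y Ky <-] := Kx; apply: of_coord_dom; exact: Kc.
    have [r r0 Hr] := nbhs_of_chart xc (filterT : nbhs x setT).
    apply: (chart_locally_const xc r0) => y /Hr[yc _] w.
    (* Surjectivity of [phi t] gives an orbit that passes through the point at time t. *)
    have [x0 x0E] := sphi (of_coord c y).
    have dphi : chart_dom c (phi t x0) by rewrite x0E; exact: of_coord_dom.
    pose u s := to_coord c (phi s x0).
    have ut : u t = y by rewrite /u x0E of_coordK.
    have du := orbit_derive (oH x0) nI dphi; rewrite -[to_coord c (phi t x0)]/(u t) in du.
    have flc s : `[0, 1]%classic s -> chart_dom c (phi s x0) ->
        chart_dom c (psi s x0) /\ to_coord c (psi s x0) = theta (u s) (sg s).
      move=> sI ds; have [fs ->] := PhiP s sI; exact: (flow_coord_flow gb cf fs ds).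
    have [dpsi psiE] := flc t tI dphi.
    have dp := orbit_derive (oHe x0) nI dpsi; rewrite psiE in dp.
    have dp' : is_derive t 1 (fun s => theta (u s) (sg s))
       (ham_field (Defs.form c) (He t \o of_coord c) (theta (u t) (sg t))).
      apply: near_eq_is_derive dp.
      have [r1 r10 H1] := orbit_near (oH x0) tI dphi ltr01.
      have nr : \forall s \near t, `|s - t| < r1 by apply/near_ball_norm; exists r1.
      apply: filterS (filterI nr nI) => s [sr sI]; have [ds _] := H1 s sI sr.
      by have [_] := flc s sI ds.
    have zc : chart_img c (theta (u t) (sg t)) by rewrite -psiE; exact: to_coord_img.
    have [U [oU Uz sU _]] := family_smooth_slice sHe tI zc.
    have uc : chart_img c (u t) by rewrite ut.
    have KD := composed_path_derive gb cf uc du (cutoff_is_derive e t) dp' oU sU Uz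
      (fun w => ham_fieldE w oU sU Uz zc) w.
    rewrite ut in KD.
    have := is_deriveB KD (family_ham_fieldE w sH tI yc); rewrite subrr.
    apply: near_eq_is_derive.
    apply: (near_open (@open_chart_img _ _ _ c) yc) => y' yc'.
    have dy' := of_coord_dom yc'.
    have [dP PE] := flow_coord_flow gb cf flt dy'.
    rewrite /D /= chart_extend_of// -[PhiF t 1 (of_coord c y')](to_coordK dP) PE of_coordK//.
    rewrite !fctE /=; ring.
  have oK : nbhs x (~` (of_coord c @` K)).
    by apply: open_nbhs_nbhs; split => //; apply: closed_openC; exact: chart_closed.
  have [d xd] := chart_cover x.
  have [r r0 Hr] := nbhs_of_chart xd oK.
  apply: (chart_locally_const xd r0) => y yr w; have [yd Ky] := Hr y yr.
  have [x0 x0E] := sphi (of_coord d y).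
  have dphi : chart_dom d (phi t x0) by rewrite x0E; exact: of_coord_dom.
  have psiout s : `[0, 1]%classic s -> ~ (of_coord c @` K) (phi s x0) -> psi s x0 = phi s x0.
    by move=> sI Ks; have [fs ->] := PhiP s sI; exact: (flow_out gb fs Ks).
  have Kt : ~ (of_coord c @` K) (phi t x0) by rewrite x0E.
  have psiE := psiout t tI Kt.
  have dpsi : chart_dom d (psi t x0) by rewrite psiE.
  have du := orbit_derive (oH x0) nI dphi.
  have dp := orbit_derive (oHe x0) nI dpsi.
  have dp' : is_derive t 1 (to_coord d \o phi ^~ x0)
      (ham_field (Defs.form d) (He t \o of_coord d) (to_coord d (psi t x0))).
    apply: near_eq_is_derive dp.
    have oKt : nbhs (phi t x0) (~` (of_coord c @` K)).
      by apply: open_nbhs_nbhs; split => //; apply: closed_openC; exact: chart_closed.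
    have [r1 r10 H1] := orbit_nbhs (oH x0) tI oKt.
    have nr : \forall s \near t, `|s - t| < r1 by apply/near_ball_norm; exists r1.
    by apply: filterS (filterI nr nI) => s [sr sI]; rewrite /= psiout//; exact: H1.
  have E : ham_field (Defs.form d) (He t \o of_coord d) y = ham_field (Defs.form d) (H t \o of_coord d) y.
    by have [_ e1] := du; have [_] := dp'; rewrite e1 psiE x0E of_coordK.
  have := is_deriveB (family_ham_fieldE w sHe tI yd) (family_ham_fieldE w sH tI yd).
  rewrite E subrr; apply: near_eq_is_derive.
  have nb : \forall y' \near y, `|y' - to_coord d x| < r.
    apply/near_ball_norm; exists (r - `|y - to_coord d x|); first by rewrite subr_gt0.
    move=> y' yy; rewrite -(subrKA y); apply: le_lt_trans (ler_normD _ _) _.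
    by rewrite -ltrBrDr.
  apply: filterS nb => y' /Hr[yd' Ky'].
  by rewrite /D /= (chart_extend0 b0 Ky') (flow_out gb flt Ky') mulr0 subr0.
move=> x y; apply: (@connected_ind _ [set: M] (fun z => D x = D z) x) => // z _.
have [N Nz HN] := loc z; exists N => // s s' _ _ Ns Ns' ->.
by rewrite (HN s Ns) (HN s' Ns').
Qed.

(** * First variation of the length *)

(** Extended real values: the Hamiltonian behind [hofer_length] is any generator of the path, with
    no boundedness built in. *)
Definition oscillation R (T : Type) (f : T -> R) : \bar R :=
  (ereal_sup [set (f x)%:E | x in [set: T]] - ereal_inf [set (f x)%:E | x in [set: T]])%E.

Lemma oscillation_ge R (T : Type) (f : T -> R) p q :
  ((f p - f q)%:E <= oscillation f)%E.
Proof.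
rewrite EFinB /oscillation; apply: leeB.
  by apply: ereal_sup_ubound; exists p.
by apply: ereal_inf_lbound; exists q.
Qed.

Lemma oscillation_ge0 R (T : Type) (f : T -> R) (p : T) :
  (0 <= oscillation f)%E.
Proof. by have := oscillation_ge f p p; rewrite subrr. Qed.

Lemma ereal_sup_max R (T : Type) (f : T -> R) p : (forall y, f y <= f p) ->
  ereal_sup [set (f x)%:E | x in [set: T]] = (f p)%:E.
Proof.
move=> H; apply/eqP; rewrite eq_le; apply/andP; split.
  by apply: ge_ereal_sup => _ [y _ <-]; rewrite lee_fin.
by apply: ereal_sup_ubound; exists p.
Qed.

Lemma ereal_inf_min R (T : Type) (f : T -> R) p : (forall y, f p <= f y) ->
  ereal_inf [set (f x)%:E | x in [set: T]] = (f p)%:E.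
Proof.
move=> H; apply/eqP; rewrite eq_le; apply/andP; split.
  by apply: ereal_inf_lbound; exists p.
by apply: le_ereal_inf_tmp => _ [y _ <-]; rewrite lee_fin.
Qed.

(** The supremum is uncountable, but its superlevel sets in the open set [I] are unions of open
    sets. *)
Lemma sup_family_measurable R (T : Type) (F : R -> T -> R) (I : set R) :
  open I -> (forall x t, I t -> {for t, continuous (F ^~ x)}) ->
  measurable_fun I ((fun t => ereal_sup [set (F t x)%:E | x in [set: T]]) : R -> \bar R).
Proof.
move=> oI cF; apply: (measurability _ (ErealGenOInfty.measurableE R)).
move=> /= _ [_ [a ->]] <-; rewrite preimage_itvoy; apply: open_measurable.
rewrite (_ : _ `&` _ = \bigcup_(x in [set: T]) [set t | I t /\ a < F t x]).
  apply: bigcup_open => x _; rewrite openE => t [It aF].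
  have n1 : nbhs t I by exact: open_nbhs_nbhs.
  have n2 : \forall s \near t, a < F s x.
    by have := cF x t It; move=> /cvgr_gt; apply.
  exact: filterI n1 n2.
apply/seteqP; split => [t [It /ereal_sup_gt[_ [x _ <-] aF]]|t [x _ [It aF]]].
  by exists x => //; split => //; rewrite -lte_fin.
split => //=; apply: lt_le_trans (ereal_sup_ubound _); last by exists x.
by rewrite lte_fin.
Qed.

Lemma oscillation_measurable R (T : Type) (F : R -> T -> R) (I : set R) :
  open I -> (forall x t, I t -> {for t, continuous (F ^~ x)}) ->
  measurable_fun I (fun t => oscillation (F t)).
Proof.
move=> oI cF.
have E t : ereal_inf [set (F t x)%:E | x in [set: T]] =
    (- ereal_sup [set (- F t x)%:E | x in [set: T]])%E.
  rewrite -ereal_infN; congr (ereal_inf _); rewrite image_comp.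
  by apply: eq_imagel => x _ /=; rewrite opprK.
apply: emeasurable_funB; first exact: sup_family_measurable.
rewrite (_ : (fun t => ereal_inf _) = (fun t => - ereal_sup [set (- F t x)%:E | x in [set: T]])%E); last first.
  by apply/funext => t; exact: E.
apply: measurableT_comp => //.
apply: (@sup_family_measurable _ _ (fun t x => - F t x)) => // x t It.
by apply: continuousN; exact: cF.
Qed.

Lemma derivable_second_difference R (l : R -> R) (eta : R) :
  derivable l 0 1 -> 0 < eta ->
  exists2 e : R, 0 < e & l e + l (- e) - 2 * l 0 <= eta * e.
Proof.
move=> dl eta0; have eta2 : 0 < eta / 2 by rewrite divr_gt0.
have : is_derive (0 : R) 1 l ('D_1 l 0) by exact: derivableP.
move=> /is_derive_cvg/cvgrPdist_le/(_ _ eta2) H.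
have H' : \forall h \near (0 : R)^', `|'D_1 l 0 - h^-1 * (l h - l 0)| <= eta / 2.
  by apply: filterS H => h; rewrite addr0 [h%:A]mulr1.
have [r r0 Hr] : exists2 r : R, 0 < r & forall h, `|h - 0| < r -> h != 0 ->
    `|'D_1 l 0 - h^-1 * (l h - l 0)| <= eta / 2.
  by apply/near_ball_norm; exact: H'.
pose e := r / 2; have e0 : 0 < e by rewrite divr_gt0.
exists e => //.
have en : e != 0 by rewrite gt_eqF.
have := Hr e; rewrite subr0 gtr0_norm// => /(_ _ en) H1.
have := Hr (- e); rewrite subr0 normrN gtr0_norm// oppr_eq0 => /(_ _ en) H2.
have er : e < r by rewrite /e; lra.
move: (H1 er) (H2 er); rewrite !ler_norml => /andP[a1 _] /andP[_ a2].
rewrite invrN mulNr in a2.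
have b : e^-1 * (l e + l (- e) - 2 * l 0) <= eta by lra.
have := ler_wpM2l (ltW e0) b.
by rewrite mulrA (mulfV en) mul1r [e * eta]mulrC.
Qed.

(* The second difference of the length at 0 dominates the integral of
   [e * w], while it is o(e); Markov's inequality does the rest. *)
Lemma negligible_first_variation R (O : R -> R -> \bar R) (a l w : R -> R) :
  (forall e, measurable_fun (`]0, 1[%classic : set R) (O e)) ->
  (forall e, (\int[@lebesgue_measure R]_(t in `[0%R, 1%R]) O e t = (l e)%:E)%E) ->
  (forall e t, `]0, 1[%classic t -> (0 <= O e t)%E) ->
  (forall t, `]0, 1[%classic t -> O 0 t = (a t)%:E) ->
  (forall e t, 0 < e -> `]0, 1[%classic t ->
     ((2 * a t + e * w t)%R%:E <= O e t + O (- e)%R t)%E) ->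
  (forall t, 0 <= w t) ->
  derivable l 0 1 ->
  (@lebesgue_measure R).-negligible [set t | `]0, 1[%classic t /\ 0 < w t].
Proof.
move=> mO iO O0 Oa Ow w0 dl.
set mu := @lebesgue_measure R; set I := (`]0, 1[%classic : set R).
have mI : measurable I by exact: measurable_itv.
have iO' e : (\int[mu]_(t in I) O e t = (l e)%:E)%E.
  by rewrite -iO /I -(integral_itv_bndoo true false).
have ma : measurable_fun I (EFin \o a).
  by apply: eq_measurable_fun (mO 0) => t; rewrite inE => It; exact: Oa.
have a0 t : I t -> 0 <= a t by move=> It; rewrite -lee_fin -Oa// O0.
have ia : (\int[mu]_(t in I) (a t)%:E = (l 0)%:E)%E.
  by rewrite -iO'; apply: eq_integral => t; rewrite inE => It; rewrite Oa.
pose u e t := (O e t + O (- e)%R t - (2 * a t)%R%:E)%E.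
have m2a : measurable_fun I (fun t => (2 * a t)%R%:E).
  by apply: (@eq_measurable_fun _ _ _ _ _ (fun t => (2%:E * (a t)%:E)%E)) => //;
    exact: measurable_funeM.
have mu_ e : measurable_fun I (u e).
  by apply: emeasurable_funB => //; exact: emeasurable_funD.
have uw e t : 0 < e -> I t -> ((e * w t)%R%:E <= u e t)%E.
  by move=> e0 It; rewrite /u leeBrDr// -EFinD addrC; exact: Ow.
have u0 e t : 0 < e -> I t -> (0 <= u e t)%E.
  by move=> e0 It; apply: le_trans (uw e t e0 It); rewrite lee_fin mulr_ge0// ltW.
have iu e : 0 < e -> (\int[mu]_(t in I) u e t = (l e + l (- e) - 2 * l 0)%R%:E)%E.
  move=> e0.
  have S : (\int[mu]_(t in I) (u e t + (2 * a t)%R%:E) =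
      \int[mu]_(t in I) (O e t + O (- e)%R t))%E.
    by apply: eq_integral => t _; rewrite /u subeK.
  have a20 t : I t -> (0 <= (2 * a t)%R%:E)%E by move=> It; rewrite lee_fin mulr_ge0// a0.
  rewrite (@ge0_integralD _ _ _ mu I mI _ _ (fun t => @u0 e t e0) (mu_ e) a20 m2a) in S.
  rewrite (@ge0_integralD _ _ _ mu I mI _ _ (O0 e) (mO e) (O0 (- e)) (mO (- e))) in S.
  have S2 : (\int[mu]_(t in I) (2 * a t)%R%:E = (2 * l 0)%R%:E)%E.
    under eq_integral do rewrite EFinM.
    by rewrite ge0_integralZl_EFin// ?ia// => t It; rewrite lee_fin a0.
  rewrite !iO' S2 -EFinD in S.
  by rewrite EFinB -S addeK.
(* No measurability of [w] is assumed, so this set is covered by superlevel sets of the measurable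
   functions [u e]. *)
have neg d : 0 < d -> mu.-negligible [set t | I t /\ d <= w t].
  move=> d0.
  have pick (j : nat) : exists e : R, 0 < e /\ l e + l (- e) - 2 * l 0 <= d * j.+1%:R^-1 * e.
    have [|e e0 H] := @derivable_second_difference _ l (d * j.+1%:R^-1) dl.
      by rewrite mulr_gt0.
    by exists e.
  have [e eP] := choice pick.
  (* Markov's inequality at the level e_j d, with e_j chosen so that the integral of [u (e j)] is at
     most d e_j / (j + 1), bounds the measure of [E j] by 1 / (j + 1). Each [E j] contains the set
     in question since u >= e_j w. *)
  pose E j := I `&` [set t | ((e j * d)%R%:E <= `|u (e j) t|)%E].
  have mE j : measurable (E j).
    by apply: emeasurable_fun_c_infty => //; exact: measurableT_comp.
  have muE j : (mu (E j) <= (j.+1%:R^-1)%R%:E)%E.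
    have [e0 ej] := eP j.
    have ed0 : 0 < e j * d by rewrite mulr_gt0.
    have := le_integral_abse mu mI (mu_ (e j)) ed0.
    rewrite -/(E j) => H.
    have H2 : ((e j * d)%R%:E * mu (E j) <= (d * j.+1%:R^-1 * e j)%R%:E)%E.
      apply: (le_trans H).
      have -> : (\int[mu]_(t in I) `|u (e j) t| = \int[mu]_(t in I) u (e j) t)%E.
        by apply: eq_integral => t; rewrite inE => It; rewrite gee0_abs// u0.
      by rewrite iu// lee_fin.
    rewrite -(@lee_pmul2l _ (e j * d)%R%:E)//; apply: (le_trans H2).
    by rewrite -EFinM lee_fin le_eqVlt; apply/orP; left; apply/eqP; ring.
  exists (\bigcap_j E j); split.
  - exact: bigcapT_measurable.
  - apply/eqP; rewrite -measure_le0; apply/lee_addgt0Pr => r r0.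
    rewrite add0e.
    have [j _ /(_ j (leqnn _)) jr] : \forall j \near \oo, j.+1%:R^-1 <= r :> R.
      by near=> j; apply: ltW; near: j; exact: (near_infty_natSinv_lt (PosNum r0)).
    apply: (@le_trans _ _ (mu (E j))).
      apply: le_measure; rewrite ?inE; [exact: bigcapT_measurable|exact: mE|].
      by move=> t H; exact: (H j Logic.I).
    by apply: (le_trans (muE j)); rewrite lee_fin.
  - move=> t [It dw] j _; have [e0 _] := eP j; split => //=.
    rewrite gee0_abs ?u0//; apply: le_trans (uw _ _ e0 It).
    by rewrite lee_fin ler_wpM2l// ltW.
have nj (j : nat) : mu.-negligible [set t | I t /\ j.+1%:R^-1 <= w t] by exact: neg.
apply: negligibleS (negligible_bigcup nj) => t [It wt].
have [j _ /(_ j (leqnn _)) jr] : \forall j \near \oo, j.+1%:R^-1 <= w t :> R.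
  by near=> j; apply: ltW; near: j; exact: (near_infty_natSinv_lt (PosNum wt)).
by exists j.
Unshelve. all: by end_near. Qed.

Lemma family_continuous R n (M : symplectic_manifold R n)
    (F : R -> M -> R) x t : smooth_family F -> 0 < t < 1 ->
  {for t, continuous (F ^~ x)}.
Proof.
move=> sF t01; have [c xc] := chart_cover x.
have tI : `[0, 1]%classic t by rewrite /= in_itv/=; case/andP: t01 => /ltW -> /ltW ->.
have nI : nbhs t (`[0, 1]%classic : set R).
  apply: (@interval_nbhs _ _ 0 1) => //; first exact: interval_is_interval.
    by rewrite /= in_itv/= lexx ler01.
  by rewrite /= in_itv/= lexx ler01.
have [U [G [oU Ut sG _ FG]]] := family_ham_field sF tI (to_coord_img xc).
have cG : {for (t, to_coord c x), continuous G} by exact: (smooth_continuous sG).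
apply/cvgrPdist_lt => e e0.
have N1 : \forall z \near (t, to_coord c x), `|G (t, to_coord c x) - G z| < e.
  by move/cvgrPdist_lt : cG => /(_ e e0).
have N2 : \forall z \near (t, to_coord c x), U z by apply: open_nbhs_nbhs.
have [r r0 Hr] := near_pair_norm (filterI N1 N2).
have N3 : \forall s \near t, `|s - t| < r by apply/near_ball_norm; exists r.
apply: filterS (filterI N3 nI) => s [sr sI].
have [|H1 H2] := Hr s (to_coord c x) sr; first by rewrite subrr normr0.
by have := FG t _ tI Ut; have := FG s _ sI H2; rewrite to_coordK// => -> ->.
Qed.

(** At t = 1/2 the cutoff is 1/4, so for eps = 4 the deformation uses a flow of the generator
    itself. *)
Lemma coord_flow_of_smooth_point R n (M : symplectic_manifold R n) (c : chart M)
    K b (phi psi : R -> M -> M) : generator c K b ->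
  is_deformation phi (fun t x => cutoff t * chart_extend c b x) 4 psi ->
  exists theta, coord_flow c b theta.
Proof.
move=> gb def.
have hI : (`[0, 1]%classic : set R) 2^-1.
  by rewrite /= in_itv/=; apply/andP; split; lra.
have [Phi fl _] := def _ hI.
apply: (coord_flow_exists gb (Phi := Phi)).
rewrite (_ : chart_extend c b = (fun x => 4 * (cutoff 2^-1 * chart_extend c b x)))//.
by apply/funext => x; rewrite /cutoff; field.
Qed.

Lemma first_variation R n (M : symplectic_manifold R n) (c : chart M) K b
    (phi : R -> M -> M) (H : R -> M -> R) (p P : M) :
  connected [set: M] -> Ham_c_path phi -> generates H phi ->
  fixed_minima H p -> fixed_maxima H P -> smooth_point phi ->
  generator c K b -> tangent_field (fun t x => cutoff t * chart_extend c b x) ->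
  (@lebesgue_measure R).-negligible [set t | `]0, 1[%classic t /\
     ((exists2 q, max_set (H t) q & chart_extend c b q <> chart_extend c b P) \/
      (exists2 q, min_set (H t) q & chart_extend c b q <> chart_extend c b p))].
Proof.
move=> cM pphi gH minp maxP sp gb tG.
set g := chart_extend c b.
have [gam [l [gl dl]]] := sp _ tG.
have [theta cf] := coord_flow_of_smooth_point gb (proj1 (gl 4)).
have ex e : exists He : R -> M -> R, generates He (gam e) /\
    (\int[@lebesgue_measure R]_(t in `[0%R, 1%R]) oscillation (He t) = (l e)%:E)%E.
  by have [_ [He gHe iHe]] := gl e; exists He.
have [He HeP] := choice ex.
have in01 (t : R) : `]0, 1[%classic t -> 0 < t < 1 by rewrite /= in_itv.
have inI (t : R) : 0 < t < 1 -> `[0, 1]%classic t.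
  by move=> t01; rewrite /= in_itv/=; case/andP: t01 => /ltW -> /ltW ->.
have defH e t : 0 < t < 1 -> exists (Psi : M -> M) (k : R),
    (e = 0 -> forall x, Psi x = x) /\ forall x,
    He e t (Psi x) = H t x + e * (1 - 2 * t) * g x + k.
  move=> t01; have [df _] := gl e; have [gHe _] := HeP e.
  apply: (deformed_hamiltonian cM gb cf gH gHe _ df t01).
  by have [Hc _ _] := pphi; apply: Ham_c_surj => //; apply: Hc; exact: inI.
have lower e t q r : 0 < t < 1 ->
    ((H t q + e * (1 - 2 * t) * g q - (H t r + e * (1 - 2 * t) * g r))%R%:E <=
     oscillation (He e t))%E.
  move=> t01; have [Psi [k [_ HPsi]]] := defH e t t01.
  apply: le_trans (oscillation_ge (He e t) (Psi q) (Psi r)).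
  by rewrite lee_fin !HPsi le_eqVlt; apply/orP; left; apply/eqP; ring.
pose a t := H t P - H t p.
have Hmax t q : 0 < t < 1 -> max_set (H t) q -> H t q = H t P.
  move=> t01 qm; apply/eqP; rewrite eq_le; apply/andP; split; last exact: qm.
  exact: (maxP t (inI t t01) q).
have Hmin t q : 0 < t < 1 -> min_set (H t) q -> H t q = H t p.
  move=> t01 qm; apply/eqP; rewrite eq_le; apply/andP; split; first exact: qm.
  exact: (minp t (inI t t01) q).
(* Two maxima and two minima, the first ones for e and the others for -e. *)
have two e t q q' r r' : 0 < t < 1 -> max_set (H t) q -> max_set (H t) q' ->
    min_set (H t) r -> min_set (H t) r' ->
    ((2 * a t + e * (1 - 2 * t) * ((g q - g q') - (g r - g r')))%R%:E <=
     oscillation (He e t) + oscillation (He (- e)%R t))%E.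
  move=> t01 qm qm' rm rm'.
  apply: le_trans (leeD (lower e t q r t01) (lower (- e) t q' r' t01)).
  rewrite -EFinD lee_fin (Hmax t q)// (Hmax t q')// (Hmin t r)// (Hmin t r')// /a.
  by rewrite le_eqVlt; apply/orP; left; apply/eqP; ring.
(* The time 1/2 is left out because the factor 1 - 2 t vanishes there; it is put back as a null
   set. *)
pose bad t := [set t | `]0, 1[%classic t /\
     ((exists2 q, max_set (H t) q & g q <> g P) \/
      (exists2 q, min_set (H t) q & g q <> g p))] t /\ t != 2^-1.
(* [w t] is the first-order term of [two]. At times that are not bad all four points are [P] or [p]
   and it is 0. At a bad time [q] is paired with [P] or with [p], in the order given by the sign of
   1 - 2 t times the difference of the values of [g], which makes it positive. *)
have exw t : exists w : R, [/\ 0 <= w,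
    (forall e, 0 < e -> 0 < t < 1 -> ((2 * a t + e * w)%R%:E <=
      oscillation (He e t) + oscillation (He (- e)%R t))%E) & (bad t -> 0 < w)].
  have [[[t01 Hbad] t2]|nb] := pselect (bad t); last first.
    exists 0; split => // e e0 t01; rewrite mulr0 addr0.
    have := two e t P P p p t01 (maxP t (inI t t01)) (maxP t (inI t t01))
      (minp t (inI t t01)) (minp t (inI t t01)).
    by rewrite !subrr mulr0 addr0.
  have {}t01 := in01 t t01.
  have tn : 0 < `|1 - 2 * t|.
    rewrite normr_gt0; apply: contra t2 => /eqP H0; apply/eqP; lra.
  have mP := maxP t (inI t t01); have mp := minp t (inI t t01).
  have fin (q q' r r' : M) (w : R) : max_set (H t) q -> max_set (H t) q' ->
      min_set (H t) r -> min_set (H t) r' ->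
      (1 - 2 * t) * ((g q - g q') - (g r - g r')) = w -> 0 < w ->
      exists w : R, [/\ 0 <= w,
        (forall e, 0 < e -> 0 < t < 1 -> ((2 * a t + e * w)%R%:E <=
         oscillation (He e t) + oscillation (He (- e)%R t))%E) & (bad t -> 0 < w)].
    move=> h1 h2 h3 h4 wE w0; exists w; split => // [|e e0 _]; first exact: ltW.
    by rewrite -wE mulrA; exact: two.
  case: Hbad => -[q qm gq].
    have gn : 0 < `|g q - g P| by rewrite normr_gt0 subr_eq0; apply/eqP.
    have : 0 < `|(1 - 2 * t) * (g q - g P)| by rewrite normrM mulr_gt0.
    case: (ger0P ((1 - 2 * t) * (g q - g P))) => _ w0.
      by apply: (fin q P p p _ qm mP mp mp erefl); rewrite subrr subr0.
    apply: (fin P q p p _ mP qm mp mp erefl).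
    by rewrite subrr subr0 -mulrN opprB in w0 *.
  have gn : 0 < `|g q - g p| by rewrite normr_gt0 subr_eq0; apply/eqP.
  have : 0 < `|(1 - 2 * t) * (g q - g p)| by rewrite normrM mulr_gt0.
  case: (ger0P ((1 - 2 * t) * (g q - g p))) => _ w0.
    by apply: (fin P P p q _ mP mP mp qm erefl); rewrite subrr sub0r opprB.
  by apply: (fin P P q p _ mP mP qm mp erefl); rewrite subrr sub0r mulrN.
have [w wP] := choice exw.
have neg : (@lebesgue_measure R).-negligible [set t | `]0, 1[%classic t /\ 0 < w t].
  apply: (@negligible_first_variation _ (fun e t => oscillation (He e t)) a l w) => //.
  - move=> e; apply: oscillation_measurable; first exact: interval_open.
    move=> x t /in01 t01; have [[sHe _] _] := HeP e; exact: family_continuous.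
  - by move=> e; have [_ ->] := HeP e.
  - by move=> e t _; exact: oscillation_ge0 P.
  - move=> t /in01 t01; have [Psi [k [id0 HPsi]]] := defH 0 t t01.
    have E x : He 0 t x = H t x + k by rewrite -[in LHS](id0 erefl x) HPsi !mul0r addr0.
    rewrite /oscillation (@ereal_sup_max _ _ _ P) ?(@ereal_inf_min _ _ _ p).
    + by rewrite -EFinB !E /a; congr (_%:E); ring.
    + by move=> y; rewrite !E lerD2r; exact: (minp t (inI t t01)).
    + by move=> y; rewrite !E lerD2r; exact: (maxP t (inI t t01)).
  - by move=> e t e0 /in01 t01; have [_ Hw _] := wP t; exact: Hw.
  - by move=> t; have [] := wP t.
have n1 : (@lebesgue_measure R).-negligible [set 2^-1 : R].
  by apply/negligibleP; [exact: measurable_set1|exact: lebesgue_measure_set1].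
apply: negligibleS (negligibleU neg n1) => t Ht.
have [->|t2] := eqVneq t 2^-1; first by right.
by left; split; [case: Ht|have [_ _ Hb] := wP t; apply: Hb].
Qed.

Lemma smooth_functionP R n (M : symplectic_manifold R n) (f : M -> R) :
  smooth_function f <-> forall d : chart M, smooth_on (chart_img d) (fun z => f (of_coord d z)).
Proof.
split=> [sf d|sf d y yd].
  by apply: smooth_on_local => y yd; apply/smooth_atT; exact: sf.
by apply/smooth_atT; exists (chart_img d); split => //; exact: open_chart_img.
Qed.

(** * Bump functions *)

Definition sqdist R m (q y : 'rV[R]_m) : R := \sum_i (y 0 i - q 0 i) ^+ 2.

(** Built on the squared Euclidean distance, a polynomial, because the sup norm is not smooth. A
    larger [k] means a narrower bump. *)
Definition bump R m (q : 'rV[R]_m) (k : R) (y : 'rV[R]_m) : R :=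
  flat 0 (1 - k * sqdist q y).

Lemma sqdist_ge R m (q y : 'rV[R]_m) : `|y - q| ^+ 2 <= sqdist q y.
Proof.
have /andP[H _] := rV_norm_sq (y - q); apply: (le_trans H).
by rewrite le_eqVlt; apply/orP; left; apply/eqP; apply: eq_bigr => i _; rewrite !mxE.
Qed.

Lemma bump_ge0 R m (q : 'rV[R]_m) k y : 0 <= bump q k y.
Proof. exact: flat_ge0. Qed.

Lemma bump_center R m (q : 'rV[R]_m) k : bump q k q = flat 0 1.
Proof.
rewrite /bump /sqdist big1 ?mulr0 ?subr0// => i _.
by rewrite subrr expr0n.
Qed.

Lemma flat_le1 R (x : R) : flat 0 x <= 1.
Proof.
rewrite /flat; case: ifP => x0; last exact: ler01.
by rewrite expr0 invr1 mul1r -expR0 ler_expR oppr_le0 invr_ge0 ltW.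
Qed.

Lemma bump_out R m (q : 'rV[R]_m) k y : 1 <= k * sqdist q y -> bump q k y = 0.
Proof. by move=> H; rewrite /bump flat_le0// subr_le0. Qed.

Lemma coord_sub_is_derive R m (q y v : 'rV[R]_m) i :
  is_derive y v (fun y : 'rV[R]_m => y 0 i - q 0 i) (v 0 i).
Proof.
have := is_deriveB (is_derive_coord i (is_derive_id y v)) (is_derive_cst (q 0 i) y v).
by rewrite subr0.
Qed.

Lemma sqdist_is_derive R m (q y v : 'rV[R]_m) :
  is_derive y v (sqdist q) (2 * \sum_i (y 0 i - q 0 i) * v 0 i).
Proof.
have dc := coord_sub_is_derive q y v.
have E : sqdist q = \sum_i ((fun y : 'rV[R]_m => y 0 i - q 0 i) * (fun y : 'rV[R]_m => y 0 i - q 0 i)).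
  by apply/funext => z; rewrite fct_sumE; apply: eq_bigr => i _; rewrite expr2.
have D : is_derive y v (sqdist q) (\sum_i ((y 0 i - q 0 i) *: v 0 i + (y 0 i - q 0 i) *: v 0 i)).
  by rewrite E; apply: is_derive_sum => i; exact: is_deriveM.
rewrite (_ : 2 * _ = \sum_i ((y 0 i - q 0 i) *: v 0 i + (y 0 i - q 0 i) *: v 0 i))//.
by rewrite mulr_sumr; apply: eq_bigr => i _; rewrite /GRing.scale/=; ring.
Qed.

Lemma sqdist_smooth R (V : normedModType R) m (U : set V)
    (f : V -> 'rV[R]_m) (q : 'rV[R]_m) :
  open U -> smooth_on U f -> smooth_on U (fun z => sqdist q (f z)).
Proof.
move=> oU sf; apply: smooth_sum => // i _.
have s1 : smooth_on U (fun z => f z 0 i - q 0 i).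
  by apply: smoothB => //; [exact: smooth_coord|exact: smooth_cst].
by apply: smooth_on_eq (smoothM oU s1 s1) => // z _; rewrite expr2.
Qed.

(** The inner map [f] leaves room for a transition map. The bump depends on [f] through one real
    polynomial in its coordinates, so composition with a function of one variable is enough. *)
Lemma bump_smooth R (V : normedModType R) m (U : set V)
    (f : V -> 'rV[R]_m) (q : 'rV[R]_m) k :
  open U -> smooth_on U f -> smooth_on U (fun z => bump q k (f z)).
Proof.
move=> oU sf; apply: (smooth_comp1 (psi := flat 0) oU (@smooth_flat R 0)).
apply: smoothB => //; first exact: smooth_cst.
by apply: smoothM => //; [exact: smooth_cst|exact: sqdist_smooth].
Qed.

Lemma bump_is_derive R m (q : 'rV[R]_m) j k y v :
  is_derive y v (fun y => flat j (1 - k * sqdist q y))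
    ((- j%:R * flat j.+1 (1 - k * sqdist q y) + flat j.+2 (1 - k * sqdist q y)) *
     (- (k * (2 * \sum_i (y 0 i - q 0 i) * v 0 i)))).
Proof.
apply: (is_derive_comp1 (f := fun y => 1 - k * sqdist q y)); last exact: flat_is_derive.
have := @is_deriveB R 'rV[R]_m R (cst 1) _ y v _ _ (is_derive_cst _ _ _) (is_deriveZ k (sqdist_is_derive q y v)).
by rewrite sub0r.
Qed.

(** Both sides come out as an explicit expression in [flat 2], [flat 3] and [flat 4] that is
    symmetric in [u] and [v]. *)
Lemma bump_symmetric R m (q : 'rV[R]_m) k (u v y : 'rV[R]_m) :
  'D_u (fun z => 'D_v (bump q k) z) y = 'D_v (fun z => 'D_u (bump q k) z) y.
Proof.
pose S (v z : 'rV[R]_m) : R := \sum_i (z 0 i - q 0 i) * v 0 i.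
have D1 w : (fun z => 'D_w (bump q k) z) =
    (fun z => flat 2 (1 - k * sqdist q z)) * (fun z => - (k * (2 * S w z))).
  apply/funext => z; have [_ ->] := bump_is_derive q 0 k z w.
  by rewrite oppr0 mul0r add0r.
have dS w z v' : is_derive z v' (fun z => - (k * (2 * S w z))) (- (k * (2 * \sum_i v' 0 i * w 0 i))).
  have dc i : is_derive z v' (fun y : 'rV[R]_m => w 0 i *: (y 0 i - q 0 i)) (w 0 i *: v' 0 i).
    by apply: is_deriveZ; exact: coord_sub_is_derive.
  have d := @is_derive_sum _ _ _ _ (fun i => fun y : 'rV[R]_m => w 0 i *: (y 0 i - q 0 i)) z v' _ dc.
  have E1 : (fun z => - (k * (2 * S w z))) = (- (k * 2)) *:
      \sum_i (fun y : 'rV[R]_m => w 0 i *: (y 0 i - q 0 i)).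
    apply/funext => z'; rewrite scalrfctE fct_sumE /GRing.scale/= mulNr mulrA.
    by congr (- (_ * _)); apply: eq_bigr => i _; rewrite mulrC.
  have E2 : - (k * (2 * \sum_i v' 0 i * w 0 i)) = (- (k * 2)) *: \sum_i w 0 i *: v' 0 i.
    rewrite /GRing.scale/= mulNr mulrA; congr (- (_ * _)).
    by apply: eq_bigr => i _; rewrite mulrC.
  by rewrite E1 E2; exact: is_deriveZ.
set F := fun z => flat 2 (1 - k * sqdist q z).
have D2 w v' : 'D_v' (F * (fun z => - (k * (2 * S w z)))) y =
    F y * (- (k * (2 * \sum_i v' 0 i * w 0 i))) + (- (k * (2 * S w y))) *
    ((- 2%:R * flat 3 (1 - k * sqdist q y) + flat 4 (1 - k * sqdist q y)) * (- (k * (2 * S v' y)))).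
  have := @is_deriveM _ _ F (fun z => - (k * (2 * S w z))) y v' _ _
    (bump_is_derive q 2 k y v') (dS w y v').
  by move=> [_ ->].
have D3 w v' : 'D_v' (fun z => 'D_w (bump q k) z) y = 'D_v' (F * (fun z => - (k * (2 * S w z)))) y.
  exact: (congr1 (fun f => 'D_v' f y) (D1 w)).
apply: etrans (D3 v u) _; apply: etrans (D2 v u) _; apply/esym.
apply: etrans (D3 u v) _; apply: etrans (D2 u v) _.
rewrite (eq_bigr (fun i => u 0 i * v 0 i)); last by move=> i _; rewrite mulrC.
move: (F y) (flat 3 _) (flat 4 _) (S u y) (S v y) (\sum_i _) => a b d e f h.
ring.
Qed.

Definition bump_supp R m (q : 'rV[R]_m) (k : R) : set 'rV[R]_m :=
  [set y | k * sqdist q y <= 1].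

Lemma sqdist_continuous R m (q : 'rV[R]_m) : continuous (sqdist q).
Proof.
move=> y; have := sqdist_smooth q openT (smooth_id (@openT 'rV[R]_m)).
by move=> s; exact: (smooth_continuous s).
Qed.

Lemma bump_supp_norm R m (q : 'rV[R]_m) k r y : 0 < k -> 0 < r -> r ^- 2 <= k ->
  bump_supp q k y -> `|y - q| <= r.
Proof.
move=> k0 r0 rk /= ky.
have r20 : 0 < r ^+ 2 by rewrite exprn_gt0.
suff: `|y - q| ^+ 2 <= r ^+ 2 by rewrite ler_pXn2r ?nnegrE// ltW.
have H1 : k * `|y - q| ^+ 2 <= 1.
  by apply: le_trans ky; rewrite ler_wpM2l ?sqdist_ge// ltW.
have : r ^- 2 * `|y - q| ^+ 2 <= 1 by apply: le_trans H1; rewrite ler_wpM2r ?exprn_ge0.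
by rewrite mulrC ler_pdivrMr// mul1r.
Qed.

Lemma bump_supp_compact R m (q : 'rV[R]_m) k : 0 < k -> compact (bump_supp q k).
Proof.
move=> k0; apply: bounded_closed_compact.
  (* From r >= 1 follows r^2 >= r >= 1/k, so [r] bounds the radius of the support without a square
     root. *)
  pose r : R := Num.max 1 k^-1.
  have r1 : 1 <= r by rewrite /r le_max lexx.
  have rk : k^-1 <= r by rewrite /r le_max lexx orbT.
  exists (r + `|q|); split; first exact: num_real.
  move=> x xr y /= ky; apply: le_trans (ltW xr).
  rewrite -(subrK q y); apply: le_trans (ler_normD _ _) _; rewrite lerD2r.
  apply: (bump_supp_norm k0 (lt_le_trans ltr01 r1) _ ky).
  rewrite -[k]invrK lef_pV2 ?posrE ?exprn_gt0 ?invr_gt0 ?(lt_le_trans ltr01 r1)//.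
  by apply: le_trans rk _; rewrite expr2 ler_peMl// (le_trans ler01 r1).
apply: (@preimage_closed _ _ (fun y => k * sqdist q y) [set x | x <= 1]); last exact: closed_le.
move=> y _; apply: continuousM; [exact: cst_continuous|exact: sqdist_continuous].
Qed.

Lemma bump_off R m (q : 'rV[R]_m) k y : ~ bump_supp q k y -> bump q k y = 0.
Proof.
by move=> H; apply: bump_out; apply: ltW; rewrite ltNge; apply/negP.
Qed.

Lemma bump_generator R n (M : symplectic_manifold R n) (c : chart M) q k :
  0 < k -> bump_supp q k `<=` chart_img c -> generator c (bump_supp q k) (bump q k).
Proof.
move=> k0 kc; split.
- exact: bump_supp_compact.
- exact: kc.
- by apply: bump_smooth; [exact: openT|exact: smooth_id openT].
- exact: bump_off.
- exact: (@bump_symmetric R (n + n) q k).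
Qed.

Lemma generator_comb R n (M : symplectic_manifold R n) (c : chart M) K1 K2 b1 b2
    (a1 a2 : R) : generator c K1 b1 -> generator c K2 b2 ->
  generator c (K1 `|` K2) (fun y => a1 * b1 y + a2 * b2 y).
Proof.
move=> [cK1 Kc1 s1 z1 y1] [cK2 Kc2 s2 z2 y2]; split.
- exact: compactU.
- by move=> y [/Kc1|/Kc2].
- by apply: smoothD; [exact: openT| |]; apply: smoothM; try exact: smooth_cst; try exact: openT.
- move=> y Ky; rewrite z1 ?z2 ?mulr0 ?addr0// => ?; apply: Ky; [by right|by left].
- move=> u v y.
  have D1 w : (fun z => 'D_w (fun y => a1 * b1 y + a2 * b2 y) z) =
      (fun z => a1 * 'D_w b1 z + a2 * 'D_w b2 z).
    apply/funext => z.
    have d1 := is_deriveZ a1 (derivableP (smooth_derivable s1 I : derivable b1 z w)).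
    have d2 := is_deriveZ a2 (derivableP (smooth_derivable s2 I : derivable b2 z w)).
    by have [_ ->] := is_deriveD d1 d2.
  have D2 w w' : 'D_w' (fun z => a1 * 'D_w b1 z + a2 * 'D_w b2 z) y =
     a1 * 'D_w' (fun z => 'D_w b1 z) y + a2 * 'D_w' (fun z => 'D_w b2 z) y.
    have d1 := is_deriveZ a1 (derivableP (smooth_derivable (smooth_derive w s1) I :
      derivable (fun z => 'D_w b1 z) y w')).
    have d2 := is_deriveZ a2 (derivableP (smooth_derivable (smooth_derive w s2) I :
      derivable (fun z => 'D_w b2 z) y w')).
    by have [_ ->] := is_deriveD d1 d2.
  by rewrite !D1 !D2 y1 y2.
Qed.

(** In another chart the function is, near its support, the bump composed with the transition map.
    Elsewhere it is locally 0, because the compact support has closed image in the Hausdorff space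
    [M]. *)
Lemma chart_extend_bump_smooth R n (M : symplectic_manifold R n) (c : chart M) q k :
  0 < k -> bump_supp q k `<=` chart_img c ->
  smooth_function (chart_extend c (bump q k)).
Proof.
move=> k0 kc; apply/smooth_functionP => d; apply: smooth_on_local => y yd.
have cK := @bump_supp_compact _ _ q _ k0.
have [yc|yc] := pselect ((of_coord c @` bump_supp q k) (of_coord d y)).
  have {}yc : chart_dom c (of_coord d y).
    by have [z zK <-] := yc; apply: of_coord_dom; exact: kc.
  have /smooth_atT[U [oU Uy sU]] := transition_smooth yd yc.
  have [U' [oU' U'y UU']] : exists U', [/\ open U', U' y & forall z, U' z -> chart_dom c (of_coord d z)].
    have N : nbhs y [set z | chart_dom c (of_coord d z)].
      by apply: (of_coord_cont yd); apply: open_nbhs_nbhs; split => //; exact: open_chart_dom.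
    by move: N; rewrite nbhsE => -[U' [oU' U'y] UU']; exists U'.
  exists (U `&` U'); split => //; first exact: openI.
  apply: (@smooth_on_eq _ _ _ _ (fun z => bump q k (to_coord c (of_coord d z)))).
  - exact: openI.
  - by move=> z [_ /UU' zc]; rewrite chart_extendE.
  - by apply: bump_smooth; [exact: openI|apply: smooth_onW sU => z []].
have oK : nbhs (of_coord d y) (~` (of_coord c @` bump_supp q k)).
  by apply: open_nbhs_nbhs; split => //; apply: closed_openC; exact: chart_closed.
have := of_coord_cont yd oK; rewrite nbhsE => -[U [oU Uy] UU].
exists U; split => //.
apply: (@smooth_on_eq _ _ _ _ (fun=> 0)) => //; last exact: smooth_cst.
by move=> z /UU zK; rewrite (chart_extend0 _ zK)//; exact: bump_off.
Qed.

Lemma smooth_function_comb R n (M : symplectic_manifold R n) (f1 f2 : M -> R)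
    (a1 a2 : R) : smooth_function f1 -> smooth_function f2 ->
  smooth_function (fun x => a1 * f1 x + a2 * f2 x).
Proof.
move=> /smooth_functionP s1 /smooth_functionP s2; apply/smooth_functionP => d.
have o := @open_chart_img _ _ _ d.
by apply: smoothD => //; apply: smoothM => //; exact: smooth_cst.
Qed.

Lemma chart_extend_comb R m (M : manifold R m) (c : chart M) b1 b2 (a1 a2 : R) :
  chart_extend c (fun y => a1 * b1 y + a2 * b2 y) =
  fun x => a1 * chart_extend c b1 x + a2 * chart_extend c b2 x.
Proof.
apply/funext => x; rewrite /chart_extend; case: asboolP => // _.
by rewrite !mulr0 addr0.
Qed.

Lemma cutoff_tangent_field R n (M : symplectic_manifold R n) (g : M -> R) (K : set M) :
  smooth_function g -> compact K -> (forall x, ~ K x -> g x = 0) ->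
  (compact [set: M] -> forall t, liouville_integral (fun x => cutoff t * g x) 0) ->
  tangent_field (fun t x => cutoff t * g x).
Proof.
move=> sg cK g0 I0; split.
- move=> d t y tI yd; have /smooth_atT[U [oU Uy sU]] := sg d y yd.
  exists [set z | U z.2], (fun z => cutoff z.1 * g (of_coord d z.2)); split => //.
    exact: open_snd.
  apply: smoothM; [exact: open_snd| |exact: (smooth_snd sU)].
  apply: (@smooth_onW _ _ _ [set z : R * 'rV[R]_(n + n) | setT z.1]) => //.
  apply: (@smooth_fst _ _ _ setT (fun t : R => t * (1 - t))).
  have sid := smooth_id (@openT R).
  apply: smoothM => //; first exact: openT.
  by apply: smoothB => //; [exact: openT|exact: smooth_cst].
- by exists K => // t x _ Kx; rewrite g0// mulr0.
- by move=> x; rewrite /cutoff !mul0r.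
- by move=> x; rewrite /cutoff subrr mulr0 mul0r.
- by move=> cM t _; exact: I0.
Qed.

(** * Iterated integrals of compactly supported Lipschitz functions *)

(** A class of integrands that survives the absolute value in [liouville_density] as well as slicing
    and integrating out coordinates. *)
Definition lipschitz_supp R m (F : 'rV[R]_m -> R) : Prop :=
  (exists2 L : R, 0 <= L & forall a b, `|F a - F b| <= L * `|a - b|) /\
  (exists2 r : R, 0 <= r & forall y, r < `|y| -> F y = 0).

Lemma lipschitz_supp_comb R m (F G : 'rV[R]_m -> R) (s t : R) :
  lipschitz_supp F -> lipschitz_supp G -> lipschitz_supp (fun y => s * F y + t * G y).
Proof.
move=> [[L L0 HL] [r r0 Hr]] [[L' L'0 HL'] [r' r'0 Hr']]; split.
  exists (`|s| * L + `|t| * L'); first by rewrite addr_ge0 ?mulr_ge0.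
  move=> a b.
  rewrite (_ : _ - _ = s * (F a - F b) + t * (G a - G b)); last by ring.
  apply: le_trans (ler_normD _ _) _; rewrite !normrM mulrDl -!mulrA.
  by rewrite lerD// ler_wpM2l.
exists (r + r') => [|y ry]; first exact: addr_ge0.
rewrite Hr ?Hr' ?mulr0 ?addr0//; apply: le_lt_trans ry.
  by rewrite lerDr.
by rewrite lerDl.
Qed.

Section line.
Variable R : realType.
Local Notation mu := (@lebesgue_measure R).

Lemma lipschitz_supp_integrable (h : R -> R) (L r : R) : 0 <= L ->
  (forall x y, `|h x - h y| <= L * `|x - y|) -> (forall x, r < `|x| -> h x = 0) ->
  mu.-integrable setT (EFin \o h).
Proof.
move=> L0 HL Hr.
have ch : continuous h.
  move=> x; apply/cvgrPdist_lt => e e0.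
  have L1 : 0 < L + 1 by rewrite ltr_wpDl.
  have d0 : 0 < e / (L + 1) by rewrite divr_gt0.
  apply: filterS (nbhsx_ballx x _ d0) => y xy.
  apply: le_lt_trans (HL _ _) _.
  apply: (@le_lt_trans _ _ ((L + 1) * `|x - y|)); first by rewrite ler_wpM2r// lerDl.
  by rewrite mulrC -ltr_pdivlMr.
have ir : mu.-integrable `[- r, r] (EFin \o h).
  by apply: continuous_compact_integrable; [exact: segment_compact|exact: continuous_subspaceT].
have := (@integrable_mkcond _ _ R mu _ (EFin \o h) (@measurable_itv R `[- r, r])).1 ir.
congr (is_true (integrable _ _ _)); apply/funext => x; rewrite patchE; case: ifPn => // /negP xr.
by rewrite /= Hr// ltNge; apply: contra_notN xr; rewrite ler_norml inE/= in_itv.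
Qed.

Lemma supp_integral_le (h : R -> R) (C r z : R) : 0 <= r ->
  mu.-integrable setT (EFin \o h) ->
  (forall x, `|h x| <= C) -> (forall x, r < `|x - z| -> h x = 0) ->
  `|(\int[mu]_x h x)%R| <= C * (2 * r).
Proof.
move=> r0 ih hC hz.
pose D := `[z - r, z + r]%classic.
have mD : measurable (D : set (measurableTypeR R)) by exact: measurable_itv.
have hD : h \_ D = h.
  apply/funext => x; rewrite patchE; case: ifPn => // /negP xD.
  rewrite hz// ltNge; apply: contra_notN xD; rewrite ler_norml => /andP[H1 H2].
  by apply/mem_set; rewrite /D/= in_itv/=; apply/andP; split; lra.
have iD : mu.-integrable D (EFin \o h) by apply: integrableS ih.
rewrite -hD -Rintegral_mkcond.
apply: le_trans (le_normr_Rintegral _ iD) _ => //.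
have C_int : mu.-integrable D (EFin \o cst C).
  apply: continuous_compact_integrable; first exact: segment_compact.
  by apply: continuous_subspaceT => x; exact: cst_continuous.
apply: (@le_trans _ _ ((\int[mu]_(x in D) C)%R)).
  by apply: le_Rintegral => //; exact: integrable_norm.
have C0 : 0 <= C by apply: le_trans (hC 0).
have muD : fine (mu D) <= 2 * r.
  rewrite /D lebesgue_measure_itv/= lte_fin.
  by case: ifPn => _; rewrite ?mulr_ge0// -EFinB/=; lra.
by rewrite Rintegral_cst//; apply: ler_wpM2l muD.
Qed.

End line.

Section integral_rV.
Variable R : realType.
Local Notation mu := (@lebesgue_measure R).

Definition slice m (F : 'rV[R]_(1 + m) -> R) (x : R) (y : 'rV[R]_m) : R :=
  F (row_mx (x%:M : 'rV[R]_1) y).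

Lemma rV_cons_le m (x x' : R) (y y' : 'rV[R]_m) (r : R) :
  (`|row_mx (x%:M : 'rV[R]_1) y - row_mx (x'%:M : 'rV[R]_1) y'| <= r) <->
  `|x - x'| <= r /\ `|y - y'| <= r.
Proof.
have B (A A' : 'rV[R]_(1 + m)) i : (A - A') 0 i = A 0 i - A' 0 i by rewrite !mxE.
split=> [H|[H1 H2]].
  have r0 : 0 <= r by apply: le_trans H.
  have /(rV_norm_le _ r0) {}H := H; split.
    by have := H (lshift m 0); rewrite B !row_mxEl !mxE.
  apply/(rV_norm_le _ r0) => j.
  by have := H (rshift 1 j); rewrite B !row_mxEr !mxE.
have r0 : 0 <= r by apply: le_trans H1.
apply/(rV_norm_le _ r0) => i.
rewrite !mxE; case: fintype.split => [a|j]; first by rewrite (ord1 a) !mxE.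
have /(rV_norm_le _ r0) {}H2 := H2; by have := H2 j; rewrite !mxE.
Qed.

Lemma rV_cons_split m (z : 'rV[R]_(1 + m)) :
  z = row_mx ((z 0 (lshift m 0))%:M : 'rV[R]_1) (rsubmx z).
Proof.
rewrite -[LHS]hsubmxK; congr row_mx.
by apply/rowP => i; rewrite !mxE (ord1 i).
Qed.

(** Linearity and the bound are proved by one induction: integrability of the inner integral needs
    its Lipschitz continuity in the outer variable, which is the bound applied to a difference of
    slices, one dimension lower. The free centre [z] makes integrals of narrow bumps small wherever
    they sit. *)
Lemma integral_rV_properties m :
  (forall (F G : 'rV[R]_m -> R) s t, lipschitz_supp F -> lipschitz_supp G ->
    integral_rV (fun y => s * F y + t * G y) = s * integral_rV F + t * integral_rV G) /\
  (forall (F : 'rV[R]_m -> R) (C r : R) (z : 'rV[R]_m), lipschitz_supp F -> 0 <= r -> (forall y, `|F y| <= C) ->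
    (forall y, r < `|y - z| -> F y = 0) -> `|integral_rV F| <= C * (2 * r) ^+ m).
Proof.
elim: m => [|m [IH1 IH2]].
  by split=> //= F C r z _ _ FC _; rewrite mulr1.
have slice_lip (F : 'rV[R]_(1 + m) -> R) x : lipschitz_supp F -> lipschitz_supp (slice F x).
  move=> [[L L0 HL] [r r0 Hr]]; split.
    exists L => // a b; apply: le_trans (HL _ _) _; rewrite ler_wpM2l//.
    by apply/rV_cons_le; rewrite subrr normr0.
  exists r => // y ry; apply: Hr; rewrite ltNge; apply: contraTN ry => H; rewrite -leNgt.
  have /rV_cons_le[_] : `|row_mx (x%:M : 'rV[R]_1) y - row_mx ((0 : R)%:M : 'rV[R]_1) 0| <= r.
    by rewrite (_ : (0 : R)%:M = 0) ?row_mx0 ?subr0// raddf0.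
  by rewrite subr0.
have inner (F : 'rV[R]_(1 + m) -> R) : lipschitz_supp F ->
    mu.-integrable setT (EFin \o (fun x => integral_rV (slice F x))).
  move=> lF; have [[L L0 HL] [r r0 Hr]] := lF.
  have C0 : 0 <= L * (2 * r) ^+ m by rewrite mulr_ge0 ?exprn_ge0 ?mulr_ge0.
  apply: (@lipschitz_supp_integrable R _ (L * (2 * r) ^+ m) r) => //.
    move=> x x'.
    have lx := slice_lip F x lF; have lx' := slice_lip F x' lF.
    have E : integral_rV (slice F x) - integral_rV (slice F x') =
        integral_rV (fun y => 1 * slice F x y + (-1) * slice F x' y).
      by rewrite IH1// mul1r mulN1r.
    rewrite E mulrAC.
    apply: (IH2 _ _ _ 0); rewrite ?mulr_ge0//.
    - exact: lipschitz_supp_comb.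
    - move=> y; rewrite mul1r mulN1r; apply: le_trans (HL _ _) _; rewrite ler_wpM2l//.
      by apply/rV_cons_le; rewrite subrr normr0.
    - move=> y; rewrite subr0 => ry.
      have z w : slice F w y = 0.
        apply: Hr; apply: lt_le_trans ry _.
        have /rV_cons_le[_] : `|row_mx (w%:M : 'rV[R]_1) y - row_mx ((0 : R)%:M : 'rV[R]_1) 0| <=
            `|row_mx (w%:M : 'rV[R]_1) y|.
          by rewrite (_ : (0 : R)%:M = 0) ?row_mx0 ?subr0// raddf0.
        by rewrite subr0.
      by rewrite !z !mulr0 addr0.
  move=> x rx.
  have Z : slice F x = fun=> 0.
    apply/funext => y; apply: Hr; apply: lt_le_trans rx _.
    have /rV_cons_le[+ _] : `|row_mx (x%:M : 'rV[R]_1) y - row_mx ((0 : R)%:M : 'rV[R]_1) 0| <=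
        `|row_mx (x%:M : 'rV[R]_1) y|.
      by rewrite (_ : (0 : R)%:M = 0) ?row_mx0 ?subr0// raddf0.
    by rewrite subr0.
  (* The bound with C = 0 shows that the zero function has integral 0. *)
  apply/eqP; rewrite -normr_le0 -(mul0r ((2 * 0) ^+ m)); apply: (IH2 _ _ _ 0) => //.
  - exact: slice_lip.
  - by move=> y; rewrite Z normr0.
  - by move=> y _; rewrite Z.
split=> [F G s t lF lG|F C r z lF r0 FC Fz].
  have E : integral_rV (fun y : 'rV[R]_(m.+1) => s * F y + t * G y) =
      (\int[mu]_x (s * integral_rV (slice F x) + t * integral_rV (slice G x)))%R.
    by apply: eq_Rintegral => x _; apply: IH1; exact: slice_lip.
  rewrite E RintegralD//; first by rewrite !RintegralZl//; exact: inner.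
  - by have := integrableZl (measurableT) s (inner _ lF).
  - by have := integrableZl (measurableT) t (inner _ lG).
have C0 : 0 <= C by apply: le_trans (FC 0).
rewrite exprS mulrCA [leRHS]mulrC.
have Cm : 0 <= C * (2 * r) ^+ m by rewrite mulr_ge0 ?exprn_ge0 ?mulr_ge0.
pose z0 : R := (z : 'rV[R]_(1 + m)) 0 (lshift m 0).
have zE : z = row_mx (z0%:M : 'rV[R]_1) (rsubmx (z : 'rV[R]_(1 + m))) := rV_cons_split z.
apply: (@supp_integral_le _ (fun x => integral_rV (slice F x)) _ _ z0) => //.
- exact: inner.
- move=> x; apply: (IH2 _ _ _ (rsubmx (z : 'rV[R]_(1 + m)))) => //; [exact: slice_lip|by move=> y; exact: FC|].
  move=> y ry; apply: Fz; apply: lt_le_trans ry _.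
  by have /rV_cons_le[] := lexx `|row_mx (x%:M : 'rV[R]_1) y - row_mx (z0%:M : 'rV[R]_1) (rsubmx (z : 'rV[R]_(1 + m)))|; rewrite -zE.
- move=> x xr.
  have Z : slice F x = fun=> 0.
    apply/funext => y; apply: Fz; apply: lt_le_trans xr _.
    by have /rV_cons_le[] := lexx `|row_mx (x%:M : 'rV[R]_1) y - row_mx (z0%:M : 'rV[R]_1) (rsubmx (z : 'rV[R]_(1 + m)))|; rewrite -zE.
  apply/eqP; rewrite -normr_le0 -(mul0r ((2 * 0) ^+ m)); apply: (IH2 _ _ _ 0) => //.
  + exact: slice_lip.
  + by move=> y; rewrite Z normr0.
  + by move=> y _; rewrite Z.
Qed.

End integral_rV.

(** * Partitions of unity and normalised bumps *)

Lemma bump_supp_nbhs R m (q : 'rV[R]_m) (A : set 'rV[R]_m) : nbhs q A ->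
  exists2 k0 : R, 0 < k0 & forall k, k0 <= k -> bump_supp q k `<=` A.
Proof.
move=> /near_ball_norm[r r0 rA]; have r20 : 0 < r / 2 by rewrite divr_gt0.
exists ((r / 2) ^- 2) => [|k kk y yk]; first by rewrite invr_gt0 exprn_gt0.
apply: rA; apply: (@le_lt_trans _ _ (r / 2)); last lra.
apply: bump_supp_norm yk => //; apply: lt_le_trans kk.
by rewrite invr_gt0 exprn_gt0.
Qed.

Lemma bump_gt0 R m (q : 'rV[R]_m) k y : k * sqdist q y < 1 -> 0 < bump q k y.
Proof. by move=> H; apply: flat_gt0; rewrite subr_gt0. Qed.

Lemma bump_le1 R m (q : 'rV[R]_m) k y : bump q k y <= 1.
Proof. exact: flat_le1. Qed.

Lemma chart_extend_bump_ge0 R m (M : manifold R m) (c : chart M) q k x :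
  0 <= chart_extend c (bump q k) x.
Proof. by rewrite /chart_extend; case: ifP => // _; exact: bump_ge0. Qed.

Lemma chart_extend_bump_le1 R m (M : manifold R m) (c : chart M) q k x :
  chart_extend c (bump q k) x <= 1.
Proof. by rewrite /chart_extend; case: ifP => // _; exact: bump_le1. Qed.

Lemma compact_finite_cover (T : topologicalType) (U : T -> set T) :
  compact [set: T] -> (forall x, open (U x)) -> (forall x, U x x) ->
  exists s : seq T, forall x, exists2 y, y \in s & U y x.
Proof.
move=> cT oU xU; have [[q _]|T0] := pselect (exists _ : T, True); last first.
  by exists [::] => x; case: T0; exists x.
(* The characterisation of compactness by covers is applied to a pointed space, and [q] serves as
   the point. *)
pose PT : ptopologicalType := HB.pack (Topological.sort T) (isPointed.Build (Topological.sort T) q).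
have E := @compact_cover PT.
have : @compact PT [set: T] by [].
rewrite E => /(_ _ [set: T] U (fun x _ => oU x))[x _|D _ TD]; first by exists x.
exists (finmap.enum_fset D) => x; have [y yD yx] := TD x Logic.I; by exists y.
Qed.

Lemma partition_of_unity R n (M : symplectic_manifold R n) : compact [set: M] ->
  exists (k : nat) (c : 'I_k -> chart M) (rho : 'I_k -> M -> R),
    [/\ forall i, smooth_function (rho i), forall i x, 0 <= rho i x,
        forall i, exists K : set M,
          [/\ compact K, K `<=` chart_dom (c i) & forall x, ~ K x -> rho i x = 0] &
        forall x, \sum_(i < k) rho i x = 1].
Proof.
move=> cM.
have loc (x : M) : exists ck : chart M * R, [/\ chart_dom ck.1 x, 0 < ck.2 &
    bump_supp (to_coord ck.1 x) ck.2 `<=` chart_img ck.1].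
  have [c xc] := chart_cover x.
  have N : nbhs (to_coord c x) (chart_img c).
    by apply: open_nbhs_nbhs; split; [exact: open_chart_img|exact: to_coord_img].
  by have [k k0 kc] := bump_supp_nbhs N; exists (c, k); split => //; exact: kc.
have [ck ckP] := choice loc.
pose g (x y : M) := chart_extend (ck x).1 (bump (to_coord (ck x).1 x) (ck x).2) y.
pose U (x : M) : set M := [set y | chart_dom (ck x).1 y /\
   (ck x).2 * sqdist (to_coord (ck x).1 x) (to_coord (ck x).1 y) < 1].
have U_open x : open (U x).
  rewrite openE => y [yc y1]; rewrite /interior; apply: filterI.
    by apply: open_nbhs_nbhs; split => //; exact: open_chart_dom.
  have cf : {for to_coord (ck x).1 y, continuous
      (fun z => (ck x).2 * sqdist (to_coord (ck x).1 x) z)}.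
    by apply: continuousM; [exact: cst_continuous|exact: sqdist_continuous].
  have N : nbhs ((ck x).2 * sqdist (to_coord (ck x).1 x) (to_coord (ck x).1 y)) [set z : R | z < 1].
    by apply: open_nbhs_nbhs; split => //; exact: open_lt.
  exact: (continuous_comp (to_coord_cont yc) cf) _ N.
have Ug x y : U x y -> 0 < g x y.
  by move=> [yc y1]; rewrite /g chart_extendE//; exact: bump_gt0.
have xU x : U x x.
  have [xc _ _] := ckP x; split => //.
  by rewrite /sqdist big1 ?mulr0// => i _; rewrite subrr expr0n.
have [s Ms] := compact_finite_cover cM U_open xU.
pose S y := \sum_(i < size s) g (tnth (in_tuple s) i) y.
have S_gt0 y : 0 < S y.
  have [x /seq_tnthP[i xi] xy] := Ms y.
  rewrite /S (bigD1 i)//= ltr_wpDr//; last by rewrite -xi; exact: Ug.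
  by apply: sumr_ge0 => j _; exact: chart_extend_bump_ge0.
have sg x : smooth_function (g x).
  by have [_ k0 kc] := ckP x; exact: chart_extend_bump_smooth.
exists (size s), (fun i => (ck (tnth (in_tuple s) i)).1),
  (fun i y => g (tnth (in_tuple s) i) y / S y); split.
- move=> i; apply/smooth_functionP => d.
  have od := @open_chart_img _ _ _ d.
  apply: smoothM => //; first exact: (smooth_functionP _).1 (sg _) d.
  apply: smoothV => //; first by move=> y _; rewrite gt_eqF.
  by apply: smooth_sum => // j _; exact: (smooth_functionP _).1 (sg _) d.
- by move=> i y; rewrite divr_ge0//; [exact: chart_extend_bump_ge0|exact: ltW].
- move=> i; set x := tnth _ i; have [_ k0 kc] := ckP x.
  have cK := @bump_supp_compact _ _ (to_coord (ck x).1 x) _ k0.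
  exists (of_coord (ck x).1 @` bump_supp (to_coord (ck x).1 x) (ck x).2); split.
  + exact: chart_compact.
  + by move=> _ [y yK <-]; apply: of_coord_dom; exact: kc.
  + move=> y yK; rewrite (_ : g x y = 0) ?mul0r//.
    exact: (chart_extend0 (@bump_off _ _ _ _) yK).
- move=> y; have S0 : S y != 0 by rewrite lt0r_neq0// S_gt0.
  by rewrite -mulr_suml; exact: divff.
Qed.

Section liouville_piece.
Context {R : realType} {n : nat} {M : symplectic_manifold R n}.
Implicit Types (c : chart M) (f rho : M -> R).

Definition liouville_piece c rho f (y : 'rV[R]_(n + n)) : R :=
  if `[< chart_img c y >] then
    rho (of_coord c y) * f (of_coord c y) * liouville_density c y
  else 0.

(** Without the absolute value the density is a polynomial in the entries of omega, hence smooth. *)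
Definition signed_density c (y : 'rV[R]_(n + n)) : R :=
  2 ^- n * \sum_(s : 'S_(n + n)) (-1) ^+ s *
     \prod_(i < n) Defs.form c y (s (lshift n i)) (s (rshift n i)).

Lemma signed_density_smooth c : smooth_on (chart_img c) (signed_density c).
Proof.
have o := @open_chart_img _ _ _ c.
apply: smoothM => //; first exact: smooth_cst.
apply: smooth_sum => // s _; apply: smoothM => //; first exact: smooth_cst.
by apply: smooth_prod => // i _; exact: form_smooth_on.
Qed.

Lemma liouville_piece_comb c rho f1 f2 (a1 a2 : R) y :
  liouville_piece c rho (fun x => a1 * f1 x + a2 * f2 x) y =
  a1 * liouville_piece c rho f1 y + a2 * liouville_piece c rho f2 y.
Proof.
rewrite /liouville_piece; case: ifP => _; last by rewrite !mulr0 addr0.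
by ring.
Qed.

(** For nonnegative [rho] and [f] the integrand is the absolute value of a smooth compactly
    supported function, and taking absolute values keeps the Lipschitz constant. *)
Lemma liouville_piece_signed c rho f (K : set M) : smooth_function rho -> smooth_function f ->
    (forall x, 0 <= rho x) -> (forall x, 0 <= f x) ->
    compact K -> K `<=` chart_dom c -> (forall x, ~ K x -> rho x = 0) ->
  exists G : 'rV[R]_(n + n) -> R, [/\ smooth_on setT G,
    compact (to_coord c @` K), (forall y, ~ (to_coord c @` K) y -> G y = 0) &
    forall y, liouville_piece c rho f y = `|G y|].
Proof.
move=> srho sf rho0 f0 cK Kc rhoK.
have cK' : compact (to_coord c @` K).
  apply: continuous_compact => //; apply/subspace_continuousP => x Kx.
  by apply: cvg_within_filter; exact: (to_coord_cont (Kc _ Kx)).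
have o := @open_chart_img _ _ _ c.
pose G y := if `[< chart_img c y >] then
  rho (of_coord c y) * f (of_coord c y) * signed_density c y else 0.
have G0 y : ~ (to_coord c @` K) y -> G y = 0.
  move=> Ky; rewrite /G; case: asboolP => // yc; rewrite rhoK ?mul0r// => Ky'.
  by apply: Ky; exists (of_coord c y) => //; rewrite of_coordK.
exists G; split => //.
  apply: (@smooth_onW _ _ _ (chart_img c `|` ~` (to_coord c @` K))).
    move=> y _; have [[x Kx <-]|Ky] := pselect ((to_coord c @` K) y); last by right.
    by left; apply: to_coord_img; exact: Kc.
  apply: smooth_on_setU.
    apply: (@smooth_on_eq _ _ _ _ (fun y => rho (of_coord c y) * f (of_coord c y) * signed_density c y)) => //.
      by move=> y yc; rewrite /G; case: asboolP.
    apply: smoothM => //; last exact: signed_density_smooth.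
    by apply: smoothM => //; exact: (smooth_functionP _).1.
  have oK : open (~` (to_coord c @` K)) by apply: closed_openC; exact: rV_compact_closed.
  apply: (@smooth_on_eq _ _ _ _ (fun=> 0)) => //; last exact: smooth_cst.
  by move=> y Ky; rewrite G0.
move=> y; rewrite /liouville_piece /G; case: ifP => _; last by rewrite normr0.
by rewrite [RHS]normrM ger0_norm// mulr_ge0.
Qed.

Lemma liouville_piece_lipschitz c rho f (K : set M) : smooth_function rho -> smooth_function f ->
    (forall x, 0 <= rho x) -> (forall x, 0 <= f x) ->
    compact K -> K `<=` chart_dom c -> (forall x, ~ K x -> rho x = 0) ->
  lipschitz_supp (liouville_piece c rho f).
Proof.
move=> srho sf rho0 f0 cK Kc rhoK.
have [G [sG cK' G0 GE]] := liouville_piece_signed srho sf rho0 f0 cK Kc rhoK.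
have [L L0 HL] := compact_lipschitz cK' sG G0.
split.
  exists L => // a b; rewrite !GE; apply: le_trans (ler_dist_dist _ _) _; exact: HL.
have [N [Nr HN]] := compact_bounded cK'.
exists (`|N| + 1) => [|y yN]; first by rewrite addr_ge0.
rewrite GE G0 ?normr0// => Ky; move: yN; rewrite ltNge => /negP; apply.
by apply: HN => //; apply: le_lt_trans (ler_norm _) _; rewrite ltrDl.
Qed.

Lemma liouville_piece_bounded c rho (K : set M) : smooth_function rho ->
    (forall x, 0 <= rho x) ->
    compact K -> K `<=` chart_dom c -> (forall x, ~ K x -> rho x = 0) ->
  exists2 C : R, 0 <= C & forall f, (forall x, 0 <= f x <= 1) ->
    forall y, `|liouville_piece c rho f y| <= C.
Proof.
move=> srho rho0 cK Kc rhoK.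
have s1 : smooth_function (fun _ : M => 1 : R).
  by apply/smooth_functionP => d; exact: smooth_cst.
have [G [sG cK' G0 GE]] := @liouville_piece_signed c rho (fun=> 1) K srho s1 rho0 (fun=> ler01) cK Kc rhoK.
have cG : {in setT, continuous G} by move=> y _; exact: (smooth_continuous sG).
have [C C0 HC] := smooth_compact_bounded cK' cG G0.
exists C => // f f01 y; apply: le_trans (HC y).
rewrite -GE /liouville_piece; case: ifP => _; last by rewrite normr0.
have /andP[f0 f1] := f01 (of_coord c y).
rewrite !normrM /liouville_density normr_id (ger0_norm f0) ger0_norm//.
by rewrite ler_wpM2r// ler_wpM2l.
Qed.

(** Read in the chart [c], the part of a narrow bump that meets [K] fits into a ball of radius r, so
    its integral is at most C (2 r)^(2 n), with [C] independent of the bump. Positive dimension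
    makes this small. *)
Lemma liouville_piece_bump_small c rho (K : set M) (c0 : chart M) q (e : R) :
    (0 < n)%N -> smooth_function rho -> (forall x, 0 <= rho x) ->
    compact K -> K `<=` chart_dom c -> (forall x, ~ K x -> rho x = 0) ->
    chart_img c0 q -> 0 < e ->
  exists2 k0 : R, 0 < k0 & forall k, k0 <= k -> bump_supp q k `<=` chart_img c0 ->
    `|integral_rV (liouville_piece c rho (chart_extend c0 (bump q k)))| <= e.
Proof.
move=> n0 srho rho0 cK Kc rhoK qc e0.
have [C C0 HC] := liouville_piece_bounded srho rho0 cK Kc rhoK.
(* As 2 r <= 1, the power (2 r)^(2 n) is at most 2 r; the second bound on r then gives [e]. *)
pose r : R := Num.min 2^-1 (e / (2 * (C + 1))).
have C1 : 0 < 2 * (C + 1) by rewrite mulr_gt0// ltr_wpDl.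
have r0 : 0 < r by rewrite lt_min invr_gt0 ltr0n/= divr_gt0.
have Cr : C * (2 * r) ^+ (n + n) <= e.
  have r1 : 2 * r <= 1.
    have : r <= 2^-1 by rewrite ge_min lexx.
    by rewrite -(ler_pM2l (ltr0Sn R 1)) divff// pnatr_eq0.
  apply: (@le_trans _ _ (C * (2 * r))).
    rewrite ler_wpM2l//; have -> : (n + n = (n + n).-1.+1)%N by rewrite prednK// addn_gt0 n0.
    by rewrite exprS ler_piMr ?mulr_ge0 ?exprn_ile1 ?mulr_ge0// ltW.
  apply: (@le_trans _ _ ((2 * (C + 1)) * r)).
    by rewrite mulrA ler_wpM2r ?(ltW r0)// mulrDr; lra.
  by rewrite mulrC -ler_pdivlMr// ge_min lexx orbT.
pose x0 := of_coord c0 q; pose z := to_coord c x0.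
(* If [x0] lies outside [K], then [z] may be a meaningless value, but near [q] the condition is
   vacuous. *)
pose A := [set w | K (of_coord c0 w) -> `|to_coord c (of_coord c0 w) - z| < r].
have AN : nbhs q A.
  have [Kx|Kx] := pselect (K x0).
    have N := of_coord_cont qc (chart_nbhs (Kc _ Kx) r0).
    by apply: (filterS _ (N : nbhs q _)) => w [_ wr] _.
  have oK : nbhs x0 (~` K).
    apply: open_nbhs_nbhs; split => //; apply: closed_openC; apply: compact_closed => //.
    exact: manifold_hausdorff.
  have N := of_coord_cont qc oK.
  by apply: (filterS _ (N : nbhs q _)) => w Kw /Kw.
have [k0 k00 HA] := bump_supp_nbhs AN.
exists (Num.max k0 1) => [|k]; first by rewrite lt_max k00.
rewrite ge_max => /andP[k0k k1] kc; have k_gt0 := lt_le_trans ltr01 k1.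
have [_ H] := @integral_rV_properties R (n + n).
apply: le_trans Cr; apply: (H _ _ _ z); last 3 first.
- exact: ltW.
- apply: HC => x.
  by rewrite chart_extend_bump_ge0 chart_extend_bump_le1.
- move=> y ry; rewrite /liouville_piece; case: asboolP => // yc.
  have [Ky|Ky] := pselect (K (of_coord c y)); last by rewrite rhoK ?mul0r.
  have [[w wk wy]|Sy] := pselect ((of_coord c0 @` bump_supp q k) (of_coord c y)).
    have := HA k k0k w wk; rewrite /A/= wy => /(_ Ky).
    by rewrite of_coordK// ltNge (ltW ry).
  by rewrite (chart_extend0 (@bump_off _ _ _ _) Sy) mulr0 mul0r.
apply: (liouville_piece_lipschitz (K := K)) => //.
- exact: chart_extend_bump_smooth.
- by move=> x; exact: chart_extend_bump_ge0.
Qed.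

End liouville_piece.

(** A chart with values in the one-point space R^0 has at most one point in its open domain. *)
Lemma connected_dim0 R (M : manifold R 0) (q P : M) :
  connected [set: M] -> P = q.
Proof.
move=> cM; apply: (@connected_ind M [set: M] (fun x => x = q) q cM) => // t _.
have [c tc] := chart_cover t; exists (chart_dom c).
  by apply: open_nbhs_nbhs; split => //; exact: open_chart_dom.
move=> s s' _ _ sc sc' <-.
rewrite -(to_coordK sc) -(to_coordK sc'); congr of_coord.
by apply/rowP => -[].
Qed.

(** All bumps have the same value at their centre, so a1 + a2 != 0 says that the combination does
    not vanish there. *)
Lemma bump_combination R n (M : symplectic_manifold R n) (c : chart M) q (k0 : R) :
    connected [set: M] -> (exists x y : M, x <> y) -> chart_img c q -> 0 < k0 ->
    (forall k, k0 <= k -> bump_supp q k `<=` chart_img c) ->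
  exists (k1 k2 a1 a2 : R), [/\ k0 <= k1, k0 <= k2, a1 + a2 != 0 &
    compact [set: M] -> forall t, liouville_integral (fun x => t *
      (a1 * chart_extend c (bump q k1) x + a2 * chart_extend c (bump q k2) x)) 0].
Proof.
move=> connM [x [y xy]] qc k00 k0c.
have [cM|ncM] := pselect (compact [set: M]); last first.
  by exists k0, k0, 1, 0; split => //; rewrite addr0 oner_neq0.
have n0 : (0 < n)%N.
  by case: (n) M connM x y xy {qc k0c cM c q k00} => // M' connM' x y xy;
     case: xy; exact: connected_dim0.
have [N [d [rho [srho rho0 rhoK rho1]]]] := partition_of_unity cM.
pose J k := \sum_(i < N) integral_rV (liouville_piece (d i) (rho i) (chart_extend c (bump q k))).
have lip i k : k0 <= k -> lipschitz_supp (liouville_piece (d i) (rho i) (chart_extend c (bump q k))).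
  move=> kk; have k_gt0 := lt_le_trans k00 kk.
  have [K [cK Kd K0]] := rhoK i.
  apply: (liouville_piece_lipschitz (K := K)) => //.
    exact: chart_extend_bump_smooth k_gt0 (k0c k kk).
  by move=> z; exact: chart_extend_bump_ge0.
have JI k1 k2 (a1 a2 t : R) : k0 <= k1 -> k0 <= k2 -> a1 * J k1 + a2 * J k2 = 0 ->
    liouville_integral (fun x => t *
      (a1 * chart_extend c (bump q k1) x + a2 * chart_extend c (bump q k2) x)) 0.
  move=> kk1 kk2 E; exists N, d, rho; split => //.
  have E' : 0 = t * a1 * J k1 + t * a2 * J k2 by rewrite -!mulrA -mulrDr E mulr0.
  apply: (etrans E'); rewrite /J !mulr_sumr -big_split/=; apply: eq_bigr => i _.
  have [P _] := @integral_rV_properties R (n + n).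
  rewrite -P; [|exact: lip|exact: lip].
  congr integral_rV; apply/funext => z; rewrite -liouville_piece_comb /liouville_piece.
  by case: ifP => // _; congr (_ * _ * _); ring.
have [J0|J0] := eqVneq (J k0) 0.
  exists k0, k0, 1, 0; split => //.
  by move=> _ t; apply: JI => //; rewrite J0 !mulr0 addr0.
(* N terms of this size add up to less than |J k0|. *)
have e0 : 0 < `|J k0| / (2 * (N%:R + 1)).
  by rewrite divr_gt0 ?normr_gt0// mulr_gt0// ltr_wpDl.
have small i : exists k, 0 < k /\ forall k', k <= k' -> bump_supp q k' `<=` chart_img c ->
    `|integral_rV (liouville_piece (d i) (rho i) (chart_extend c (bump q k')))| <=
      `|J k0| / (2 * (N%:R + 1)).
  have [K [cK Kd K0]] := rhoK i.
  have [k k_gt0 H] := liouville_piece_bump_small n0 (srho i) (rho0 i) cK Kd K0 qc e0.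
  by exists k.
have [kf kfP] := choice small.
pose k2 := k0 + \sum_i kf i.
have k02 : k0 <= k2 by rewrite lerDl sumr_ge0// => i _; have [/ltW] := kfP i.
have kf2 i : kf i <= k2.
  rewrite /k2 (bigD1 i)//= addrCA lerDl addr_ge0 ?(ltW k00)// sumr_ge0// => j _.
  by have [/ltW] := kfP j.
have J2 : `|J k2| < `|J k0|.
  apply: le_lt_trans (ler_norm_sum _ _ _) _.
  apply: (@le_lt_trans _ _ (\sum_(i < N) (`|J k0| / (2 * (N%:R + 1))))).
    by apply: ler_sum => i _; have [_] := kfP i; apply; [exact: kf2|exact: k0c].
  have E (a b : R) : (a / b) *+ N = a * (N%:R / b) by rewrite -[LHS]mulr_natl mulrCA.
  rewrite sumr_const card_ord E gtr_pMr ?normr_gt0//.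
  have N0 : 0 <= N%:R :> R by [].
  by rewrite ltr_pdivrMr ?mulr_gt0 ?ltr_wpDl//; lra.
(* With these coefficients the two integrals cancel, and |J k2| < |J k0| keeps their sum from being
   0. *)
exists k0, k2, (J k2), (- J k0); split => //.
  by rewrite subr_eq0; apply: contraTneq J2 => ->; rewrite ltxx.
by move=> _ t; apply: JI => //; ring.
Qed.

(** * Separating points by countably many functions, and the conclusion *)

Lemma separating_generator R n (M : symplectic_manifold R n) (q P : M) :
    connected [set: M] -> q <> P ->
  exists (c : chart M) K b, [/\ generator c K b,
    tangent_field (fun t x => cutoff t * chart_extend c b x),
    chart_extend c b P = 0 & \forall x \near q, chart_extend c b x != 0].
Proof.
move=> connM qP; have [c qc] := chart_cover q.
pose z := to_coord c q; have zc : chart_img c z := to_coord_img qc.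
have oP : open (~` [set P]).
  apply: closed_openC; apply: accessible_closed_set1; apply: hausdorff_accessible.
  exact: manifold_hausdorff.
have zA : nbhs z [set w | chart_img c w /\ of_coord c w <> P].
  apply: filterI; first by apply: open_nbhs_nbhs; split => //; exact: open_chart_img.
  have N : nbhs (of_coord c z) (~` [set P]).
    by apply: open_nbhs_nbhs; split => //; rewrite /z to_coordK.
  exact: (of_coord_cont zc N : nbhs z _).
have [k0 k00 HA] := bump_supp_nbhs zA.
have k0c k : k0 <= k -> bump_supp z k `<=` chart_img c by move=> kk w /(HA _ kk)[].
have [k1 [k2 [a1 [a2 [kk1 kk2 a0 I0]]]]] :=
  bump_combination connM (ex_intro _ q (ex_intro _ P qP)) zc k00 k0c.
have k1_gt0 := lt_le_trans k00 kk1; have k2_gt0 := lt_le_trans k00 kk2.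
pose b w := a1 * bump z k1 w + a2 * bump z k2 w.
have gb : generator c (bump_supp z k1 `|` bump_supp z k2) b.
  by apply: generator_comb; apply: bump_generator => //; exact: k0c.
have [cK Kc sb bK _] := gb.
exists c, (bump_supp z k1 `|` bump_supp z k2), b; split => //.
- apply: (cutoff_tangent_field (K := of_coord c @` (bump_supp z k1 `|` bump_supp z k2))).
  + by rewrite chart_extend_comb; apply: smooth_function_comb;
      apply: chart_extend_bump_smooth => //; exact: k0c.
  + exact: chart_compact.
  + by move=> x; exact: chart_extend0.
  + by move=> cM t; rewrite chart_extend_comb; exact: I0.
- apply: (chart_extend0 bK) => -[w wK wP].
  by case: wK => [/(HA _ kk1)|/(HA _ kk2)] [].
have bq : b z != 0 by rewrite /b !bump_center -mulrDl mulf_neq0// gt_eqF// flat_gt0.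
have cb : {for z, continuous b} by exact: (smooth_continuous sb).
have N : nbhs (b z) [set y : R | y != 0].
  by apply: open_nbhs_nbhs; split => //; exact: open_neq.
have N' : nbhs q [set x | b (to_coord c x) != 0].
  exact: ((continuous_comp (to_coord_cont qc) cb) _ N : nbhs q _).
have N'' : nbhs q (chart_dom c) by apply: open_nbhs_nbhs; split => //; exact: open_chart_dom.
apply: filterS2 N' N'' => x bx xc.
by rewrite chart_extendE.
Qed.

(** One function is chosen for each basic open set on which some admissible function that vanishes
    at [P] has no zero; the injective numbering [f] recovers the set from its index. It is enough
    because [separating_generator] gives nonvanishing on a whole neighbourhood. *)
Lemma separating_sequence R n (M : symplectic_manifold R n) (P : M) :
    connected [set: M] ->
  exists F : nat -> M -> R,
    (forall i, F i = (fun=> 0) \/ exists (c : chart M) K b, [/\ generator c K b,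
      tangent_field (fun t x => cutoff t * chart_extend c b x) & F i = chart_extend c b]) /\
    (forall q, q <> P -> exists i, F i q <> F i P).
Proof.
move=> connM; have [B cB [_ bB]] := manifold_second_countable M.
have /countable_injP[f f_inj] := cB.
pose good (g : M -> R) := g P = 0 /\ exists (c : chart M) K b, [/\ generator c K b,
      tangent_field (fun t x => cutoff t * chart_extend c b x) & g = chart_extend c b].
have ex i : exists g, (g = (fun=> 0) \/ good g) /\ forall U, B U -> f U = i ->
    (exists2 g', good g' & forall x, U x -> g' x != 0) -> forall x, U x -> g x != 0.
  have [[U [BU fU [g gg Ug]]]|no] := pselect (exists U, [/\ B U, f U = i &
      exists2 g', good g' & forall x, U x -> g' x != 0]).
    exists g; split; first by right.
    move=> V BV fV _ x Vx; apply: Ug.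
    by have -> : U = V by apply: f_inj; rewrite ?inE// fU.
  exists (fun=> 0); split; first by left.
  by move=> U BU fU H; case: no; exists U.
have [F HF] := choice ex; exists F; split=> [i|q qP].
  by have [[F0|[_ gF]] _] := HF i; [left|right].
have [c [K [b [gb tb bP bq]]]] := separating_generator connM qP.
have [U [BU Uq] Ub] := bB q _ bq.
exists (f U); have [[F0|[FP _]] HU] := HF (f U).
  have : F (f U) q != 0.
    apply: (HU U) => //; exists (chart_extend c b) => //.
    by split => //; exists c, K, b; split.
  by rewrite F0 eqxx.
rewrite FP; apply/eqP; apply: (HU U) => //; exists (chart_extend c b) => //.
by split => //; exists c, K, b; split.
Qed.

Theorem proposition1p10 (R : realType) (n : nat) (M : symplectic_manifold R n)
    (M_connected : connected [set: M])
    (phi : R -> M -> M) (H : R -> M -> R)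
    (phi_path : Ham_c_path phi)
    (H_generates : generates H phi)
    (has_fixed_min : fixed_minima H !=set0)
    (has_fixed_max : fixed_maxima H !=set0)
    (phi_smooth_point : smooth_point phi) :
  exists p P : M,
    [/\ fixed_minima H p,
        fixed_maxima H P,
        fixed_minima H = [set p],
        fixed_maxima H = [set P] &
        (@lebesgue_measure R).-negligible
          [set t | `[0, 1]%classic t /\
                   ~ (min_set (H t) = [set p] /\ max_set (H t) = [set P])]].
Proof.
have [p minp] := has_fixed_min; have [P maxP] := has_fixed_max.
pose mu := @lebesgue_measure R.
have [F [goodF sepF]] := separating_sequence P M_connected.
have [G [goodG sepG]] := separating_sequence p M_connected.
have negF i : mu.-negligible [set t | `]0, 1[%classic t /\
    exists2 q, max_set (H t) q & F i q <> F i P].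
  have [F0|[c [K [b [gb tb FE]]]]] := goodF i.
    apply: negligibleS (@negligible_set0 _ _ _ mu) => t [_ [q _]].
    by rewrite F0.
  apply: negligibleS (first_variation M_connected phi_path H_generates minp maxP
    phi_smooth_point gb tb) => t [tI H1].
  by split => //; left; rewrite -FE.
have negG i : mu.-negligible [set t | `]0, 1[%classic t /\
    exists2 q, min_set (H t) q & G i q <> G i p].
  have [G0|[c [K [b [gb tb GE]]]]] := goodG i.
    apply: negligibleS (@negligible_set0 _ _ _ mu) => t [_ [q _]].
    by rewrite G0.
  apply: negligibleS (first_variation M_connected phi_path H_generates minp maxP
    phi_smooth_point gb tb) => t [tI H1].
  by split => //; right; rewrite -GE.
have neg1 (x : R) : mu.-negligible [set x].
  by apply/negligibleP => //; exact: lebesgue_measure_set1.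
pose bad : set R := [set t | `[0, 1]%classic t /\
  ~ (min_set (H t) = [set p] /\ max_set (H t) = [set P])].
have neg_bad : mu.-negligible bad.
  apply: negligibleS (negligibleU (negligibleU (negligible_bigcup negF) (negligible_bigcup negG))
    (negligibleU (neg1 0) (neg1 1))) => t [tI badt].
  (* The first variation only covers the open interval, so the end points enter as null sets. *)
  have [t0|t0] := eqVneq t 0; first by right; left.
  have [t1|t1] := eqVneq t 1; first by right; right.
  have tI' : `]0, 1[%classic t.
    move: tI; rewrite /= !in_itv/= => /andP[t_ge0 t_le1].
    by rewrite !lt_neqAle eq_sym t0 t1 t_ge0.
  left; apply: contrapT => H0; apply: badt; split.
    apply/seteqP; split=> [q qm|_ ->]; last exact: minp.
    apply: contrapT => /sepG[i Gi]; apply: H0; right.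
    by exists i => //; split => //; exists q.
  apply/seteqP; split=> [q qm|_ ->]; last exact: maxP.
  apply: contrapT => /sepF[i Fi]; apply: H0; left.
  by exists i => //; split => //; exists q.
(* A null set cannot exhaust [0, 1]. One good time determines both intersections, since every fixed
   extremum is an extremum at that time. *)
have [t tI tgood] : exists2 t, `[0, 1]%classic t & ~ bad t.
  apply: contrapT => H0.
  have : mu.-negligible (`[0, 1]%classic : set R).
    apply: negligibleS neg_bad => t tI; apply: contrapT => tb; apply: H0; by exists t.
  move/negligibleP => /(_ (measurable_itv _)) mu0.
  have : mu (`[0, 1]%classic : set R) = 1%:E.
    by rewrite /mu lebesgue_measure_itv/= lte_fin ltr01 -EFinB subr0.
  by move=> /(etrans (esym mu0)) [] /esym/eqP; rewrite oner_eq0.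
have [minE maxE] : min_set (H t) = [set p] /\ max_set (H t) = [set P].
  by apply: contrapT => H0; apply: tgood.
exists p, P; split => //.
- apply/seteqP; split=> [q qm|_ ->//].
  by rewrite -minE; exact: qm.
- apply/seteqP; split=> [q qm|_ ->//].
  by rewrite -maxE; exact: qm.
Qed.
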